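(* Suppose that $\mathbb M$ has definable Skolem functions. Let $X$ be a Hausdorff, locally definably compact definable space. If $C\subseteq X$ is a definable subset which is not closed, then for every $z\in\overline{C}\setminus C$ there is a definable open neighborhood $V$ of $z$ in $X$ such that $\overline{V}$ is definably compact, and there is a definable set $E\subseteq(\overline{C}\setminus C)\cap V$ such that $\dim E<\dim((\overline{C}\cap V)\setminus(C\cap V))$ and for every $x\in(\overline{C}\cap V)\setminus((C\cap V)\cup E)$ there is a definable curve in $C\cap V$ which has $x$ as a limit point.
   Context: $\mathbb M=(M,<,\ldots)$ is an arbitrary o-minimal structure; ''definable'' means definable in $\mathbb M$, possibly with parameters. $\mathbb M$ has definable Skolem functions if for every uniformly definable family $\{F_t\}_{t\in T}$ of nonempty definable sets there is a definable map $f:T\to\bigcup_t F_t$ with $f(t)\in F_t$ for all $t\in T$. A definable space is a set $X=\bigcup_{i\le k}X_i$ with injections (definable charts) $\theta_i:X_i\to M^{n_i}$ ($i\le k$, $k$ finite) such that each $\theta_i(X_i)$ is a definable subset of $M^{n_i}$ (with the induced topology), each $\theta_i(X_i\cap X_j)$ is an open definable subset of $\theta_i(X_i)$, and each transition map $\theta_j\circ\theta_i^{-1}:\theta_i(X_i\cap X_j)\to\theta_j(X_i\cap X_j)$ is a definable homeomorphism. $X$ carries the topology in which each $X_i$ is open and each $\theta_i$ is a homeomorphism. A subset $A\subseteq X$ is definable if each $\theta_i(A\cap X_i)$ is definable; it is then itself a definable space with the induced topology. The dimension of a definable space is $\dim X=\max_i\dim\theta_i(X_i)$ (with $\dim\emptyset=-\infty$).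 A map $f:X\to Y$ between definable spaces with charts $(X_i,\theta_i)$, $(Y_j,\delta_j)$ is definable if each $\delta_j\circ f\circ\theta_i^{-1}$ (on its natural domain) is a definable map between definable sets. $\overline{A}$ denotes the closure of $A$ in $X$. A definable curve in a definable subset $C\subseteq X$ is a continuous definable map $\alpha:(a,b)\to C$, with $a<b$ in $M\cup\{-\infty,+\infty\}$. It has $x\in X$ as a limit point if $x=\lim_{t\to a^+}\alpha(t)$ or $x=\lim_{t\to b^-}\alpha(t)$. It is completable in $C$ if both limits $\lim_{t\to a^+}\alpha(t)$ and $\lim_{t\to b^-}\alpha(t)$ exist in $C$. $C$ is definably compact if every definable curve in $C$ is completable in $C$. $X$ is locally definably compact if every $x\in X$ has a definably compact (definable) neighborhood. *)

(* Defs.v *)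
From HB Require Import structures.
From mathcomp Require Import all_boot all_order all_algebra.
From mathcomp Require Import all_classical topology constructive_ereal.

Set Implicit Arguments.
Unset Strict Implicit.
Unset Printing Implicit Defensive.

Import Order.TTheory GRing.Theory Num.Theory.
Local Open Scope classical_set_scope.
Local Open Scope order_scope.

Record language := Language {
  fsym : Type;
  farity : fsym -> nat;
  rsym : Type;
  rarity : rsym -> nat }.

Inductive fo_term (L : language) : Type :=
| TVar of nat
| TApp (f : fsym L) of ('I_(farity f) -> fo_term L).

(* The order symbol is part of the syntax, so [L] lists only the symbols that
   come in addition to [<]. *)
Inductive fo_formula (L : language) : Type :=
| FFalse
| FEq of fo_term L & fo_term L
| FLt of fo_term L & fo_term L
| FRel (r : rsym L) of ('I_(rarity r) -> fo_term L)
| FImp of fo_formula L & fo_formula L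
| FAll of nat & fo_formula L.

Record structure (L : language) (M : Type) := Structure {
  finterp : forall f : fsym L, ('I_(farity f) -> M) -> M;
  rinterp : forall r : rsym L, ('I_(rarity r) -> M) -> Prop }.

Section OMinimal.
Context {d : Order.disp_t} {M : orderTopologicalType d} {L : language}.
Variable S : structure L M.

Fixpoint eval (e : nat -> M) (t : fo_term L) : M :=
  match t with
  | TVar k => e k
  | TApp f ts => finterp S (fun i => eval e (ts i))
  end.

Fixpoint sat (e : nat -> M) (p : fo_formula L) : Prop :=
  match p with
  | FFalse => False
  | FEq t u => eval e t = eval e u
  | FLt t u => eval e t < eval e u
  | FRel r ts => rinterp S (fun i => eval e (ts i))
  | FImp p q => sat e p -> sat e q
  | FAll k p => forall a : M, sat (fun j => if j == k then a else e j) p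
  end.

(* Definable with parameters: the variables below [n] are the coordinates of
   the point, the remaining ones are the parameters, given by [e]. *)
Definition definable n (A : set 'rV[M]_n) : Prop :=
  exists (p : fo_formula L) (e : nat -> M), forall x : 'rV[M]_n,
    A x <-> sat (fun k => oapp (x ord0) (e k) (insub k)) p.

Definition definable_map m n (A : set 'rV[M]_m) (f : 'rV[M]_m -> 'rV[M]_n) :
  Prop := definable [set row_mx x (f x) | x in A].

(* The interval ]a, b[ with endpoints in M u {-oo, +oo}: [None] is -oo as a
   left endpoint and +oo as a right endpoint. *)
Definition oo_itv (a b : option M) : set M :=
  [set t | (if a is Some x then x < t else true) /\
           (if b is Some y then t < y else true)].

Definition oo_lt (a b : option M) : bool :=
  if a is Some x then if b is Some y then x < y else true else true.

Definition o_minimal : Prop :=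
  [/\ inhabited M,
      forall x y : M, x < y -> exists z, x < z < y,
      forall x : M, exists y z, y < x < z &
      forall A : set M, definable [set x : 'rV[M]_1 | A (x ord0 ord0)] ->
        exists (F : seq M) (s : seq (option M * option M)), forall t,
          A t <-> t \in F \/ exists2 J, J \in s & oo_itv J.1 J.2 t].

(* A uniformly definable family is given by its index set [T] and its total
   space [F], with fibres F_t = [set y | F (row_mx t y)]. *)
Definition definable_skolem_functions : Prop :=
  forall m n (T : set 'rV[M]_m) (F : set 'rV[M]_(m + n)),
    definable T -> definable F ->
    (forall t, T t -> exists y, F (row_mx t y)) ->
    exists2 f : 'rV[M]_m -> 'rV[M]_n,
      definable_map T f & forall t, T t -> F (row_mx t (f t)).

Definition definable_cont n (C : set 'rV[M]_n) (f : 'rV[M]_n -> M) : Prop :=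
  definable_map C (fun x => const_mx (f x) : 'rV[M]_1) /\
  {within C, continuous f}.

(* [cell r C]: C is an (i_1, ..., i_n)-cell with i_1 + ... + i_n = r. *)
Inductive cell : forall n : nat, nat -> set 'rV[M]_n -> Prop :=
| cell_point : @cell 0 0 setT
| cell_graph n r (C : set 'rV[M]_n) (f : 'rV[M]_n -> M) :
    cell r C -> definable_cont C f ->
    @cell (n + 1) r [set x | C (lsubmx x) /\
                             rsubmx x ord0 ord0 = f (lsubmx x)]
| cell_band n r (C : set 'rV[M]_n) (f g : option ('rV[M]_n -> M)) :
    cell r C ->
    (if f is Some f' then definable_cont C f' else True) ->
    (if g is Some g' then definable_cont C g' else True) ->
    (forall x, C x ->
      oo_lt (omap (fun h => h x) f) (omap (fun h => h x) g)) ->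
    @cell (n + 1) r.+1
      [set x | C (lsubmx x) /\
               oo_itv (omap (fun h => h (lsubmx x)) f)
                      (omap (fun h => h (lsubmx x)) g) (rsubmx x ord0 ord0)].

(* The largest dimension of a cell contained in A; -oo if A is empty. *)
Definition dimM n (A : set 'rV[M]_n) : \bar int :=
  \big[maxe/-oo%E]_(r < n.+1 | `[< exists2 C, cell r C & C `<=` A >])
    (Posz r)%:E.

Definition rel_open (T : topologicalType) (A B : set T) : Prop :=
  exists2 O, open O & B = A `&` O.

(* A definable space is a topological space with a finite atlas; [chart i] is
   total, but only its values on [dom i] matter. [ds_dom_open] and
   [ds_chart_homeo] say that the topology of X is the one glued from the
   charts. *)
Record definable_space (X : topologicalType) := DefinableSpace {
  ncharts : nat;
  dom : 'I_ncharts -> set X;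
  chdim : 'I_ncharts -> nat;
  chart : forall i, X -> 'rV[M]_(chdim i);
  ds_cover : \bigcup_i dom i = setT;
  ds_inj : forall i, {in dom i &, injective (chart i)};
  ds_image_definable : forall i, definable (chart i @` dom i);
  ds_overlap_definable : forall i j, definable (chart i @` (dom i `&` dom j));
  ds_overlap_open : forall i j,
    rel_open (chart i @` dom i) (chart i @` (dom i `&` dom j));
  ds_transition_definable : forall i j,
    definable [set row_mx (chart i x) (chart j x) | x in dom i `&` dom j];
  ds_transition_homeo : forall i j U, U `<=` dom i `&` dom j ->
    rel_open (chart i @` (dom i `&` dom j)) (chart i @` U) <->
    rel_open (chart j @` (dom i `&` dom j)) (chart j @` U);
  ds_dom_open : forall i, open (dom i);
  ds_chart_homeo : forall i U, U `<=` dom i ->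
    open U <-> rel_open (chart i @` dom i) (chart i @` U) }.

Arguments dom {X} _ _.
Arguments chart {X} _ _ _.

Section Space.
Context {X : topologicalType}.
Variable D : definable_space X.

Definition definable_sub (A : set X) : Prop :=
  forall i, definable (chart D i @` (A `&` dom D i)).

(* The dimension of the definable space A, whose charts are the restrictions
   of those of X. *)
Definition dimX (A : set X) : \bar int :=
  \big[maxe/-oo%E]_(i < ncharts D) dimM (chart D i @` (A `&` dom D i)).

(* Only the restriction of [c] to ]a, b[ matters. *)
Definition definable_curve (C : set X) (a b : option M) (c : M -> X) : Prop :=
  [/\ oo_lt a b,
      forall t, oo_itv a b t -> C (c t),
      {within oo_itv a b, continuous c} &
      forall j, definable
        [set row_mx (const_mx t : 'rV[M]_1) (chart D j (c t))
           | t in oo_itv a b `&` c @^-1` dom D j]].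

(* The filters t -> a^+ and t -> b^- on ]a, b[. *)
Definition at_left_end (a b : option M) : set_system M :=
  [set P | exists2 s, oo_itv a b s & oo_itv a (Some s) `<=` P].

Definition at_right_end (a b : option M) : set_system M :=
  [set P | exists2 s, oo_itv a b s & oo_itv (Some s) b `<=` P].

Definition curve_limit_point (a b : option M) (c : M -> X) (x : X) : Prop :=
  c @ at_left_end a b --> x \/ c @ at_right_end a b --> x.

Definition completable (C : set X) (a b : option M) (c : M -> X) : Prop :=
  (exists2 x, C x & c @ at_left_end a b --> x) /\
  (exists2 y, C y & c @ at_right_end a b --> y).

Definition definably_compact (C : set X) : Prop :=
  definable_sub C /\
  forall a b c, definable_curve C a b c -> completable C a b c.

Definition locally_definably_compact : Prop :=
  forall x : X, exists2 K, nbhs x K & definably_compact K.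

End Space.
End OMinimal.

(* Main.v *)
Require Import Defs.
From mathcomp Require Import all_boot all_order all_algebra.
From mathcomp Require Import all_classical topology constructive_ereal.

(** The difficulty is that there need not be any definable family of
    neighbourhoods of a point that depends on a single parameter: neighbourhoods
    are boxes, and the endpoints of their sides may be definably unrelated. So a
    point [x] of the closure of [A] is approached by a map [p] of all the [2n]
    endpoints of a box around [x], chosen by definable Skolem functions with
    values in [A] and in the box. Inside a definably compact set the limits of
    [p] in its variables, taken one after the other, all exist, because a
    definable map of one variable is eventually continuous on each side of a
    point ([ev_continuous], from [monotonicity]). As the space is Hausdorff, the
    final iterated limit can only be [x] ([iterated_limit]).

    This is used twice. First, definably compact sets are closed
    ([compact_closed]); hence for [V] one can take a box of a chart inside a
    definably compact neighbourhood of [z]. Secondly, let [x] be in the frontier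
    of [A], the intersection of [C] with [V]. The iterated limit starts in [A]
    and ends at [x], which is not in [A], so at some stage, arbitrarily close to
    [x], a map [t |-> q_i (.., t, ..)] with values in [A] has its limit outside
    [A] ([descend]). The set [R] of the limits arising in this way is definable,
    consists of limits of definable curves in [A], and is dense in the frontier
    [F] ([reachable_dense]). Let [E] be [F] minus [R].

    It remains to see that [dim E < dim F] ([dense_dim]). A cell of dimension [r]
    in the image of [E] under a chart lies in the frontier of the image of [R],
    and then the latter contains a cell of dimension [r + 1] ([frontier_cell]).
    So the dimensions are compared inside each chart.

    The theorem [frontier_cell] rests on the generic behaviour of definable
    sets and functions on boxes: for any partition of a box into two definable
    sets, one of them contains a box, and any definable function is continuous
    on some smaller box ([generic], by simultaneous induction on the dimension).
    Applied along definable sections, these two facts produce the cells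
    ([image_box_cell]).

    Definability is handled by a small calculus. A type with coordinates ([ctx])
    is a type whose points are identified by finitely many elements of [M], with
    a definable set of possible coordinates; besides [M], row vectors and
    products, the space [X] is such a type. Definable predicates and maps are
    closed under the logical operations, quantification over such types and
    composition, and the tactic [dfn] applies these rules. *)

Set Implicit Arguments.
Unset Strict Implicit.
Unset Printing Implicit Defensive.

Import Order.TTheory.
Local Open Scope order_scope.
Local Open Scope classical_set_scope.

(** * Definability of predicates on indexed families of elements *)

Section Indexed.
Context {d : Order.disp_t} {M : orderTopologicalType d} {L : language}.
Variable S : structure L M.
Variable m0 : M.
Implicit Types (t : fo_term L) (p : fo_formula L) (e : nat -> M).

Definition upd e k (a : M) : nat -> M := fun j => if j == k then a else e j.

Lemma eval_rename (r : nat -> nat) t :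
  exists t', forall e, Defs.eval S e t' = Defs.eval S (e \o r) t.
Proof.
elim: t => [k|f ts IH]; first by exists (TVar L (r k)).
have [ts' Hts] := choice IH.
by exists (TApp ts') => e /=; congr (finterp S); apply/funext => i; apply: Hts.
Qed.

Lemma eval_finite t :
  exists N, forall e e', (forall k, (k < N)%N -> e k = e' k) ->
    Defs.eval S e t = Defs.eval S e' t.
Proof.
elim: t => [k|f ts IH]; first by exists k.+1 => e e' H; apply: H.
have [Ns HN] := choice IH.
exists (\max_(i < farity f) Ns i) => e e' H /=.
congr (finterp S); apply/funext => i; apply: HN => k Hk.
exact/H/(leq_trans Hk)/(leq_bigmax i).
Qed.

Lemma sat_finite p :
  exists N, forall e e', (forall k, (k < N)%N -> e k = e' k) ->
    sat S e p <-> sat S e' p.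
Proof.
have two t u : exists N, forall e e', (forall k, (k < N)%N -> e k = e' k) ->
    Defs.eval S e t = Defs.eval S e' t /\ Defs.eval S e u = Defs.eval S e' u.
  have [N HN] := eval_finite t; have [N' HN'] := eval_finite u.
  exists (maxn N N') => e e' H; split.
    by apply: HN => k Hk; apply: H; rewrite leq_max Hk.
  by apply: HN' => k Hk; apply: H; rewrite leq_max Hk orbT.
elim: p => [|t u|t u|r ts|p [N HN] q [N' HN']|k p [N HN]].
- by exists 0%N.
- by have [N HN] := two t u; exists N => e e' /HN [/= -> ->].
- by have [N HN] := two t u; exists N => e e' /HN [/= -> ->].
- have [Ns HN] := choice (fun i => eval_finite (ts i)).
  exists (\max_(i < rarity r) Ns i) => e e' H /=.
  suff -> : (fun i => Defs.eval S e (ts i)) = (fun i => Defs.eval S e' (ts i)) by [].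
  apply/funext => i; apply: HN => k Hk.
  exact/H/(leq_trans Hk)/(leq_bigmax i).
- exists (maxn N N') => e e' H /=.
  have -> : sat S e p <-> sat S e' p.
    by apply: HN => k Hk; apply: H; rewrite leq_max Hk.
  have -> // : sat S e q <-> sat S e' q.
  by apply: HN' => k Hk; apply: H; rewrite leq_max Hk orbT.
- exists N => e e' H /=.
  split=> Hs a; have := Hs a; apply HN => j Hj /=; case: ifP => // _.
    by rewrite H.
  exact: H.
Qed.

(** Renaming has to avoid capture: a bound variable is moved past the images
    of the finitely many variables that the formula can see. *)
Lemma sat_rename (r : nat -> nat) p :
  exists p', forall e, sat S e p' <-> sat S (e \o r) p.
Proof.
elim: p r => [|t u|t u|s ts|p IHp q IHq|k p IH] r.
- by exists (FFalse L).
- have [t' Ht] := eval_rename r t; have [u' Hu] := eval_rename r u.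
  by exists (FEq t' u') => e /=; rewrite Ht Hu.
- have [t' Ht] := eval_rename r t; have [u' Hu] := eval_rename r u.
  by exists (FLt t' u') => e /=; rewrite Ht Hu.
- have [ts' Hts] := choice (fun i => eval_rename r (ts i)).
  exists (FRel ts') => e /=.
  suff -> : (fun i => Defs.eval S e (ts' i)) = (fun i => Defs.eval S (e \o r) (ts i)).
    by [].
  by apply/funext => i; apply: Hts.
- have [p' Hp] := IHp r; have [q' Hq] := IHq r.
  by exists (FImp p' q') => e /=; rewrite Hp Hq.
- have [N HN] := sat_finite p.
  set m := (\max_(j < N) r j).+1.
  have [p' Hp] := IH (fun j => if j == k then m else r j).
  exists (FAll m p') => e /=.
  have E a : sat S (upd e m a) p' <->
      sat S (fun j => if j == k then a else (e \o r) j) p.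
    rewrite Hp; apply: HN => j Hj; rewrite /upd /=.
    case: (j == k); first by rewrite eqxx.
    have Hrj : (r j <= \max_(i < N) r i)%N.
      by rewrite (leq_bigmax_cond (Ordinal Hj)).
    by rewrite ltn_eqF.
  by split=> H a; apply/E/H.
Qed.

Definition asg (I : Type) (e : nat -> I + M) (v : I -> M) : nat -> M :=
  fun k => match e k with inl i => v i | inr c => c end.

(** Each variable of the formula is assigned a coordinate or a parameter, in
    any order. This leaves no arithmetic on variable numbers in the closure
    properties. *)
Definition defI (I : Type) (A : (I -> M) -> Prop) : Prop :=
  exists p (e : nat -> I + M), forall v, A v <-> sat S (asg e v) p.

Lemma defI_ext I (A B : (I -> M) -> Prop) :
  (forall v, A v <-> B v) -> defI A -> defI B.
Proof. by move=> AB [p [e H]]; exists p, e => v; rewrite -AB. Qed.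

Lemma defI_sub I J (r : J -> I) (A : (J -> M) -> Prop) :
  defI A -> defI (fun v : I -> M => A (v \o r)).
Proof.
move=> [p [e H]].
exists p, (fun k => match e k with inl j => inl (r j) | inr c => inr c end).
move=> v; rewrite H; suff -> : asg e (v \o r) = asg
  (fun k => match e k with inl j => inl (r j) | inr c => inr c end) v by [].
by apply/funext => k; rewrite /asg /=; case: (e k).
Qed.

Lemma defI_False I : @defI I (fun=> False).
Proof. by exists (FFalse L), (fun=> inr m0). Qed.

Lemma defI_lt I (i j : I) : defI (fun v => v i < v j).
Proof.
exists (FLt (TVar L 0) (TVar L 1)).
by exists (fun k => if k == 0%N then inl i else inl j).
Qed.

Lemma defI_eqc I (i : I) (c : M) : defI (fun v => v i = c).
Proof.
exists (FEq (TVar L 0) (TVar L 1)).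
by exists (fun k => if k == 0%N then inl i else inr c).
Qed.

Lemma defI_eq I (i j : I) : defI (fun v => v i = v j).
Proof.
exists (FEq (TVar L 0) (TVar L 1)).
by exists (fun k => if k == 0%N then inl i else inl j).
Qed.

Lemma defI_imp I (A B : (I -> M) -> Prop) :
  defI A -> defI B -> defI (fun v => A v -> B v).
Proof.
move=> [p [e He]] [q [f Hf]].
have [p' Hp] := sat_rename double p.
have [q' Hq] := sat_rename (fun k => k.*2.+1) q.
exists (FImp p' q'), (fun k => if odd k then f k./2 else e k./2) => v /=.
set g := asg _ _; rewrite Hp Hq He Hf.
have -> : g \o double = asg e v.
  by apply/funext => k; rewrite /g /asg /= odd_double doubleK.
suff -> : g \o (fun k => k.*2.+1) = asg f v by [].
by apply/funext => k; rewrite /g /asg /= odd_double uphalf_double.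
Qed.

Lemma defI_not I (A : (I -> M) -> Prop) : defI A -> defI (fun v => ~ A v).
Proof. by move=> /defI_imp; apply; apply: defI_False. Qed.

Lemma defI_and I (A B : (I -> M) -> Prop) :
  defI A -> defI B -> defI (fun v => A v /\ B v).
Proof.
move=> dA dB; apply: (@defI_ext _ (fun v => ~ (A v -> ~ B v))) => [v|].
  split=> [|[a b]]; last exact.
  by move=> /not_implyP [a /contrapT].
exact/defI_not/defI_imp/defI_not.
Qed.

Definition sumv I J (v : I -> M) (w : J -> M) : I + J -> M :=
  fun i => match i with inl i => v i | inr j => w j end.

Lemma defI_all1 I (A : (I + unit -> M) -> Prop) :
  defI A -> defI (fun v => forall a, A (sumv v (fun=> a))).
Proof.
move=> [p [e He]].
have [p' Hp] := sat_rename (fun k => if e k is inl (inr _) then 0 else k.+1) p.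
exists (FAll 0 p'), (fun k => match e k.-1 with
   inl (inl i) => inl i | inr c => inr c | _ => inr m0 end) => v /=.
set g := asg _ v.
have E a : sat S (upd g 0 a) p' <-> A (sumv v (fun=> a)).
  rewrite He Hp; suff -> : upd g 0 a \o
    (fun k => if e k is inl (inr _) then 0 else k.+1) =
    asg e (sumv v (fun=> a)) by [].
  by apply/funext => k; rewrite /upd /g /asg /=; case E: (e k) => [[]|] //=;
    rewrite E.
by split=> H a; apply/E/H.
Qed.

Lemma sumv0 I (v : I -> M) (w : 'I_0 -> M) (r : I + 'I_0 -> I) :
  (forall i, r (inl i) = i) -> v \o r = sumv v w.
Proof. by move=> E; apply/funext => -[i|[]//]; rewrite /= E. Qed.

Lemma defI_allord I n (A : (I + 'I_n -> M) -> Prop) :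
  defI A -> defI (fun v => forall w, A (sumv v w)).
Proof.
elim: n I A => [|n IH] I A dA.
  pose r (i : I + 'I_0) : I := match i with inl i => i
    | inr j => False_rect I (notF (ltn_ord j)) end.
  apply: (defI_ext _ (defI_sub r dA)) => v.
  have E w : v \o r = sumv v w by apply: sumv0.
  by rewrite (E (fun=> m0)); split=> [H w|]; [rewrite -(E w) (E (fun=> m0))|].
pose r (i : I + 'I_n.+1) : (I + unit) + 'I_n := match i with
  | inl i => inl (inl i)
  | inr j => if unlift ord0 j is Some k then inr k else inl (inr tt) end.
apply: (defI_ext _ (defI_all1 (IH _ _ (defI_sub r dA)))) => v; split.
  move=> H w; have := H (w ord0) (fun k => w (lift ord0 k)).
  suff -> : sumv (sumv v (fun=> w ord0)) (fun k => w (lift ord0 k)) \o r =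
    sumv v w by [].
  by apply/funext => -[i|j] //=; case: unliftP => [k|] ->.
move=> H a w.
have := H (fun j => if unlift ord0 j is Some k then w k else a).
suff -> : sumv v (fun j => if unlift ord0 j is Some k then w k else a) =
  sumv (sumv v (fun=> a)) w \o r by [].
by apply/funext => -[i|j] //=; case: unliftP.
Qed.

Lemma defI_all I (J : finType) (A : (I + J -> M) -> Prop) :
  defI A -> defI (fun v => forall w, A (sumv v w)).
Proof.
move=> dA.
pose r (i : I + J) : I + 'I_#|J| := match i with
  inl i => inl i | inr j => inr (enum_rank j) end.
apply: (defI_ext _ (defI_allord (defI_sub r dA))) => v.
have E w : sumv v (w \o enum_val) \o r = sumv v w.
  by apply/funext => -[i|j] //=; rewrite enum_rankK.
have E' w : sumv v w \o r = sumv v (w \o enum_rank) by apply/funext => -[].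
by split=> H w; [rewrite -E; apply: H | rewrite E'; apply: H].
Qed.

Lemma defI_ex I (J : finType) (A : (I + J -> M) -> Prop) :
  defI A -> defI (fun v => exists w, A (sumv v w)).
Proof.
move=> dA; apply: (defI_ext _ (defI_not (defI_all (defI_not dA)))) => v.
by split=> [/existsNP [w /contrapT]|[w Aw] /(_ w)]; [exists w|].
Qed.

Lemma defI_allfin I (J : finType) (A : J -> (I -> M) -> Prop) :
  (forall j, defI (A j)) -> defI (fun v => forall j, A j v).
Proof.
move=> dA.
suff H (s : seq J) : defI (fun v => forall j, j \in s -> A j v).
  apply: (defI_ext _ (H (enum J))) => v.
  by split=> H' j; first apply: H'; rewrite ?mem_enum.
elim: s => [|i s IH].
  by apply: (defI_ext _ (defI_not (@defI_False I))) => v; split=> // _ j.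
apply: (defI_ext _ (defI_and (dA i) IH)) => v; split.
  by move=> [a H j]; rewrite inE => /predU1P [->|/H].
by move=> H; split=> [|j js]; apply: H; rewrite inE ?eqxx ?js ?orbT.
Qed.

Lemma defI_exfin I (J : finType) (A : J -> (I -> M) -> Prop) :
  (forall j, defI (A j)) -> defI (fun v => exists j, A j v).
Proof.
move=> dA; have dn := defI_not (defI_allfin (fun j => defI_not (dA j))).
apply: (defI_ext _ dn) => v.
by split=> [/existsNP [i /contrapT]|[i Ai] /(_ i)]; [exists i|].
Qed.

(** Parameters are renumbered from [n] on, to make room for the coordinates. *)
Lemma definable_defI n (A : set 'rV[M]_n) :
  definable S A <-> defI (fun v : 'I_n -> M => A (\row_i v i)%R).
Proof.
split=> [[p [e H]]|[p [f H]]].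
  exists p, (fun k => if insub k is Some i then inl i else inr (e k)) => v.
  rewrite H; set g := fun k => _; set h := asg _ _.
  suff -> : g = h by [].
  apply/funext => k; rewrite /g /h /asg.
  by case: insubP => //= i _ _; rewrite mxE.
have [p' Hp] := sat_rename
  (fun k => match f k with inl i => nat_of_ord i | inr _ => n + k end)%N p.
exists p', (fun k => if f (k - n)%N is inr c then c else m0) => x.
have {1}-> : x = (\row_i x ord0 i)%R by apply/rowP => i; rewrite mxE.
rewrite H Hp; set g := asg _ _; set h := _ \o _.
suff -> : g = h by [].
apply/funext => k; rewrite /g /h /asg /=; case E: (f k) => [i|c].
  by rewrite valK.
by rewrite insubF ?addKn ?E //= ltnNge leq_addr.
Qed.

End Indexed.

(** * Definable predicates and maps on types with coordinates *)

(** The default value for total extensions of partial functions. *)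
Class has_point (T : Type) := pt : T.

(** [ctx S T] makes [T] a definable set: finitely many coordinates in [M]
    identify its points. The instances below are [M], row vectors, products and
    the points of a definable space, so that one calculus of definability
    serves them all. *)
Class ctx {d : Order.disp_t} {M : orderTopologicalType d} {L : language}
    (S : structure L M) (T : Type) := Ctx {
  cidx : finType;
  crd : T -> cidx -> M;
  crd_inj : forall x y, crd x = crd y -> x = y;
  crd_def : defI S (fun v => exists x, crd x = v) }.
Arguments crd {d M L S T _} x i.
Arguments cidx {d M L S} T {_}.

Definition ifp {T : Type} (P : Prop) (a b : T) : T := if `[< P >] then a else b.

Lemma ifpT T (P : Prop) (a b : T) : P -> ifp P a b = a.
Proof. by rewrite /ifp; case: asboolP. Qed.

Lemma ifpF T (P : Prop) (a b : T) : ~ P -> ifp P a b = b.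
Proof. by rewrite /ifp; case: asboolP. Qed.

Section Calculus.
Context {d : Order.disp_t} {M : orderTopologicalType d} {L : language}.
Context {S : structure L M} {m0 : has_point M}.

(** [defpred] and [defmap] are written [dfp] and [dmap] where the structure is fixed. *)
Definition defpred {T} {c : ctx S T} (P : T -> Prop) : Prop :=
  defI S (fun v => exists2 x, P x & crd x = v).

Lemma defI_True I : defI S (fun _ : I -> M => True).
Proof.
by apply: (defI_ext _ (defI_not m0 (defI_False S m0 I))) => v; split=> // _ [].
Qed.

#[export] Program Instance ctxM : ctx S M :=
  {| cidx := unit; crd x := fun=> x |}.
Next Obligation. by move=> x y /(congr1 (@^~ tt)). Qed.
Next Obligation.
apply: (defI_ext _ (defI_True _)) => v; split=> // _.
by exists (v tt); apply/funext => -[].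
Qed.

#[export] Program Instance ctxV n : ctx S 'rV[M]_n :=
  {| cidx := 'I_n; crd x := fun i => x ord0 i |}.
Next Obligation. by move=> n x y E; apply/rowP => i; rewrite (congr1 (@^~ i) E). Qed.
Next Obligation.
move=> n; apply: (defI_ext _ (defI_True _)) => v; split=> // _.
by exists (\row_i v i)%R; apply/funext => i; rewrite mxE.
Qed.

Lemma sumv_inj I J (v v' : I -> M) (w w' : J -> M) :
  sumv v w = sumv v' w' -> v = v' /\ w = w'.
Proof.
move=> E; split; apply/funext => i.
  exact: (congr1 (@^~ (inl i)) E).
exact: (congr1 (@^~ (inr i)) E).
Qed.

Lemma sumv_split I J (u : I + J -> M) : u = sumv (u \o inl) (u \o inr).
Proof. by apply/funext => -[]. Qed.

#[export] Program Instance ctxX {G H} (c : ctx S G) (c' : ctx S H) :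
    ctx S (G * H) :=
  {| cidx := (cidx G + cidx H)%type; crd x := sumv (crd x.1) (crd x.2) |}.
Next Obligation.
move=> G H c c' [g h] [g' h'] /sumv_inj [/= E E'].
by congr (_, _); apply: crd_inj.
Qed.
Next Obligation.
move=> G H c c'; apply: (defI_ext _ (defI_and m0
  (defI_sub (@inl _ (cidx H)) (@crd_def _ _ _ _ _ c))
  (defI_sub (@inr (cidx G) _) (@crd_def _ _ _ _ _ c')))) => v.
split=> [[[g Eg] [h Eh]]|[[g h] <-]].
  by exists (g, h); rewrite (sumv_split v) Eg Eh.
by split; [exists g|exists h].
Qed.

Section Rules.
Context {G H : Type} {c : ctx S G} {c' : ctx S H}.
Implicit Types (P Q : G -> Prop).

Lemma dfp_ext P Q : (forall x, P x <-> Q x) -> defpred P -> defpred Q.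
Proof.
move=> PQ; apply: defI_ext => v.
by split=> -[x] /PQ; exists x.
Qed.

Lemma dfp_imp P Q : defpred P -> defpred Q -> defpred (fun x => P x -> Q x).
Proof.
move=> dP dQ.
apply: (defI_ext _ (defI_and m0 (@crd_def _ _ _ _ _ c) (defI_imp dP dQ))) => v.
split=> [[[x <-] H']|[x PQ <-]]; last first.
  split; first by exists x.
  move=> [y Py E]; exists x => //; apply: PQ.
  by rewrite -(crd_inj E).
by exists x => // Px; have [|y Qy E] := H'; [exists x|rewrite -(crd_inj E)].
Qed.

Lemma dfp_False : defpred (fun _ : G => False).
Proof.
apply: (defI_ext _ (defI_False S m0 _)) => v.
by split=> // -[].
Qed.

Lemma dfp_not P : defpred P -> defpred (fun x => ~ P x).
Proof. by move=> dP; apply: dfp_imp dP dfp_False. Qed.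

Lemma dfp_True : defpred (fun _ : G => True).
Proof. by apply: dfp_ext (dfp_not dfp_False) => x; split=> // _ []. Qed.

Lemma dfp_const (A : Prop) : defpred (fun _ : G => A).
Proof.
by case: (pselect A) => HA; [apply: dfp_ext dfp_True|apply: dfp_ext dfp_False].
Qed.

Lemma dfp_and P Q : defpred P -> defpred Q -> defpred (fun x => P x /\ Q x).
Proof.
move=> dP dQ; apply: (dfp_ext _ (dfp_not (dfp_imp dP (dfp_not dQ)))) => x.
by split=> [/not_implyP [a /contrapT]|[a b] /(_ a)].
Qed.

Lemma dfp_or P Q : defpred P -> defpred Q -> defpred (fun x => P x \/ Q x).
Proof.
move=> dP dQ; apply: (dfp_ext _ (dfp_imp (dfp_not dP) dQ)) => x; split.
  by case: (pselect (P x)) => Px H'; [left|right; apply: H'].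
by case.
Qed.

Lemma dfp_iff P Q : defpred P -> defpred Q -> defpred (fun x => P x <-> Q x).
Proof. by move=> dP dQ; apply: dfp_and; apply: dfp_imp. Qed.

Lemma dfp_simple (f : G -> H) (r : cidx H -> cidx G) (R : H -> Prop) :
  (forall g, crd (f g) = crd g \o r) -> defpred R -> defpred (fun g => R (f g)).
Proof.
move=> Ef dR.
apply: (defI_ext _ (defI_and m0 (@crd_def _ _ _ _ _ c) (defI_sub r dR))) => v.
split=> [[[x <-] [y Ry]]|[x Rx <-]].
  by rewrite -Ef => E; exists x => //; rewrite -(crd_inj E).
by split; [exists x|exists (f x)].
Qed.

Lemma dfp_ex (R : G -> H -> Prop) :
  defpred (fun x => R x.1 x.2) -> defpred (fun g => exists h, R g h).
Proof.
move=> dR; apply: (defI_ext _ (defI_ex m0 dR)) => v; split.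
  by move=> [w [[g h] /= Rgh /sumv_inj [<- _]]]; exists g => //; exists h.
by move=> [g [h Rgh] <-]; exists (crd h), (g, h).
Qed.

End Rules.

Section Rules2.
Context {G H : Type} {c : ctx S G} {c' : ctx S H}.
Implicit Types (P Q : G -> Prop).

Lemma dfp_all (R : G -> H -> Prop) :
  defpred (fun x => R x.1 x.2) -> defpred (fun g => forall h, R g h).
Proof.
move=> dR; apply: (dfp_ext _ (dfp_not (@dfp_ex _ _ _ _ (fun g h => ~ R g h) (dfp_not dR)))) => g.
by split=> [H' h|H' [h]]; [apply: contrapT => nR; apply: H'; exists h|apply].
Qed.

Lemma dfp_ex2 (R R' : G -> H -> Prop) :
  defpred (fun x => R x.1 x.2 /\ R' x.1 x.2) ->
  defpred (fun g => exists2 h, R g h & R' g h).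
Proof.
move=> dR; apply: (dfp_ext _ (@dfp_ex _ _ _ _ (fun g h => R g h /\ R' g h) dR)) => g.
by split=> -[h]; [move=> []|]; exists h.
Qed.

Lemma dfp_allfin (I : finType) (A : I -> G -> Prop) :
  (forall i, defpred (A i)) -> defpred (fun g => forall i, A i g).
Proof.
move=> dA; apply: (defI_ext _ (defI_and m0 (@crd_def _ _ _ _ _ c)
  (defI_allfin m0 dA))) => v; split.
  move=> [[g <-] H']; exists g => // i.
  by have [x Ax E] := H' i; rewrite -(crd_inj E).
by move=> [g Ag <-]; split=> [|i]; exists g.
Qed.

Lemma dfp_exfin (I : finType) (A : I -> G -> Prop) :
  (forall i, defpred (A i)) -> defpred (fun g => exists i, A i g).
Proof.
move=> dA; apply: (dfp_ext _ (dfp_not (@dfp_allfin I (fun i g => ~ A i g) _))).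
  by move=> g; split=> [/existsNP [i /contrapT]|[i Ai] /(_ i)]; [exists i|].
by move=> i; apply: dfp_not.
Qed.

End Rules2.

Definition defmap {G H} {c : ctx S G} {c' : ctx S H} (f : G -> H) : Prop :=
  defpred (fun x : G * H => f x.1 = x.2).

Section Maps.
Context {G H K : Type} {c : ctx S G} {c' : ctx S H} {c'' : ctx S K}.

Lemma dfp_comp (f : G -> H) (R : H -> Prop) :
  defpred R -> defmap f -> defpred (fun g => R (f g)).
Proof.
move=> dR df; apply: (dfp_ext (P := fun g => exists h, f g = h /\ R h)) => [g|].
  by split=> [[h [<-]]|Rf] //; exists (f g).
apply: dfp_ex; apply: dfp_and => //.
exact: (@dfp_simple (G * H) H _ _ snd inr R (fun=> erefl) dR).
Qed.

Lemma dfp_crd_eq (i j : cidx G) : defpred (fun g => crd g i = crd g j).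
Proof.
apply: (defI_ext _ (defI_and m0 (@crd_def _ _ _ _ _ c) (defI_eq S i j))) => v.
by split=> [[[g <-] E]|[g E <-]]; [exists g|split=> //; exists g].
Qed.

Lemma dfp_crd_lt (i j : cidx G) : defpred (fun g => crd g i < crd g j).
Proof.
apply: (defI_ext _ (defI_and m0 (@crd_def _ _ _ _ _ c) (defI_lt S i j))) => v.
by split=> [[[g <-] E]|[g E <-]]; [exists g|split=> //; exists g].
Qed.

Lemma dfp_crd_eqc (i : cidx G) (a : M) : defpred (fun g => crd g i = a).
Proof.
apply: (defI_ext _ (defI_and m0 (@crd_def _ _ _ _ _ c) (defI_eqc S i a))) => v.
by split=> [[[g <-] E]|[g E <-]]; [exists g|split=> //; exists g].
Qed.

End Maps.

Lemma dmap_simple {G H} {c : ctx S G} {c' : ctx S H} (f : G -> H)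
    (r : cidx H -> cidx G) :
  (forall g, crd (f g) = crd g \o r) -> defmap f.
Proof.
move=> Ef; rewrite /defmap; apply: (dfp_ext (P := fun x : G * H =>
    forall i : cidx H, crd x (inl (r i)) = crd x (inr i))) => [[g h] /=|].
  split=> [E|<- i]; last by rewrite Ef.
  by apply: crd_inj; rewrite Ef; apply/funext => i; apply: E.
by apply: dfp_allfin => i; apply: dfp_crd_eq.
Qed.

Lemma dmap_const {G H} {c : ctx S G} {c' : ctx S H} (h : H) :
  defmap (fun _ : G => h).
Proof.
rewrite /defmap; apply: (dfp_ext (P := fun x : G * H =>
    forall i : cidx H, crd x (inr i) = crd h i)) => [[g k] /=|].
  split=> [E|<- //]; apply: crd_inj; apply/funext => i; exact/esym/E.
by apply: dfp_allfin => i; apply: dfp_crd_eqc.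
Qed.

Lemma dmap_id {G} {c : ctx S G} : defmap (fun x : G => x).
Proof. exact: (@dmap_simple _ _ _ _ _ id). Qed.

Lemma dmap_ext {G H} {c : ctx S G} {c' : ctx S H} (f g : G -> H) :
  (forall x, f x = g x) -> defmap f -> defmap g.
Proof. by move=> /funext ->. Qed.

Section Maps2.
Context {G H K : Type} {c : ctx S G} {c' : ctx S H} {c'' : ctx S K}.

Lemma dmap_comp (f : H -> K) (g : G -> H) :
  defmap f -> defmap g -> defmap (fun x => f (g x)).
Proof.
move=> df dg; rewrite /defmap.
apply: (dfp_ext (P := fun x : G * K => exists h, g x.1 = h /\ f h = x.2)).
  by move=> [x k] /=; split=> [[_ [<-]]|E] //; exists (g x).
apply: dfp_ex; apply: dfp_and.
  apply: (@dfp_simple _ _ _ _ (fun x : G * K * H => (x.1.1, x.2))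
    (fun i => match i with inl i => inl (inl i) | inr j => inr j end) _ _ dg).
  by move=> x; apply/funext => -[].
apply: (@dfp_simple _ _ _ _ (fun x : G * K * H => (x.2, x.1.2))
  (fun i => match i with inl i => inr i | inr j => inl (inr j) end) _ _ df).
by move=> x; apply/funext => -[].
Qed.

Lemma dmap_pair (f : G -> H) (g : G -> K) :
  defmap f -> defmap g -> defmap (fun x => (f x, g x)).
Proof.
move=> df dg; rewrite /defmap.
apply: (dfp_ext (P := fun x : G * (H * K) =>
  f x.1 = x.2.1 /\ g x.1 = x.2.2)).
  by move=> [x [h k]] /=; split=> [[-> ->]|[-> ->]].
apply: dfp_and.
  apply: (@dfp_simple _ _ _ _ (fun x : G * (H * K) => (x.1, x.2.1))
    (fun i => match i with inl i => inl i | inr j => inr (inl j) end) _ _ df).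
  by move=> x; apply/funext => -[].
apply: (@dfp_simple _ _ _ _ (fun x : G * (H * K) => (x.1, x.2.2))
  (fun i => match i with inl i => inl i | inr j => inr (inr j) end) _ _ dg).
by move=> x; apply/funext => -[].
Qed.

Lemma dmap_fst (f : G -> H * K) : defmap f -> defmap (fun x => (f x).1).
Proof.
move=> df; apply: (dfp_ext (P := fun x : G * H => exists k, f x.1 = (x.2, k))).
  move=> [x h] /=; split=> [[k ->]|<-] //.
  by exists (f x).2; case: (f x).
apply: dfp_ex; apply: (@dfp_simple _ _ _ _ (fun x : G * H * K =>
  (x.1.1, (x.1.2, x.2)))
  (fun i => match i with inl i => inl (inl i) | inr (inl i) => inl (inr i)
    | inr (inr i) => inr i end) _ _ df).
by move=> x; apply/funext => -[|[]].
Qed.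

Lemma dmap_snd (f : G -> H * K) : defmap f -> defmap (fun x => (f x).2).
Proof.
move=> df; apply: (dfp_ext (P := fun x : G * K => exists h, f x.1 = (h, x.2))).
  move=> [x h] /=; split=> [[k ->]|<-] //.
  by exists (f x).1; case: (f x).
apply: dfp_ex; apply: (@dfp_simple _ _ _ _ (fun x : G * K * H =>
  (x.1.1, (x.2, x.1.2)))
  (fun i => match i with inl i => inl (inl i) | inr (inl i) => inr i
    | inr (inr i) => inl (inr i) end) _ _ df).
by move=> x; apply/funext => -[|[]].
Qed.

End Maps2.

Section Currying.
Context {G H K N : Type} {c : ctx S G} {c' : ctx S H} {c2 : ctx S K} {c3 : ctx S N}.

Lemma dfp_comp2 (R : H -> K -> Prop) (f : G -> H) (g : G -> K) :
  defpred (fun y => R y.1 y.2) -> defmap f -> defmap g -> defpred (fun x => R (f x) (g x)).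
Proof. by move=> dR df dg; apply: (dfp_comp dR (dmap_pair df dg)). Qed.

Lemma dmap_comp2 (R : H -> K -> N) (f : G -> H) (g : G -> K) :
  defmap (fun y => R y.1 y.2) -> defmap f -> defmap g -> defmap (fun x => R (f x) (g x)).
Proof. by move=> dR df dg; apply: (dmap_comp dR (dmap_pair df dg)). Qed.

End Currying.

Section Currying3.
Context {G H K N : Type} {c : ctx S G} {c' : ctx S H} {c2 : ctx S K} {c3 : ctx S N}.

Lemma dfp_comp3 (R : H -> K -> N -> Prop) (f : G -> H) (g : G -> K) (h : G -> N) :
  defpred (fun y => R y.1.1 y.1.2 y.2) -> defmap f -> defmap g -> defmap h ->
  defpred (fun x => R (f x) (g x) (h x)).
Proof.
by move=> dR df dg dh; apply: (dfp_comp dR (dmap_pair (dmap_pair df dg) dh)).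
Qed.

End Currying3.

Section Maps3.
Context {G H : Type} {c : ctx S G} {c' : ctx S H}.

Lemma dfp_eq (f g : G -> H) : defmap f -> defmap g -> defpred (fun x => f x = g x).
Proof.
move=> df dg.
have dE : defpred (fun x : G * H * H => x.1.2 = x.2).
  apply: (dfp_ext (P := fun x : G * H * H => forall i : cidx H,
    crd x (inl (inr i)) = crd x (inr i))) => [[[x h] h'] /=|].
    split=> [E|<- //].
    by apply: crd_inj; apply/funext.
  by apply: dfp_allfin => i; apply: dfp_crd_eq.
have dG := dmap_pair (dmap_pair dmap_id df) dg.
exact: (dfp_comp dE dG).
Qed.

Lemma dfp_lt (f g : G -> M) : defmap f -> defmap g -> defpred (fun x => f x < g x).
Proof.
move=> df dg; have dE : defpred (fun x : M * M => x.1 < x.2).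
  exact: (dfp_crd_lt (G := (M * M)%type) (inl tt) (inr tt)).
exact: (dfp_comp dE (dmap_pair df dg)).
Qed.

Lemma dfp_le (f g : G -> M) : defmap f -> defmap g -> defpred (fun x => f x <= g x).
Proof.
move=> df dg; apply: dfp_ext (dfp_not (dfp_lt dg df)) => x.
by rewrite leNgt; split=> /negP.
Qed.

Lemma dfp_andb (a b : G -> bool) :
  defpred (fun x => a x) -> defpred (fun x => b x) -> defpred (fun x => a x && b x).
Proof.
move=> da db; apply: dfp_ext (dfp_and da db) => x.
by split=> [[-> ->]|/andP].
Qed.

Lemma dfp_and3 (A B C : G -> Prop) :
  defpred A -> defpred B -> defpred C -> defpred (fun x => [/\ A x, B x & C x]).
Proof.
move=> dA dB dC; apply: dfp_ext (dfp_and dA (dfp_and dB dC)) => x.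
by split=> [[? []]|[]].
Qed.

Lemma dfp_and4 (A B C E : G -> Prop) : defpred A -> defpred B -> defpred C -> defpred E ->
  defpred (fun x => [/\ A x, B x, C x & E x]).
Proof.
move=> dA dB dC dE; apply: dfp_ext (dfp_and dA (dfp_and3 dB dC dE)) => x.
by split=> [[? []]|[]].
Qed.

Lemma dmap_ifp (P : G -> Prop) (f g : G -> H) :
  defpred P -> defmap f -> defmap g -> defmap (fun x => ifp (P x) (f x) (g x)).
Proof.
move=> dP df dg; rewrite /defmap.
have dP1 : defpred (fun x : G * H => P x.1).
  exact: (dfp_comp dP (dmap_fst dmap_id)).
apply: (dfp_ext _ (dfp_and (dfp_imp dP1 df) (dfp_imp (dfp_not dP1) dg))).
move=> [x h] /=; case: (pselect (P x)) => Px; [rewrite ifpT|rewrite ifpF] => //.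
  by split=> [[u w]|E]; auto.
by split=> [[u w]|E]; auto; split.
Qed.

Lemma dmap_crd n (f : G -> 'rV[M]_n) (i : 'I_1) (j : 'I_n) :
  defmap f -> defmap (fun x => f x i j).
Proof.
move=> df; apply: (dmap_ext (f := fun x => f x ord0 j)) => [x|].
  by rewrite (ord1 i).
have dj : defmap (fun y : 'rV[M]_n => y ord0 j).
  exact: (@dmap_simple _ _ _ _ (fun y : 'rV[M]_n => y ord0 j) (fun=> j)).
rewrite /defmap; apply: (dfp_ext (P := fun x : G * M =>
  exists y, f x.1 = y /\ y ord0 j = x.2)) => [[x k] /=|].
  by split=> [[_ [<-]]|E] //; exists (f x).
apply: dfp_ex; apply: dfp_and.
  apply: (@dfp_simple _ _ _ _ (fun x : G * M * 'rV[M]_n => (x.1.1, x.2))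
    (fun i => match i with inl i => inl (inl i) | inr j => inr j end) _ _ df).
  by move=> x; apply/funext => -[].
apply: (@dfp_simple _ _ _ _ (fun x : G * M * 'rV[M]_n => (x.2, x.1.2))
  (fun i => match i with inl i => inr i | inr j => inl (inr j) end) _ _ dj).
by move=> x; apply/funext => -[].
Qed.

Lemma dmap_mx n (k : unit) (f : G -> 'I_1 -> 'I_n -> M) :
  (forall j, defmap (fun x => f x ord0 j)) ->
  defmap (fun x => (\matrix[k]_(i, j) f x i j)%R).
Proof.
move=> df; rewrite /defmap.
apply: (dfp_ext (P := fun x : G * 'rV[M]_n =>
  forall j, f x.1 ord0 j = x.2 ord0 j)).
  move=> [x y] /=; split=> [E|<- j]; last by rewrite mxE.
  by apply/rowP => j; rewrite mxE.
apply: dfp_allfin => j.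
have dj : defmap (fun y : 'rV[M]_n => y ord0 j).
  exact: (@dmap_simple _ _ _ _ (fun y : 'rV[M]_n => y ord0 j) (fun=> j)).
apply: (dfp_ext (P := fun x : G * 'rV[M]_n =>
  exists a : M, f x.1 ord0 j = a /\ x.2 ord0 j = a)) => [[x y] /=|].
  by split=> [[a [-> ->]]|E] //; exists (y ord0 j).
apply: dfp_ex; apply: dfp_and.
  apply: (@dfp_simple _ _ _ _ (fun x : G * 'rV[M]_n * M => (x.1.1, x.2))
    (fun i => match i with inl i => inl (inl i) | inr j => inr j end) _ _ (df j)).
  by move=> x; apply/funext => -[].
apply: (@dfp_simple _ _ _ _ (fun x : G * 'rV[M]_n * M => (x.1.2, x.2))
  (fun i => match i with inl i => inl (inr i) | inr j => inr j end) _ _ dj).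
by move=> x; apply/funext => -[].
Qed.

End Maps3.
End Calculus.

(** * Automation of definability, and definable choice *)

Section Matrices.
Context {d : Order.disp_t} {M : orderTopologicalType d} {L : language}.
Context {S : structure L M} {m0 : has_point M}.
Context {G : Type} {c : ctx S G}.

Lemma dmap_crd_at (i : cidx G) : defmap (fun x => crd x i).
Proof.
rewrite /defmap; apply: (dfp_ext _ (dfp_crd_eq (c := ctxX c ctxM)
  (inl i) (inr tt))) => -[g a] /=.
by [].
Qed.

Lemma dmap_row_mx m n (f : G -> 'rV[M]_m) (g : G -> 'rV[M]_n) :
  defmap f -> defmap g -> defmap (fun x => row_mx (f x) (g x)).
Proof.
move=> df dg; apply: (dmap_ext (f := fun x : G => \matrix_(i < 1, j < (m + n)%N)
  match fintype.split j with inl k => f x i k | inr k => g x i k end)%R) => [x|].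
  by apply/matrixP => i j; rewrite !mxE.
by apply: dmap_mx => j; case: (fintype.split j) => k; apply: dmap_crd.
Qed.

Lemma dmap_lsubmx m n (f : G -> 'rV[M]_(m + n)) :
  defmap f -> defmap (fun x => lsubmx (f x)).
Proof.
move=> df; apply: (dmap_ext (f := fun x : G => \matrix_(i < 1, j < m) f x i (lshift n j))%R).
  by move=> x; apply/matrixP => i j; rewrite !mxE.
by apply: dmap_mx => j; apply: dmap_crd.
Qed.

Lemma dmap_rsubmx m n (f : G -> 'rV[M]_(m + n)) :
  defmap f -> defmap (fun x => rsubmx (f x)).
Proof.
move=> df; apply: (dmap_ext (f := fun x : G => \matrix_(i < 1, j < n) f x i (rshift m j))%R).
  by move=> x; apply/matrixP => i j; rewrite !mxE.
by apply: dmap_mx => j; apply: dmap_crd.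
Qed.

Lemma dmap_const_mx n (f : G -> M) :
  defmap f -> defmap (fun x => const_mx (f x) : 'rV[M]_n).
Proof.
move=> df; apply: (dmap_ext (f := fun x : G => \matrix_(i < 1, j < n) f x)%R).
  by move=> x; apply/matrixP => i j; rewrite !mxE.
by apply: dmap_mx.
Qed.

End Matrices.

(** Extended below, whenever a notion with its own rule is introduced. *)
Ltac dfn_hook := fail.

(** One rule of the calculus, selected by the head of the body of a predicate or
    map. Constant bodies come first, because every rule would apply to them. *)
Ltac dfn_step :=
  cbv beta delta [mkset setI setU setD setC];
  lazymatch goal with
  | |- forall _, _ => intro
  | |- defpred (fun _ => ?A) => apply: dfp_const
  | |- defmap (fun _ => ?a) => apply: dmap_const
  | |- defmap (fun x => x) => apply: dmap_id
  | |- defmap fst => apply: (dmap_fst dmap_id)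
  | |- defmap snd => apply: (dmap_snd dmap_id)
  | |- defpred (fun x => _ /\ _) => apply: dfp_and
  | |- defpred (fun x => [/\ _, _ & _]) => apply: dfp_and3
  | |- defpred (fun x => [/\ _, _, _ & _]) => apply: dfp_and4
  | |- defpred (fun x => _ \/ _) => apply: dfp_or
  | |- defpred (fun x => _ <-> _) => apply: dfp_iff
  | |- defpred (fun x => ~ _) => apply: dfp_not
  | |- defpred (fun x => @?A x -> @?B x) =>
      first [apply: (@dfp_imp _ _ _ _ _ _ _ A B)
            |apply: (@dfp_all _ _ _ _ _ _ _ _ _ (fun x _ => B x))]
  | |- defpred (fun x => exists _ : ordinal _, _) => apply: dfp_exfin
  | |- defpred (fun x => forall _ : ordinal _, _) => apply: dfp_allfin
  | |- defpred (fun x => exists h, @?R x h) => apply: (@dfp_ex _ _ _ _ _ _ _ _ _ R)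
  | |- defpred (fun x => exists2 h, @?R x h & @?R' x h) =>
      apply: (@dfp_ex2 _ _ _ _ _ _ _ _ _ R R')
  | |- defpred (fun x => forall h, @?R x h) =>
      apply: (@dfp_all _ _ _ _ _ _ _ _ _ R)
  | |- defpred (fun x => is_true (_ && _)) => apply: dfp_andb
  | |- defpred (fun x => is_true (_ < _)) => apply: dfp_lt
  | |- defpred (fun x => is_true (_ <= _)) => apply: dfp_le
  | |- defpred (fun x => _ = _) => apply: dfp_eq
  | |- defmap (fun x => (@?f x, @?g x)) => apply: (@dmap_pair _ _ _ _ _ _ _ _ _ _ _ f g)
  | |- defmap (fun x => fst (@?f x)) => apply: (@dmap_fst _ _ _ _ _ _ _ _ _ _ _ f)
  | |- defmap (fun x => snd (@?f x)) => apply: (@dmap_snd _ _ _ _ _ _ _ _ _ _ _ f)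
  | |- defmap (fun x => fun_of_matrix (@?f x) _ _) => apply: (@dmap_crd _ _ _ _ _ _ _ _ f)
  | |- defmap (fun x => matrix_of_fun _ _) => apply: dmap_mx
  | |- defmap (fun x => row_mx _ _) => apply: dmap_row_mx
  | |- defmap (fun x => lsubmx _) => apply: dmap_lsubmx
  | |- defmap (fun x => rsubmx _) => apply: dmap_rsubmx
  | |- defmap (fun x => const_mx _) => apply: dmap_const_mx
  | |- defmap (fun x => ifp (@?P x) (@?f x) (@?g x)) =>
      apply: (@dmap_ifp _ _ _ _ _ _ _ _ _ P f g)
  | |- _ => first
     [ match goal with
       | H : defpred ?A |- defpred ?A => exact H
       | H : defmap ?A |- defmap ?A => exact H
       | H : defpred ?A |- defpred (fun x => ?A (@?t x)) => apply: (dfp_comp H)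
       | H : defpred (fun y => ?A (fst y) (snd y)) |-
           defpred (fun x => ?A (@?t x) (@?u x)) =>
             apply: (dfp_comp2 (R := A) (f := t) (g := u) H)
       | H : defpred (fun y => ?A (fst (fst y)) (snd (fst y)) (snd y)) |-
           defpred (fun x => ?A (@?t x) (@?u x) (@?v x)) =>
             apply: (dfp_comp3 (R := A) (f := t) (g := u) (h := v) H)
       | H : defmap ?A |- defmap (fun x => ?A (@?t x)) => apply: (dmap_comp H)
       | H : defmap (fun y => ?A (fst y) (snd y)) |-
           defmap (fun x => ?A (@?t x) (@?u x)) =>
             apply: (dmap_comp2 (R := A) (f := t) (g := u) H)
       | H : forall i, defmap (?A i) |- defmap (fun x => ?A _ (@?t x)) =>
             apply: (dmap_comp (H _))
       | H : forall i, defpred (?A i) |- defpred (fun x => ?A _ (@?t x)) =>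
             apply: (dfp_comp (H _))
       end
     | dfn_hook
     | lazymatch goal with
       | |- defmap (fun _ => _) => fail
       | |- @defmap ?d ?M ?L ?S ?m ?G ?H ?c ?c' ?f =>
           change (@defmap d M L S m G H c c' (fun x => f x))
       end ]
  end.
Ltac dfn := repeat (dfn_step); cbv beta.

Section Links.
Context {d : Order.disp_t} {M : orderTopologicalType d} {L : language}.
Context {S : structure L M} {m0 : has_point M}.

Lemma definable_dfp n (A : set 'rV[M]_n) : definable S A <-> defpred (S := S) A.
Proof.
rewrite (definable_defI S m0); split; apply: defI_ext => v.
  split=> [Av|[x Ax <-]].
    by exists (\row_i v i)%R => //; apply/funext => i; rewrite /= mxE.
  by congr (A _) : Ax; apply/rowP => i; rewrite mxE.
split=> [[x Ax <-]|Av].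
  by congr (A _) : Ax; apply/rowP => i; rewrite mxE.
by exists (\row_i v i)%R => //; apply/funext => i; rewrite /= mxE.
Qed.

Lemma definable_map_dmap m n (f : 'rV[M]_m -> 'rV[M]_n) (A : set 'rV[M]_m) :
  defpred (S := S) A -> defmap (S := S) f -> definable_map S A f.
Proof.
move=> dA df; apply/definable_dfp.
apply: (dfp_ext (P := fun y => exists2 x, A x & row_mx x (f x) = y)) => //.
by dfn.
Qed.

Hypothesis hSk : definable_skolem_functions S.

(** Definable choice, transported to arbitrary types with coordinates. *)
Lemma skolem G H (c : ctx S G) (c' : ctx S H) (R : G -> H -> Prop) :
  defpred (fun x => R x.1 x.2) -> (forall g, exists h, R g h) ->
  exists2 f : G -> H, defmap f & forall g, R g (f g).
Proof.
move=> dR exR.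
pose eG (g : G) : 'rV[M]_#|@cidx _ _ _ S G c| := (\row_i @crd _ _ _ S G c g (enum_val i))%R.
pose eH (h : H) : 'rV[M]_#|@cidx _ _ _ S H c'| := (\row_i @crd _ _ _ S H c' h (enum_val i))%R.
have dG : defmap eG by apply: dmap_mx => j; apply: dmap_crd_at.
have dH : defmap eH by apply: dmap_mx => j; apply: dmap_crd_at.
have iH h h' : eH h = eH h' -> h = h'.
  move=> /rowP E; apply: crd_inj; apply/funext => i.
  by have := E (enum_rank i); rewrite !mxE enum_rankK.
have iG h h' : eG h = eG h' -> h = h'.
  move=> /rowP E; apply: crd_inj; apply/funext => i.
  by have := E (enum_rank i); rewrite !mxE enum_rankK.
pose T : set 'rV[M]_#|@cidx _ _ _ S G c| := fun v => exists g, eG g = v.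
pose F : set 'rV[M]_(#|@cidx _ _ _ S G c| + #|@cidx _ _ _ S H c'|) :=
  fun v => exists g h, R g h /\ row_mx (eG g) (eH h) = v.
have dT : definable S T by apply/definable_dfp; rewrite /T; dfn.
have dF : definable S F by apply/definable_dfp; rewrite /F; dfn.
have [t [g <-]|f df Ff] := hSk dT dF.
  by have [h Rgh] := exR g; exists (eH h), g, h.
have ex g : exists h, R g h /\ f (eG g) = eH h.
  have [|g' [h [Rgh /eq_row_mx [/iG E E']]]] := Ff (eG g); first by exists g.
  by exists h; split; [rewrite -E|rewrite E'].
pose phi g := projT1 (cid (ex g)).
have phiP g : R g (phi g) /\ f (eG g) = eH (phi g).
  by rewrite /phi; case: cid.
exists phi => [|g]; last by case: (phiP g).
move: df => /definable_dfp df.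
apply: (dfp_ext (P := fun x : G * H =>
  [set row_mx x (f x) | x in T] (row_mx (eG x.1) (eH x.2)))); last first.
  by apply: (dfp_comp df); dfn.
move=> [g h] /=; split=> [[_ [g' <-] /eq_row_mx [/iG -> E]]|<-].
  by apply: iH; rewrite -E; case: (phiP g).
by exists (eG g); [exists g|case: (phiP g) => _ ->].
Qed.

End Links.

(** * The order of an o-minimal structure and definable subsets of the line *)

Section Sides.
Context {d : Order.disp_t} {M : orderTopologicalType d}.

(** The order or its reverse, so that left and right limits, and increasing and
    decreasing functions, are treated by the same argument. *)
Definition lts (s : bool) (x y : M) : bool := if s then x < y else y < x.

Lemma ltsN s x y : lts (~~ s) x y = lts s y x. Proof. by case: s. Qed.

Lemma lts_irr s x : lts s x x = false. Proof. by case: s; rewrite /= ltxx. Qed.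

Lemma lts_trans s y x z : lts s x y -> lts s y z -> lts s x z.
Proof. by case: s => /= H H'; [apply: lt_trans H H'|apply: lt_trans H' H]. Qed.

Lemma lts_asym s x y : lts s x y -> lts s y x -> False.
Proof. by move=> H /(lts_trans H); rewrite lts_irr. Qed.

Lemma lts_neq s x y : lts s x y -> x <> y.
Proof. by move=> + E; rewrite E lts_irr. Qed.

Lemma lts_total s x y : [\/ lts s x y, x = y | lts s y x].
Proof. by case: s => /=; case: (ltgtP x y) => H; constructor. Qed.

Lemma lts_or s x y : x <> y -> ~ lts s x y -> lts s y x.
Proof. by case: (lts_total s x y) => // H _ []. Qed.

Definition ev s (x : M) (P : M -> Prop) : Prop :=
  exists2 a, lts s x a & forall t, lts s x t -> lts s t a -> P t.

Lemma ev_mono s x (P Q : M -> Prop) :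
  (forall t, lts s x t -> P t -> Q t) -> ev s x P -> ev s x Q.
Proof. by move=> PQ [a xa Pa]; exists a => // t xt ta; apply/PQ/Pa. Qed.

Lemma ev_and s x (P Q : M -> Prop) :
  ev s x P -> ev s x Q -> ev s x (fun t => P t /\ Q t).
Proof.
move=> [a xa Pa] [b xb Qb]; case: (lts_total s a b) => [ab|ab|ba].
- by exists a => // t xt ta; split; [apply: Pa|apply: Qb => //; apply: lts_trans ab].
- by exists a => // t xt ta; split; [apply: Pa|apply: Qb => //; rewrite -ab].
- by exists b => // t xt ta; split; [apply: Pa => //; apply: lts_trans ba|apply: Qb].
Qed.

Lemma ev_near s x b : lts s x b -> ev s x (fun t => lts s t b).
Proof. by exists b. Qed.

End Sides.

Section SidesDefinable.
Context {d : Order.disp_t} {M : orderTopologicalType d} {L : language}.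
Context {S : structure L M} {m0 : has_point M} {G : Type} {c : ctx S G}.
Local Notation dfp := (defpred (S := S)).
Local Notation dmap := (defmap (S := S)).

Lemma dfp_lts s (f g : G -> M) :
  dmap f -> dmap g -> dfp (fun x => lts s (f x) (g x)).
Proof. by case: s => df dg; apply: dfp_lt. Qed.

End SidesDefinable.

Lemma dfp_ev {d : Order.disp_t} {M : orderTopologicalType d} {L : language}
    {S : structure L M} {m0 : has_point M} {G : Type} {c : ctx S G}
    s (f : G -> M) (P : G -> M -> Prop) :
  defmap (S := S) f -> defpred (S := S) (fun x => P x.1 x.2) ->
  defpred (S := S) (fun x => ev s (f x) (P x)).
Proof. by move=> df dP; rewrite /ev; dfn; apply: dfp_lts; dfn. Qed.

Ltac dfn_hook ::= lazymatch goal with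
  | |- defpred (fun x => is_true (lts _ _ _)) => apply: dfp_lts
  | |- defpred (fun x => ev _ (@?f x) (@?P x)) =>
      apply: (@dfp_ev _ _ _ _ _ _ _ _ f P)
  end.

Section Line.
Context {d : Order.disp_t} {M : orderTopologicalType d} {L : language}.
Context {S : structure L M} {m0 : has_point M}.
Hypothesis hS : o_minimal S.
Local Notation dfp := (defpred (S := S)).
Local Notation dmap := (defmap (S := S)).

Lemma dense (x y : M) : x < y -> exists2 z, x < z & z < y.
Proof. by case: hS => _ H _ _ /H [z /andP [? ?]]; exists z. Qed.

Lemma ltsW s (x y : M) : lts s x y -> exists2 z, lts s x z & lts s z y.
Proof. by case: s => /= /dense [z ? ?]; exists z. Qed.

Lemma lts_ex s (x : M) : exists y, lts s x y.
Proof.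
case: hS => _ _ /(_ x) [y [z /andP [yx xz]]] _.
by case: s; [exists z|exists y].
Qed.

Lemma gt_ex (x : M) : exists y, x < y. Proof. exact: (lts_ex true). Qed.
Lemma lt_ex (x : M) : exists y, y < x. Proof. exact: (lts_ex false). Qed.

Lemma ev_ex s x (b : M) (P : M -> Prop) : ev s x P -> lts s x b ->
  exists t, [/\ lts s x t, lts s t b & P t].
Proof.
move=> eP /ev_near /(ev_and eP) [a xa Pa].
by have [t xt ta] := ltsW xa; have [] := Pa t xt ta; exists t.
Qed.

Lemma ev_False s (x : M) : ~ ev s x (fun=> False).
Proof. by have [b xb] := lts_ex s x; move=> /ev_ex /(_ xb) [t []]. Qed.

Lemma ev_exP s (x : M) (P : M -> Prop) : ev s x P -> exists2 t, lts s x t & P t.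
Proof.
by move=> eP; have [b xb] := lts_ex s x; have [t []] := ev_ex eP xb; exists t.
Qed.

Lemma omin (A : M -> Prop) : dfp A ->
  exists (F : seq M) (s : seq (option M * option M)), forall t,
    A t <-> t \in F \/ exists2 J, J \in s & oo_itv J.1 J.2 t.
Proof.
by move=> dA; case: hS => _ _ _; apply; apply/definable_dfp; dfn.
Qed.

Lemma ev_oo_itv s (x : M) J :
  ev s x (oo_itv J.1 J.2) \/ ev s x (fun t => ~ oo_itv J.1 J.2 t).
Proof.
have half (r : bool) (o : option M) (B : M -> Prop) :
    B = (fun t => if o is Some a then (lts r a t : Prop) else True) ->
    ev s x B \/ ev s x (fun t => ~ B t).
  move=> ->; case: o => [a|]; last first.
    by left; have [b xb] := lts_ex s x; exists b.
  have [b xb] := lts_ex s x.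
  case: (eqVneq r s) => [->|rs].
    case: (lts_total s x a) => [xa|xa|ax].
    - by right; exists a => // t xt ta at'; apply: lts_asym ta at'.
    - by left; exists b => // t xt _; rewrite -xa.
    - by left; exists b => // t xt _; apply: lts_trans xt.
  have {rs} -> : r = ~~ s by case: (r) (s) rs => -[].
  case: (lts_total s x a) => [xa|xa|ax].
  - by left; exists a => // t xt ta; rewrite ltsN.
  - by right; exists b => // t xt _; rewrite ltsN -xa => /(lts_asym xt).
  - by right; exists b => // t xt _; rewrite ltsN => /lts_asym; apply; apply: lts_trans xt.
case: J => [o o'] /=.
have [H|H] := half true o _ erefl; last first.
  by right; apply: ev_mono H => t _ nB [B _]; apply: nB; case: (o) B.
have [H'|H'] := half false o' _ erefl; last first.
  by right; apply: ev_mono H' => t _ nB [_ B]; apply: nB; case: (o') B.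
left; apply: ev_mono (ev_and H H') => t _ [].
by rewrite /oo_itv /=; case: (o) => [?|]; case: (o').
Qed.

(** Points and intervals, hence their finite unions, have a germ on each side of
    every point. Most uses of o-minimality go through this form. *)
Lemma om_ev s (x : M) (A : M -> Prop) :
  dfp A -> ev s x A \/ ev s x (fun t => ~ A t).
Proof.
move=> /omin [F [l HA]].
have {}HA t : A t <-> t \in F \/ exists2 J, J \in l & oo_itv J.1 J.2 t := HA t.
have U (P Q : M -> Prop) : ev s x P \/ ev s x (fun t => ~ P t) ->
    ev s x Q \/ ev s x (fun t => ~ Q t) ->
    ev s x (fun t => P t \/ Q t) \/ ev s x (fun t => ~ (P t \/ Q t)).
  move=> [HP|HP]; first by left; apply: ev_mono HP; left.
  move=> [HQ|HQ]; first by left; apply: ev_mono HQ; right.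
  by right; apply: ev_mono (ev_and HP HQ) => t _ [nP nQ] [].
have EF : ev s x (fun t => t \in F) \/ ev s x (fun t => ~ t \in F).
  elim: F {HA} => [|a F IH].
    by right; have [b xb] := lts_ex s x; exists b.
  have [H|H] : ev s x (fun t => t = a) \/ ev s x (fun t => t <> a).
    right; case: (lts_total s x a) => [xa|xa|ax].
    - by exists a => // t _ /lts_neq.
    - have [b xb] := lts_ex s x; exists b => // t xt _ E.
      by apply: (lts_neq xt); rewrite E.
    - have [b xb] := lts_ex s x; exists b => // t xt _ E.
      by apply: (lts_neq (lts_trans ax xt)); rewrite E.
  - by left; apply: ev_mono H => t _ ->; rewrite inE eqxx.
  case: IH => IH; [left|right].
    by apply: ev_mono IH => t _ tF; rewrite inE tF orbT.
  by apply: ev_mono (ev_and H IH) => t _ [ta tF]; rewrite inE => /predU1P [].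
have EJ : ev s x (fun t => exists2 J, J \in l & oo_itv J.1 J.2 t) \/
          ev s x (fun t => ~ exists2 J, J \in l & oo_itv J.1 J.2 t).
  elim: l {HA} => [|J l IH].
    by right; have [b xb] := lts_ex s x; exists b => // t _ _ [].
  have [H|H] := ev_oo_itv s x J.
    by left; apply: ev_mono H => t _ Jt; exists J => //; rewrite inE eqxx.
  case: IH => IH; [left|right].
    by apply: ev_mono IH => t _ [K Kl Kt]; exists K => //; rewrite inE Kl orbT.
  apply: ev_mono (ev_and H IH) => t _ [nJ nl] [K].
  by rewrite inE => /predU1P [->|Kl] // Kt; apply: nl; exists K.
have [H|H] := U _ _ EF EJ; [left|right].
  by apply: ev_mono H => t _ /HA.
by apply: ev_mono H => t _ H /HA.
Qed.

Lemma ev_cover s (x : M) (I : finType) (A : I -> M -> Prop) :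
  (forall i, dfp (A i)) -> ev s x (fun t => exists i, A i t) ->
  exists i, ev s x (A i).
Proof.
move=> dA cov; apply: contrapT => /forallNP nA.
have {}nA i : ev s x (fun t => ~ A i t) by case: (om_ev s x (dA i)) => // /nA.
suff H (l : seq I) : ev s x (fun t => forall i, i \in l -> ~ A i t).
  apply: (@ev_False s x); apply: ev_mono (ev_and cov (H (enum I))) => t _.
  by move=> [[i Ai] /(_ i)]; rewrite mem_enum; apply.
elim: l => [|i l IH]; first by have [b xb] := lts_ex s x; exists b.
apply: ev_mono (ev_and (nA i) IH) => t _ [ni nl] j.
by rewrite inE => /predU1P [->|/nl].
Qed.

(** Definable completeness. The endpoint of the cut is one of the finitely many
    endpoints of the intervals and points that make up [B]; the others are
    excluded one by one, by moving [b] or [c] past them. *)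
Lemma om_cut s (B : M -> Prop) (b c : M) : dfp B ->
  (forall x y, lts s x y -> B y -> B x) -> B b -> ~ B c ->
  exists e, (forall x, lts s x e -> B x) /\ (forall x, lts s e x -> ~ B x).
Proof.
move=> /omin [F [l HB]] dB Bb nBc.
(* [B] does not change between points that no element of [ends] separates. *)
pose ends := F ++ flatten [seq pmap id [:: J.1; J.2] | J <- l].
have sep x y : B x -> ~ B y -> x < y \/ y < x ->
    exists2 e, e \in ends & Order.min x y <= e <= Order.max x y.
  move=> Bx nBy xy; apply: contrapT => noe.
  have noe' e : e \in ends -> ~~ (Order.min x y <= e <= Order.max x y).
    by move=> He; apply/negP => H; apply: noe; exists e.
  case/HB: Bx => [xF|[J Jl Jx]].
    have := noe' x; rewrite mem_cat xF ge_min le_max !lexx /=.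
    by move=> /(_ isT).
  apply: nBy; apply/HB; right; exists J => //.
  have memE o : o \in [:: J.1; J.2] -> forall e, o = Some e -> e \in ends.
    move=> Ho e E; rewrite mem_cat; apply/orP; right.
    apply/flattenP; exists (pmap id [:: J.1; J.2]); first exact: map_f.
    by rewrite mem_pmap; apply/mapP; exists o.
  case: Jx => Jx1 Jx2; split.
    case E: J.1 Jx1 => [a|] // ax.
    have /noe' := memE J.1 (mem_head _ _) a E.
    rewrite ge_min le_max.
    by case: (ltP a y) => // ya; rewrite (ltW ax) /= ?orbT.
  case E: J.2 Jx2 => [a|] // xa.
  have J2 : J.2 \in [:: J.1; J.2] by rewrite !inE eqxx orbT.
  have /noe' := memE _ J2 a E.
  rewrite ge_min le_max.
  by case: (ltP y a) => // ay; rewrite (ltW xa) /= ?orbT.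
have lin x y : B x -> ~ B y -> lts s x y.
  move=> Bx nBy; case: (lts_total s x y) => // [E|yx].
    by move: nBy; rewrite -E.
  by case: nBy; apply: dB yx Bx.
have {}sep x y : B x -> ~ B y ->
    exists2 e, e \in ends & ~ lts s e x /\ ~ lts s y e.
  move=> Bx nBy; have [|e He] := sep x y Bx nBy.
    by case: (s) (lin _ _ Bx nBy) => /= ->; auto.
  have := lin _ _ Bx nBy.
  case: (s) => /= xy /andP [H1 H2]; exists e => //.
    move: H1 H2; rewrite (min_idPl (ltW xy)) (max_idPr (ltW xy)).
    by rewrite !leNgt => /negP ? /negP ?.
  move: H1 H2; rewrite (min_idPr (ltW xy)) (max_idPl (ltW xy)).
  by rewrite !leNgt => /negP ? /negP ?.
have {}sep x y : B x -> ~ B y -> ~ lts s x b -> ~ lts s c y ->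
    exists2 e, e \in ends & ~ lts s e x /\ ~ lts s y e.
  by move=> *; apply: sep.
have le_lt x y z : ~ lts s y x -> lts s z x -> lts s z y.
  by move=> nyx zx; case: (lts_total s x y) => [xy|<-|] //; apply: lts_trans xy.
have lt_le x y z : ~ lts s y x -> lts s y z -> lts s x z.
  by move=> nyx yz; case: (lts_total s x y) => [xy|->|] //; apply: lts_trans yz.
move: ends sep => {HB F l} ends sep.
have {}sep x y : B x -> ~ B y -> ~ lts s x b -> ~ lts s c y ->
    exists2 e, e \in ends & ~ lts s e x /\ ~ lts s y e.
  by move=> *; apply: sep.
elim: ends b c Bb nBc sep => [|e ends IH] b c Bb nBc sep.
  by have [||//] := sep b c Bb nBc; rewrite lts_irr.
case: (pselect (B e)) => Be.
  case: (pselect (exists2 b', B b' & lts s e b')) => [[b' Bb' eb']|no]; last first.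
    exists e; split=> x; first by move=> /dB; apply.
    by move=> ex Bx; apply: no; exists x.
  have [b1 [Bb1 eb1 bb1]] : exists b1, [/\ B b1, lts s e b1 & ~ lts s b1 b].
    case: (pselect (lts s e b)) => eb; first by exists b; rewrite lts_irr.
    by exists b'; split=> // b'b; apply: eb; apply: lts_trans b'b.
  apply: (IH b1 c) => // x y Bx nBy xb1 cy.
  have [|//|f] := sep x y Bx nBy; first by move=> xb; apply: xb1; apply: le_lt bb1 xb.
  rewrite inE => /predU1P [->|fe]; last by exists f.
  by move=> [ex _]; case: ex; apply: le_lt xb1 eb1.
case: (pselect (exists2 c', ~ B c' & lts s c' e)) => [[c' Bc' ec']|no]; last first.
  exists e; split=> x; last by move=> /dB H /H.
  by move=> ex; apply: contrapT => Bx; apply: no; exists x.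
have [c1 [Bc1 ec1 cc1]] : exists c1, [/\ ~ B c1, lts s c1 e & ~ lts s c c1].
  case: (pselect (lts s c e)) => ec; first by exists c; rewrite lts_irr.
  by exists c'; split=> // b'b; apply: ec; apply: lts_trans ec'.
apply: (IH b c1) => // x y Bx nBy xb1 cy.
have [//||f] := sep x y Bx nBy; first by move=> yc; apply: cy; apply: lt_le cc1 yc.
rewrite inE => /predU1P [->|fe]; last by exists f.
by move=> [_ ex]; case: ex; apply: lt_le cy ec1.
Qed.

End Line.

(** * Monotonicity of definable functions of one variable *)

Section Monotone.
Context {d : Order.disp_t} {M : orderTopologicalType d} {L : language}.
Context {S : structure L M} {m0 : has_point M}.
Hypothesis hS : o_minimal S.
Local Notation dfp := (defpred (S := S)).
Local Notation dmap := (defmap (S := S)).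
Local Notation dense := (dense hS).
Local Notation om_ev := (om_ev hS).

Definition const_on (a b : M) (f : M -> M) : Prop :=
  forall x y, a < x < b -> a < y < b -> f x = f y.

Definition inj_on (a b : M) (f : M -> M) : Prop :=
  forall x y, a < x < b -> a < y < b -> x <> y -> f x <> f y.

Definition smono u (a b : M) (f : M -> M) : Prop :=
  forall x y, a < x < b -> a < y < b -> x < y -> lts u (f x) (f y).

(** The intermediate value property. *)
Definition ivp (a b : M) (f : M -> M) : Prop :=
  forall u x y v, a < x < b -> a < y < b -> x < y ->
    lts u (f x) v -> lts u v (f y) -> exists2 t, x < t < y & f t = v.

Lemma sub_itv (a a' b' b t : M) : a <= a' -> b' <= b -> a' < t < b' -> a < t < b.
Proof.
by move=> aa bb /andP [h h']; rewrite (le_lt_trans aa h) (lt_le_trans h' bb).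
Qed.

Lemma om_itv (a b : M) (A : M -> Prop) : a < b -> dfp A ->
  exists a' b', [/\ a <= a', a' < b', b' <= b &
    (forall t, a' < t < b' -> A t) \/ (forall t, a' < t < b' -> ~ A t)].
Proof.
move=> ab dA; have [H|H] := om_ev true a dA.
  have [e /= ae He] := ev_and H (ev_near (s := true) ab).
  have [f af fe] := dense ae; have [_ fb] := He f af fe.
  exists a, f; split=> //; first exact: ltW.
  by left=> t /andP [at' tf]; apply: (He t at' (lt_trans tf fe)).1.
have [e /= ae He] := ev_and H (ev_near (s := true) ab).
have [f af fe] := dense ae; have [_ fb] := He f af fe.
exists a, f; split=> //; first exact: ltW.
by right=> t /andP [at' tf]; apply: (He t at' (lt_trans tf fe)).1.
Qed.

Lemma om_itv_cover (a b : M) (I : finType) (A : I -> M -> Prop) : a < b ->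
  (forall i, dfp (A i)) -> (forall t, a < t < b -> exists i, A i t) ->
  exists i a' b', [/\ a <= a', a' < b', b' <= b & forall t, a' < t < b' -> A i t].
Proof.
move=> ab dA cov.
have [i Hi] : exists i, ev true a (A i).
  by apply: (ev_cover hS) => //; exists b => // t /= at' tb; apply: cov; rewrite at'.
have [e /= ae He] := ev_and Hi (ev_near (s := true) ab).
have [f af fe] := dense ae; have [_ fb] := He f af fe.
exists i, a, f; split=> //; first exact: ltW.
by move=> t /andP [at' tf]; apply: (He t at' (lt_trans tf fe)).1.
Qed.

(** If the points that are first in their fibre fill an interval at the left
    end, then [f] is injective there. Otherwise near the left end every point
    has an earlier one in its fibre. So a fibre has no least element and, by
    definable completeness, contains an interval. *)
Lemma const_or_inj (f : M -> M) (a b : M) : dmap f -> a < b ->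
  exists a' b', [/\ a <= a', a' < b', b' <= b &
    const_on a' b' f \/ inj_on a' b' f].
Proof.
move=> df ab.
pose first x := forall x', a < x' < x -> f x' <> f x.
have dF : dfp first by rewrite /first; dfn.
have [H|H] := om_ev true a dF.
  have [e /= ae He] := ev_and H (ev_near (s := true) ab).
  have [c ac ce] := dense ae; have [_ cb] := He c ac ce.
  exists a, c; split=> //; first exact: ltW.
  right=> x y /andP [ax xc] /andP [ay yc].
  have [/= xy _|//|/= yx _] := lts_total true x y.
    by apply: (He y ay (lt_trans yc ce)).1; rewrite ax.
  by move=> /esym; apply: (He x ax (lt_trans xc ce)).1; rewrite ay.
have [e /= ae He] := ev_and H (ev_near (s := true) ab).
have [x ax xe] := dense ae; have [_ xb] := He x ax xe.
pose fib y := [/\ a < y, y < e & f y = f x].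
have dfib : dfp fib.
  apply: (dfp_ext (P := fun y => a < y /\ y < e /\ f y = f x)).
    by move=> y; split=> [[? []]|[]].
  by dfn.
have fconst (p q : M) : a <= p -> q <= b ->
    (forall t, p < t < q -> fib t) -> const_on p q f.
  by move=> ap qb Hf t t' /Hf [_ _ ->] /Hf [_ _ ->].
have [E|E] := om_ev true a dfib.
  have [c /= ac Hc] := ev_and E (ev_near (s := true) ab).
  have [c' ac' cc'] := dense ac; have [_ cb] := Hc c' ac' cc'.
  exists a, c'; split=> //; first exact: ltW.
  left; apply: (fconst _ _ (lexx _) (ltW cb)).
  by move=> t /andP [h h']; apply: (Hc t h (lt_trans h' cc')).1.
pose B y := forall y', y' <= y -> ~ fib y'.
have [c /= ac Hc] := ev_and E (ev_near (s := true) ax).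
have [c' ac' cc'] := dense ac; have [_ cx] := Hc c' ac' cc'.
have [||||s [sB sNB]] := om_cut hS (s := true) (B := B) (b := c') (c := x).
- by rewrite /B; dfn.
- by move=> y z /= yz Bz y' y'y; apply: Bz; apply: le_trans (ltW yz).
- move=> y yc [ay ye fy]; apply: (Hc y ay (le_lt_trans yc cc')).1.
  by split.
- by move=> /(_ x (lexx _)); apply.
have as' : a < s.
  rewrite ltNge; apply/negP => sa.
  apply: (sNB c') => [|y yc [ay ye fy]] /=; first exact: le_lt_trans sa ac'.
  by apply: (Hc y ay (le_lt_trans yc cc')).1; split.
have below y : y < s -> ~ fib y by move=> ys /(sB y ys y (lexx _)).
have se : s < e.
  rewrite ltNge; apply/negP => es.
  by apply: (below x) => //; apply: lt_le_trans xe es.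
have nfs : ~ fib s.
  move=> [_ _ fs]; have [nF _] := He s as' se; apply: nF => s' /andP [as'' s's].
  by move=> E'; apply: (below s') => //; split=> //;
     [apply: lt_trans s's se|rewrite E'].
have [H1|H1] := om_ev true s dfib; last first.
  have [z sz Hz] := H1; have [w sw wz] := dense sz.
  exfalso; apply: (sNB w sw) => y yw.
  have [/= ys|->//|/= sy] := lts_total true y s; first exact: below.
  by apply: Hz => //; apply: le_lt_trans wz.
have sx : s <= x.
  by rewrite leNgt; apply/negP => /below; apply.
have sb : s < b by apply: le_lt_trans sx xb.
have [z sz Hz] := ev_and H1 (ev_near (s := true) sb).
have [w sw wz] := dense sz; have [_ wb] := Hz w sw wz.
exists s, w; split=> //; [exact: ltW|exact: ltW|left].
apply: (fconst _ _ (ltW as') (ltW wb)).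
by move=> t /andP [h h']; apply: (Hz t h (lt_trans h' wz)).1.
Qed.

Definition tend s u (f : M -> M) x := ev s x (fun y => lts u (f x) (f y)).

Lemma tend_cases s f x a b : dmap f -> inj_on a b f -> a < x < b ->
  exists u, tend s u f x.
Proof.
move=> df fi xab; have dA : dfp (fun y => f x < f y) by dfn.
have [H|H] := om_ev s x dA.
  by exists true.
exists false; have nb : ev s x (fun y => a < y < b).
  case/andP: xab => ax xb; case: (s).
    by exists b => // t /= xt ->; rewrite (lt_trans ax xt).
  by exists a => // t /= xt ->; rewrite (lt_trans xt xb).
apply: ev_mono (ev_and H nb) => y xy [] /negP; rewrite -leNgt le_eqVlt /=.
move=> /predU1P [E|//] yab; case: (fi _ _ yab xab) => //.
by move=> E'; apply: (lts_neq xy).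
Qed.

(** For fixed [x], the points up to which [f] stays on side [u] of [f x] form a
    cut. Its endpoint [e] still belongs to it, by the behaviour of [f] to the left of
    [e], and then so do points after [e], by the behaviour to the right. *)
Lemma tend_smono u f a b : dmap f ->
  (forall x, a < x < b -> tend true u f x /\ tend false (~~ u) f x) ->
  smono u a b f.
Proof.
move=> df H x y /andP [ax xb] /andP [ay yb] xy.
apply: contrapT => nxy.
pose B s := forall t, x < t -> t <= s -> lts u (f x) (f t).
have [||||e [eB eNB]] := om_cut hS (s := true) (B := B) (b := x) (c := y).
- by rewrite /B; dfn.
- by move=> p q /= pq Bq t xt tp; apply: Bq => //; apply: le_trans (ltW pq).
- by move=> t xt; rewrite leNgt xt.
- by move=> By; apply/nxy/By.
have [Hx _] : tend true u f x /\ tend false (~~ u) f x by apply: H; rewrite ax.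
have [z xz Hz] := Hx; have [w xw wz] := dense xz.
have xe : x < e.
  rewrite ltNge; apply/negP => ex.
  apply: (eNB w) => [/=|t xt tw]; first exact: le_lt_trans ex xw.
  by apply: Hz => //; apply: le_lt_trans wz.
have ey : e <= y.
  by rewrite leNgt; apply/negP => /eB /(_ y xy (lexx _)).
have [He1 He2] : tend true u f e /\ tend false (~~ u) f e.
  by apply: H; rewrite (lt_trans ax xe) (le_lt_trans ey yb).
have [t [/= te xt]] := ev_ex hS He2 (xe : lts false e x).
rewrite ltsN => fte.
have fe : lts u (f x) (f e) by apply: lts_trans fte; apply: (eB t) => //.
have [p /= ep Hp] := He1; have [q eq qp] := dense ep.
apply: (eNB q) => // s xs sq.
have [/= se|->//|/= es] := lts_total true s e; first exact: (eB s).
by apply: lts_trans fe _; apply: Hp => //; apply: le_lt_trans qp.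
Qed.

(** In the order of side [u], [f] drops at [x] when [x] is passed in the direction
    of side [s]. *)
Definition jump s u (f : M -> M) x := exists v,
  ev (~~ s) x (fun y => lts u v (f y)) /\ ev s x (fun y => lts u (f y) v).

Lemma evNP s (x : M) (P : M -> Prop) : ev (~~ s) x P ->
  exists2 a, lts s a x & forall t, lts s a t -> lts s t x -> P t.
Proof.
move=> [a xa Ha]; exists a; first by rewrite -ltsN.
by move=> t at' tx; apply: Ha; rewrite ltsN.
Qed.

Lemma evNI s (x a : M) (P : M -> Prop) : lts s a x ->
  (forall t, lts s a t -> lts s t x -> P t) -> ev (~~ s) x P.
Proof.
by move=> ax Ha; exists a => [|t]; rewrite !ltsN // => tx at'; apply: Ha.
Qed.

(** Suppose that every point of an interval is a strict local minimum, in the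
    order of side [u]. Then no point can be below all later ones near the end [q],
    so near [q] every point [c] has a lower value after it, and then all values
    sufficiently near [q] are lower than [f c]. The point at which values above
    [f c] cease is a jump, and it comes after [c]; so jumps accumulate at [q]. *)
Lemma min_jump s u f p q : dmap f -> lts s p q ->
  (forall x y, lts s p x -> lts s x q -> lts s p y -> lts s y q ->
    x <> y -> f x <> f y) ->
  (forall x, lts s p x -> lts s x q -> tend s u f x /\ tend (~~ s) u f x) ->
  ev (~~ s) q (jump s u f).
Proof.
move=> df pq fi loc.
pose B x := forall y, lts s x y -> lts s y q -> lts u (f x) (f y).
have dB : dfp B by rewrite /B; dfn.
have nearp : ev (~~ s) q (lts s p) by apply: (evNI pq).
(* If [B] held near [q], [f] would increase there, against the local minima. *)
have [HB|HB] := om_ev (~~ s) q dB.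
  have [p' p'q Hp'] := evNP (ev_and HB nearp).
  have [x p'x xq] := ltsW hS p'q.
  have [Bx px] := Hp' x p'x xq.
  have [_ /evNP [z zx Hz]] := loc x px xq.
  have [y [yx]] : exists y, [/\ lts s y x, lts s p' y & lts s z y].
    case: (lts_total s p' z) => [h|h|h].
    - by have [y zy yx] := ltsW hS zx; exists y; split=> //; apply: lts_trans zy.
    - by have [y zy yx] := ltsW hS zx; exists y; split=> //; rewrite h.
    - by have [y zy yx] := ltsW hS p'x; exists y; split=> //; apply: lts_trans zy.
  move=> p'y /Hz /(_ yx) fxy.
  have [By _] := Hp' y p'y (lts_trans yx xq).
  by exfalso; apply: (lts_asym fxy); apply: By.
have [p' p'q Hp'] := evNP (ev_and HB nearp).
have inI t : lts s p' t -> lts s t q -> lts s p t by move=> h /(Hp' t h) [].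
have down x : lts s p' x -> lts s x q ->
    exists y, [/\ lts s x y, lts s y q & lts u (f y) (f x)].
  move=> p'x xq; have [nB px] := Hp' x p'x xq.
  move/existsNP: nB => [y /not_implyP [xy /not_implyP [yq fxy]]].
  exists y; split=> //; apply: lts_or => //.
  by apply: fi => //; [exact: inI (lts_trans p'x xy) yq|exact: lts_neq xy].
(* Otherwise the values near [q] are above [f c]. Let [e] be the point
   after which no value is below [f c]. By the local minimum at [e], [f e] is not
   above [f c], and a lower value after [e] contradicts the choice of [e]. *)
have low c : lts s p' c -> lts s c q -> ev (~~ s) q (fun y => lts u (f y) (f c)).
  move=> p'c cq.
  have dC : dfp (fun y => lts u (f y) (f c)) by dfn.
  have [//|H] := om_ev (~~ s) q dC.
  have [z0 z0q Hz0] := evNP (ev_and H (evNI (a := c) cq (fun t h _ => h))).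
  pose D x := exists y, [/\ ~ lts s y x, lts s c y, lts s y q & lts u (f y) (f c)].
  have dD : dfp D.
    apply: (dfp_ext (P := fun x => exists y, ~ lts s y x /\ lts s c y /\
      lts s y q /\ lts u (f y) (f c))).
      by move=> x; split=> -[y]; [move=> [? [? []]]|move=> []]; exists y.
    by dfn.
  have [w z0w wq] := ltsW hS z0q.
  have [|||e [eD eND]] := @om_cut _ _ _ _ _ hS s D c w dD.
  - move=> x y xy [t [ty ct tq ft]]; exists t; split=> // tx; apply: ty.
    exact: lts_trans xy.
  - have [y [cy yq fy]] := down c p'c cq; exists y; split=> //.
    by move=> /(lts_asym cy).
  - move=> [y [yw cy yq fy]]; have [|] := Hz0 y _ yq.
      by case: (lts_total s w y) => [wy|<-|] //; apply: lts_trans wy.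
    by move=> /(_ fy).
  have ce : ~ lts s e c.
    move=> ec; have [y [cy yq fy]] := down c p'c cq.
    by apply: (eND c ec); exists y; split=> // /(lts_asym cy).
  have ew : ~ lts s w e.
    move=> /eD [y [yw cy yq fy]]; have [|] := Hz0 y _ yq.
      by case: (lts_total s w y) => [wy|<-|] //; apply: lts_trans wy.
    by move=> /(_ fy).
  have eq : lts s e q.
    by case: (lts_total s e w) => [h|->|] //; apply: lts_trans wq.
  have p'e : lts s p' e.
    by case: (lts_total s e c) => [//|->|h] //; apply: lts_trans h.
  have above y : lts s e y -> lts s y q -> lts u (f c) (f y).
    move=> ey yq; have cy : lts s c y.
      by case: (lts_total s e c) => [//|<-|h] //; apply: lts_trans ey.
    apply: lts_or.
      apply: fi => //; [exact: inI (lts_trans p'e ey) yq|exact: inI|].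
      exact/nesym/(lts_neq cy).
    move=> fy; have [x ex xy] := ltsW hS ey; apply: (eND x ex); exists y.
    by split=> // /(lts_asym xy).
  have nfe : ~ lts u (f c) (f e).
    move=> fce; have ec : lts s c e.
      by case: (lts_total s e c) fce => [//|->|] //; rewrite lts_irr.
    have [_ /evNP [z ze Hz]] := loc e (inI _ p'e eq) eq.
    have [x zx xe] := ltsW hS ze.
    have [y [yx cy yq fy]] := eD x xe.
    have [ye|E|/above] := lts_total s y e.
    - have zy : lts s z y.
        by case: (lts_total s x y) => [h|<-|] //; apply: lts_trans h.
      by apply: (lts_asym fy); apply: lts_trans fce (Hz y zy ye).
    - by apply: (lts_asym fy); rewrite E.
    - by move=> /(_ yq) /(lts_asym fy).
  have [y [ey yq fy]] := down e p'e eq.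
  by exfalso; apply: nfe; apply: lts_trans fy; apply: above.
have jumps c : lts s p' c -> lts s c q ->
    exists e, [/\ lts s c e, lts s e q & jump s u f e].
  move=> p'c cq.
  pose D x := exists y, [/\ ~ lts s y x, lts s c y, lts s y q & lts u (f c) (f y)].
  have dD : dfp D.
    apply: (dfp_ext (P := fun x => exists y, ~ lts s y x /\ lts s c y /\
      lts s y q /\ lts u (f c) (f y))).
      by move=> x; split=> -[y]; [move=> [? [? []]]|move=> []]; exists y.
    by dfn.
  have [z0 z0q Hz0] := evNP (low c p'c cq).
  have [w z0w wq] := ltsW hS z0q.
  have [Hc _] := loc c (inI _ p'c cq) cq.
  have [b [cb bq fb]] := ev_ex hS Hc cq.
  have nDw : ~ D w.
    move=> [y [yw cy yq fy]]; apply: (lts_asym fy); apply: Hz0 => //.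
    by case: (lts_total s w y) => [wy|<-|] //; apply: lts_trans wy.
  have Db : D b by exists b; rewrite lts_irr.
  have [|||e [eD eND]] := @om_cut _ _ _ _ _ hS s D b w dD => //.
    move=> x y xy [t [ty ct tq ft]]; exists t; split=> // tx; apply: ty.
    exact: lts_trans xy.
  have ew : ~ lts s w e by move=> /eD.
  have eq : lts s e q.
    by case: (lts_total s e w) => [h|->|] //; apply: lts_trans wq.
  have ce : lts s c e.
    case: (lts_total s b e) => [h|<-|h] //; first exact: lts_trans h.
    by case: (eND b h).
  have pe : lts s p e by apply: inI eq; apply: lts_trans ce.
  have cneq y : lts s c y -> lts s y q -> f y <> f c.
    move=> cy yq; apply: fi => //; last by apply/nesym/lts_neq/cy.
    - by apply: inI => //; apply: lts_trans cy.
    - exact: inI.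
  have after y : lts s e y -> lts s y q -> lts u (f y) (f c).
    move=> ey yq; apply: lts_or; first by apply/nesym/cneq => //; apply: lts_trans ey.
    move=> fy; have [x ex xy] := ltsW hS ey; apply: (eND x ex); exists y.
    by split=> //; [move/(lts_asym xy)|apply: lts_trans ey].
  exists e; split=> //; exists (f c); split; last by exists q.
  have dA : dfp (fun y => lts u (f c) (f y)) by dfn.
  have [//|/evNP [z ze Hz]] := om_ev (~~ s) e dA.
  have [x zx xe] := ltsW hS ze.
  have [y [yx cy yq fy]] := eD x xe.
  have zy : lts s z y.
    by case: (lts_total s x y) => [h|<-|] //; apply: lts_trans h.
  have [ye|E|ey] := lts_total s y e.
  - by case: (Hz y zy ye).
  - have [_ /evNP [z' ze' Hz']] := loc e pe eq.
    have [t [te zt zt']] : exists t, [/\ lts s t e, lts s z t & lts s z' t].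
      case: (lts_total s z z') => [h|h|h].
      - by have [t ? ?] := ltsW hS ze'; exists t; split=> //; apply: lts_trans h _.
      - by have [t ? ?] := ltsW hS ze'; exists t; split=> //; rewrite h.
      - by have [t ? ?] := ltsW hS ze; exists t; split=> //; apply: lts_trans h _.
    by case: (Hz t zt te); apply: lts_trans fy _; rewrite E; apply: Hz'.
  - by case: (lts_asym fy); apply: after.
have dJ : dfp (jump s u f) by rewrite /jump; dfn.
have [//|/(ev_and _) H] := om_ev (~~ s) q dJ.
have [z zq Hz] := evNP (H _ (evNI (a := p') p'q (fun t h _ => h))).
have [c zc cq] := ltsW hS zq.
have [p'c _] := Hz c zc cq.
have [e [ce eq Je]] := jumps c p'c cq.
by have [] := Hz e (lts_trans zc ce) eq.
Qed.

(** Applied from both directions, [min_jump] yields a point at which [f] jumps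
    both downwards and upwards. *)
Lemma no_min u f a b : dmap f -> a < b -> inj_on a b f ->
  ~ (forall x, a < x < b -> tend true u f x /\ tend false u f x).
Proof.
move=> df ab fi loc.
have [||c /= cb Hc] := evNP (min_jump (s := true) (u := u) (p := a) (q := b) df ab _ _).
- by move=> x y ax xb ay yb; apply: fi; apply/andP.
- by move=> x ax xb; apply: loc; apply/andP.
have [c' [cc' c'b ac']] : exists c', [/\ c <= c', c' < b & a <= c'].
  case: (leP a c) => ac; first by exists c.
  by exists a; split=> //; apply: ltW.
have [||e /= c'e He] := min_jump (s := false) (u := u) (p := b) (q := c') df c'b _ _.
- move=> x y xb cx yb cy; apply: fi; apply/andP; split=> //.
    exact: le_lt_trans cx.
  exact: le_lt_trans cy.
- move=> x xb cx; have [|t1 t2] := loc x; last by split.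
  by apply/andP; split; [apply: le_lt_trans cx|].
have eJ : ev true c' (jump false u f) by exists e.
have [x [/= cx xb Jx]] := ev_ex hS eJ (c'b : lts true c' b).
have [v [v1 v2]] := Jx.
have [w [w1 w2]] := Hc x (le_lt_trans cc' cx) xb.
have [y _ [y1 y2]] := ev_exP hS (ev_and v1 w2).
have [z _ [z1 z2]] := ev_exP hS (ev_and v2 w1).
by apply: (lts_asym (lts_trans y1 y2)); apply: lts_trans z1.
Qed.

Lemma inj_smono f a b : dmap f -> a < b -> inj_on a b f ->
  exists u a' b', [/\ a <= a', a' < b', b' <= b & smono u a' b' f].
Proof.
move=> df ab fi.
pose A (i : bool * bool) x := tend true i.1 f x /\ tend false i.2 f x.
have [||[u w] [a' [b' [aa ab' bb H]]]] := @om_itv_cover a b _ A ab.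
- by move=> i; rewrite /A /tend; dfn.
- move=> t tab; have [u Hu] := tend_cases true df fi tab.
  by have [w Hw] := tend_cases false df fi tab; exists (u, w).
have [E|E] := eqVneq w u.
  case: (@no_min u f a' b' df ab'); last by rewrite -{2}E.
  by move=> x y xab yab; apply: fi; apply: sub_itv; eauto.
exists u, a', b'; split=> //; apply: tend_smono => // x xab.
by have := H x xab; rewrite /A /= (_ : w = ~~ u) //; case: (u) (w) E => -[].
Qed.

(** The image of an interval under an injective definable function is infinite,
    so it contains an interval; between two preimages of points of the latter no
    intermediate value is missed. *)
Lemma smono_ivp u f a b : dmap f -> a < b -> smono u a b f ->
  exists a' b', [/\ a <= a', a' < b', b' <= b & ivp a' b' f].
Proof.
move=> df ab fm.
have fi a' b' : a <= a' -> b' <= b -> inj_on a' b' f.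
  move=> aa bb x y /(sub_itv aa bb) xab /(sub_itv aa bb) yab.
  have [/= xy|//|/= yx] := lts_total true x y => _.
    exact: lts_neq (fm x y xab yab xy).
  exact/nesym/(lts_neq (fm y x yab xab yx)).
pose Im v := exists2 t, a < t < b & f t = v.
have dI : dfp Im by rewrite /Im; dfn.
have [F [l HI]] := omin hS dI.
have avoid (F' : seq M) : exists a' b', [/\ a <= a', a' < b', b' <= b &
    forall t, a' < t < b' -> f t \notin F'].
  elim: F' => [|v F' [a' [b' [aa ab' bb H]]]]; first by exists a, b.
  case: (pselect (exists2 t, a' < t < b' & f t = v)) => [[t tab ft]|nt]; last first.
    exists a', b'; split=> // t tab; rewrite inE negb_or H // andbT.
    by apply/eqP => ft; apply: nt; exists t.
  have [at' tb] := andP tab; exists a', t; split=> //.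
    exact: le_trans (ltW tb) bb.
  move=> x xat; have xab := sub_itv (lexx _) (ltW tb) xat.
  rewrite inE negb_or H // andbT -ft; apply/eqP; apply: fi aa bb _ _ xab tab _.
  by move=> E; move: xat; rewrite E ltxx andbF.
have [a' [b' [aa ab' bb HF]]] := avoid F.
have [t at' tb] := dense ab'.
have : Im (f t) by exists t => //; apply: sub_itv aa bb _; rewrite at'.
move/HI => [tF|[J Jl Jt]]; first by have := HF t; rewrite at' tb tF => /(_ isT).
have [c [e [cft fte HJ]]] : exists c e, [/\ c < f t, f t < e &
    forall v, c < v < e -> Im v].
  have [c cft Hc] : exists2 c, c < f t & forall v, c < v ->
      (if J.1 is Some x then (x < v : Prop) else True).
    case: (J.1) Jt.1 => [x xt|_]; first by exists x.
    by have [c ct] := lt_ex hS (f t); exists c.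
  have [e eft He] : exists2 e, f t < e & forall v, v < e ->
      (if J.2 is Some x then (v < x : Prop) else True).
    case: (J.2) Jt.2 => [x xt|_]; first by exists x.
    by have [k kt] := gt_ex hS (f t); exists k.
  exists c, e; split=> // v /andP [cv ve]; apply/HI; right; exists J => //.
  by split; [have := Hc v cv; case: (J.1)|have := He v ve; case: (J.2)].
have [v cv vt] := dense cft.
have [x xab fx] : Im v by apply: HJ; rewrite cv (lt_trans vt).
have tab : a < t < b by apply: sub_itv aa bb _; rewrite at'.
have main p q : a < p < b -> a < q < b -> p < q -> c < f p < e -> c < f q < e ->
    exists a' b', [/\ a <= a', a' < b', b' <= b & ivp a' b' f].
  move=> pab qab pq fp fq; exists p, q; split=> //.
  - by case/andP: pab => /ltW.
  - by case/andP: qab => _ /ltW.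
  move=> w y z r yab zab yz fyr frz.
  have [ap _] := andP pab; have [_ qb] := andP qab.
  have yab' := sub_itv (ltW ap) (ltW qb) yab.
  have zab' := sub_itv (ltW ap) (ltW qb) zab.
  have fyz := fm y z yab' zab' yz.
  have E : w = u.
    have := lts_trans fyr frz; move: fyz.
    by case: (u) (w) => -[] //= h /(lt_trans h); rewrite ltxx.
  rewrite {w}E in fyr frz.
  have [py yq] := andP yab; have [pz zq] := andP zab.
  have h1 : lts u (f p) r by apply: lts_trans fyr; apply: fm.
  have h2 : lts u r (f q) by apply: lts_trans frz _; apply: fm.
  have [k kab fk] : Im r.
    apply: HJ; case/andP: fp => cp pe; case/andP: fq => cq qe.
    case: (u) h1 h2 => /= h1 h2.
      by rewrite (lt_trans cp h1) (lt_trans h2 qe).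
    by rewrite (lt_trans cq h2) (lt_trans h1 pe).
  exists k => //; apply/andP; split; rewrite ltNge; apply/negP.
    rewrite le_eqVlt => /predU1P [E|ky]; first by move: fyr; rewrite -E fk lts_irr.
    by apply: (lts_asym fyr); rewrite -fk; apply: fm.
  rewrite le_eqVlt => /predU1P [E|ky]; first by move: frz; rewrite E fk lts_irr.
  by apply: (lts_asym frz); rewrite -fk; apply: fm.
have fxce : c < f x < e by rewrite fx cv (lt_trans vt).
have ftce : c < f t < e by rewrite cft.
have [xt|E|tx] := lts_total true x t.
- exact: (main x t).
- by move: vt; rewrite -fx E ltxx.
- exact: (main t x).
Qed.

(** Three steps, each on a smaller interval: constant or injective, then injective
    hence strictly monotone, then strictly monotone hence without gaps. *)
Theorem monotonicity f a b : dmap f -> a < b ->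
  exists a' b', [/\ a <= a', a' < b', b' <= b &
    const_on a' b' f \/ exists2 u, smono u a' b' f & ivp a' b' f].
Proof.
move=> df ab; have [a1 [b1 [aa ab1 bb [H|H]]]] := const_or_inj df ab.
  by exists a1, b1; split=> //; left.
have [u [a2 [b2 [aa2 ab2 bb2 fm]]]] := inj_smono df ab1 H.
have [a3 [b3 [aa3 ab3 bb3 fv]]] := smono_ivp df ab2 fm.
exists a3, b3; split=> //; [by rewrite (le_trans aa) // (le_trans aa2)| |].
  by rewrite (le_trans bb3) // (le_trans bb2).
right; exists u => // x y /(sub_itv aa3 bb3) xab /(sub_itv aa3 bb3) yab.
exact: fm.
Qed.

Definition contM (f : M -> M) (x : M) : Prop := forall c e, c < f x -> f x < e ->
  exists p q, [/\ p < x, x < q & forall y, p < y < q -> c < f y < e].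

Lemma dfp_contM f : dmap f -> dfp (contM f).
Proof.
move=> df; rewrite /contM.
apply: (dfp_ext (P := fun x => forall c e, c < f x -> f x < e ->
  exists p q, p < x /\ x < q /\ forall y, p < y < q -> c < f y < e)); last by dfn.
move=> x; split=> H c e cx xe; have [p [q]] := H c e cx xe.
  by move=> [? []]; exists p, q.
by move=> []; exists p, q.
Qed.

Lemma smono_cont u f a b x : a < x < b -> smono u a b f -> ivp a b f -> contM f x.
Proof.
move=> xab fm fv.
have [ax xb] := andP xab.
have [p0 ap0 p0x] := dense ax; have [q0 xq0 q0b] := dense xb.
have p0ab : a < p0 < b by rewrite ap0 (lt_trans p0x).
have q0ab : a < q0 < b by rewrite (lt_trans ax).
have [Hl Hr] : (forall c, lts u c (f x) -> exists2 p, a < p < x & lts u c (f p)) /\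
    (forall c, lts u (f x) c -> exists2 p, x < p < b & lts u (f p) c).
  split=> c cx.
    case: (lts_total u c (f p0)) => [h|h|h].
    - by exists p0 => //; rewrite ap0.
    - have [p p0p px] := dense p0x; exists p; first by rewrite (lt_trans ap0 p0p).
      by rewrite h; apply: fm => //; rewrite (lt_trans ap0 p0p) (lt_trans px).
    - have [c' cc' c'x] := ltsW hS cx.
      have [p /andP [p1 p2] fp] := fv u p0 x c' p0ab xab p0x (lts_trans h cc') c'x.
      by exists p; rewrite ?fp // p2 (lt_trans ap0).
  case: (lts_total u (f q0) c) => [h|h|h].
  - by exists q0 => //; rewrite xq0.
  - have [p xp pq0] := dense xq0; exists p; first by rewrite xp (lt_trans pq0 q0b).
    by rewrite -h; apply: fm => //; rewrite (lt_trans ax xp) (lt_trans pq0).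
  - have [c' cc' c'x] := ltsW hS cx.
    have [p /andP [p1 p2] fp] := fv u x q0 c' xab q0ab xq0 cc' (lts_trans c'x h).
    by exists p; rewrite ?fp // p1 (lt_trans p2).
have H c e : lts u c (f x) -> lts u (f x) e -> exists p q, [/\ p < x, x < q &
    forall y, p < y < q -> lts u c (f y) /\ lts u (f y) e].
  move=> /Hl [p /andP [ap px] cp] /Hr [q /andP [xq qb] qe].
  have pab : a < p < b by rewrite ap (lt_trans px).
  have qab : a < q < b by rewrite qb (lt_trans ax).
  exists p, q; split=> // y /andP [py yq].
  have yab : a < y < b by rewrite (lt_trans ap py) (lt_trans yq qb).
  by split; [apply: lts_trans cp _|apply: lts_trans qe]; apply: fm.
move=> c e cx xe; case: (u) H => /= H.
  have [p [q [px xq Hpq]]] := H c e cx xe; exists p, q; split=> // y /Hpq [-> //].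
have [p [q [px xq Hpq]]] := H e c xe cx.
by exists p, q; split=> // y /Hpq [-> ->].
Qed.

Lemma const_cont f a b x : a < x < b -> const_on a b f -> contM f x.
Proof.
move=> xab fc c e cx xe; case/andP: (xab) => ax xb; exists a, b; split=> // y yab.
by rewrite (fc y x) // cx.
Qed.

(** The points of discontinuity form a definable set, which contains no interval
    by the monotonicity theorem. *)
Lemma ev_contM f s x : dmap f -> ev s x (contM f).
Proof.
move=> df; have [//|[a xa Ha]] := om_ev s x (dfp_contM df); exfalso.
have main p q : p < q -> (forall t, p < t < q -> ~ contM f t) -> False.
  move=> pq H; have [p' [q' [pp p'q' qq H']]] := monotonicity df pq.
  have [t pt tq] := dense p'q'; have tpq : p' < t < q' by rewrite pt.
  apply: (H t (sub_itv pp qq tpq)).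
  case: H' => [H'|[u H' H'']]; first exact: const_cont tpq H'.
  exact: smono_cont tpq H' H''.
case: (s) xa Ha => /= xa Ha.
  by apply: (main x a xa) => t /andP [h h']; apply: Ha.
by apply: (main a x xa) => t /andP [h h']; apply: Ha.
Qed.

End Monotone.

(** * Generic behaviour of definable sets and functions on boxes *)

Section BoxDefs.
Context {d : Order.disp_t} {M : orderTopologicalType d}.

Definition box k (a b : 'rV[M]_k) : set 'rV[M]_k :=
  fun x => forall i, a ord0 i < x ord0 i < b ord0 i.

Definition nbox k (a b : 'rV[M]_k) : Prop := forall i, a ord0 i < b ord0 i.

Definition nearV k (x : 'rV[M]_k) (P : 'rV[M]_k -> Prop) : Prop :=
  exists a b, box a b x /\ forall y, box a b y -> P y.

Definition contV k (f : 'rV[M]_k -> M) (x : 'rV[M]_k) : Prop :=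
  forall c e, c < f x -> f x < e -> nearV x (fun y => c < f y < e).

Definition consV k (t : M) (x : 'rV[M]_k) : 'rV[M]_k.+1 :=
  (\row_i if unlift ord0 i is Some j then x ord0 j else t)%R.

Definition tailV k (y : 'rV[M]_k.+1) : 'rV[M]_k := (\row_j y ord0 (lift ord0 j))%R.

Definition sel k k' (J : 'I_k' -> 'I_k) (x : 'rV[M]_k) : 'rV[M]_k' :=
  (\row_i x ord0 (J i))%R.

Definition setc k (u : 'rV[M]_k) (j : 'I_k) (t : M) : 'rV[M]_k :=
  (\row_i if i == j then t else u ord0 i)%R.

Lemma setc_other k (u : 'rV[M]_k) j t i : i != j -> setc u j t ord0 i = u ord0 i.
Proof. by rewrite mxE => /negPf ->. Qed.

Lemma setc_same k (u : 'rV[M]_k) j t : setc u j t ord0 j = t.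
Proof. by rewrite mxE eqxx. Qed.

Lemma consV0 k t (x : 'rV[M]_k) : consV t x ord0 ord0 = t.
Proof. by rewrite mxE unlift_none. Qed.

Lemma consVS k t (x : 'rV[M]_k) j : consV t x ord0 (lift ord0 j) = x ord0 j.
Proof. by rewrite mxE liftK. Qed.

Lemma tailVE k (x : 'rV[M]_k.+1) j : tailV x ord0 j = x ord0 (lift ord0 j).
Proof. by rewrite mxE. Qed.

Lemma consVK k t (x : 'rV[M]_k) : tailV (consV t x) = x.
Proof. by apply/rowP => j; rewrite tailVE consVS. Qed.

Lemma consV_tail k (x : 'rV[M]_k.+1) : consV (x ord0 ord0) (tailV x) = x.
Proof.
by apply/rowP => i; rewrite mxE; case: unliftP => [j|] -> //; rewrite tailVE.
Qed.

Lemma forall_ordS k (P : 'I_k.+1 -> Prop) :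
  (forall i, P i) <-> P ord0 /\ forall j, P (lift ord0 j).
Proof.
split=> [H|[H0 HS] i]; first by split=> [|j]; apply: H.
by case: (unliftP ord0 i) => [j|] ->.
Qed.

Lemma box_cons k (a b x : 'rV[M]_k.+1) : box a b x <->
  a ord0 ord0 < x ord0 ord0 < b ord0 ord0 /\ box (tailV a) (tailV b) (tailV x).
Proof.
rewrite /box forall_ordS; split=> -[H0 HS]; split=> // j.
  by rewrite !tailVE; apply: HS.
by have := HS j; rewrite !tailVE.
Qed.

Lemma box_consV k l r (a b : 'rV[M]_k) t x :
  box (consV l a) (consV r b) (consV t x) <-> l < t < r /\ box a b x.
Proof. by rewrite box_cons !consV0 !consVK. Qed.

Lemma nbox_cons k (a b : 'rV[M]_k.+1) : nbox a b <->
  a ord0 ord0 < b ord0 ord0 /\ nbox (tailV a) (tailV b).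
Proof.
rewrite /nbox forall_ordS; split=> -[H0 HS]; split=> // j.
  by rewrite !tailVE; apply: HS.
by have := HS j; rewrite !tailVE.
Qed.

Lemma nbox_consV k l r (a b : 'rV[M]_k) :
  nbox (consV l a) (consV r b) <-> l < r /\ nbox a b.
Proof. by rewrite nbox_cons !consV0 !consVK. Qed.

Lemma box_nbox k (a b x : 'rV[M]_k) : box a b x -> nbox a b.
Proof. by move=> H i; have /andP [h h'] := H i; apply: lt_trans h h'. Qed.

Lemma nearV_box k (a b x : 'rV[M]_k) : box a b x -> nearV x (box a b).
Proof. by exists a, b. Qed.

Lemma nearV_mono k (x : 'rV[M]_k) (P Q : 'rV[M]_k -> Prop) :
  (forall y, P y -> Q y) -> nearV x P -> nearV x Q.
Proof. by move=> PQ [a [b [xab H]]]; exists a, b; split=> // y /H /PQ. Qed.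

Lemma nearV_and k (x : 'rV[M]_k) (P Q : 'rV[M]_k -> Prop) :
  nearV x P -> nearV x Q -> nearV x (fun y => P y /\ Q y).
Proof.
move=> [a [b [xab HP]]] [a' [b' [xab' HQ]]].
exists (\row_i Order.max (a ord0 i) (a' ord0 i))%R.
exists (\row_i Order.min (b ord0 i) (b' ord0 i))%R.
split=> [i|y yab].
  rewrite !mxE gt_max lt_min; case/andP: (xab i) => -> ->.
  by case/andP: (xab' i) => -> ->.
by split; [apply: HP|apply: HQ] => i; have := yab i; rewrite !mxE gt_max lt_min;
  do 2 case/andP; move=> h h' /andP [h1 h2]; apply/andP.
Qed.

Lemma contVP k (f : 'rV[M]_k -> M) (x : 'rV[M]_k) c e : contV f x ->
  c < f x -> f x < e -> nearV x (fun y => c < f y /\ f y < e).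
Proof. by move=> H cx xe; apply: nearV_mono (H c e cx xe) => y /andP. Qed.

End BoxDefs.

Section BoxDefinable.
Context {d : Order.disp_t} {M : orderTopologicalType d} {L : language}.
Context {S : structure L M} {m0 : has_point M} {G : Type} {c : ctx S G}.
Local Notation dfp := (defpred (S := S)).
Local Notation dmap := (defmap (S := S)).

Lemma dmap_consV k (f : G -> M) (g : G -> 'rV[M]_k) :
  dmap f -> dmap g -> dmap (fun x => consV (f x) (g x)).
Proof.
move=> df dg; rewrite /consV; apply: dmap_mx => i.
by case: (unlift ord0 i) => [j|] //; dfn.
Qed.

Lemma dmap_tailV k (g : G -> 'rV[M]_k.+1) : dmap g -> dmap (fun x => tailV (g x)).
Proof. by move=> dg; rewrite /tailV; dfn. Qed.

Lemma dmap_sel k k' (J : 'I_k' -> 'I_k) (g : G -> 'rV[M]_k) :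
  dmap g -> dmap (fun x => sel J (g x)).
Proof. by move=> dg; rewrite /sel; dfn. Qed.

Lemma dmap_setc k (j : 'I_k) (u : G -> 'rV[M]_k) (t : G -> M) :
  dmap u -> dmap t -> dmap (fun x => setc (u x) j (t x)).
Proof. by move=> du dt; rewrite /setc; apply: dmap_mx => i; case: (i == j); dfn. Qed.

Lemma dfp_box k (a b x : G -> 'rV[M]_k) :
  dmap a -> dmap b -> dmap x -> dfp (fun y => box (a y) (b y) (x y)).
Proof. by move=> *; rewrite /box; dfn. Qed.

End BoxDefinable.

Ltac dfn_hook ::= lazymatch goal with
  | |- defpred (fun x => is_true (lts _ _ _)) => apply: dfp_lts
  | |- defpred (fun x => ev _ (@?f x) (@?P x)) =>
      apply: (@dfp_ev _ _ _ _ _ _ _ _ f P)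
  | |- defpred (fun x => box _ _ _) => apply: dfp_box
  | |- defmap (fun x => consV _ _) => apply: dmap_consV
  | |- defmap (fun x => tailV _) => apply: dmap_tailV
  | |- defmap (fun x => sel _ _) => apply: dmap_sel
  | |- defmap (fun x => setc _ _ _) => apply: dmap_setc
  end.

Section Boxes.
Context {d : Order.disp_t} {M : orderTopologicalType d} {L : language}.
Context {S : structure L M} {m0 : has_point M}.
Hypothesis hS : o_minimal S.
Hypothesis hSk : definable_skolem_functions S.
Local Notation dfp := (defpred (S := S)).
Local Notation dmap := (defmap (S := S)).
Local Notation dense := (dense hS).

Lemma box_mid k (a b : 'rV[M]_k) : nbox a b -> exists x, box a b x.
Proof.
move=> ab; have H i : exists t, a ord0 i < t < b ord0 i.
  by have [t h h'] := dense (ab i); exists t; rewrite h.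
have [x Hx] := choice H; exists (\row_i x i)%R => i.
by rewrite mxE; apply: Hx.
Qed.

(** The next two properties are proved together by induction on [k]: the first
    in dimension [k + 1] uses the second in dimension [k], and conversely the
    continuity in dimension [k + 1] of a separately continuous function uses the
    dichotomy for the set where it is continuous in the other variables. *)
Definition sub_dichotomy k : Prop := forall (a b : 'rV[M]_k) (P : 'rV[M]_k -> Prop),
  nbox a b -> dfp P -> exists a' b', [/\ nbox a' b', box a' b' `<=` box a b &
    (forall x, box a' b' x -> P x) \/ (forall x, box a' b' x -> ~ P x)].

Definition generic_continuity k : Prop :=
  forall (a b : 'rV[M]_k) (f : 'rV[M]_k -> M),
  nbox a b -> dmap f -> exists a' b', [/\ nbox a' b', box a' b' `<=` box a b &
    forall x, box a' b' x -> contV f x].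

(** Where three definable functions are continuous, strict inequalities between
    them are witnessed by constants on a smaller box. *)
Lemma squeeze_of k : generic_continuity k ->
  forall (a b : 'rV[M]_k) (l t r : 'rV[M]_k -> M), nbox a b ->
  dmap l -> dmap t -> dmap r -> (forall x, box a b x -> l x < t x /\ t x < r x) ->
  exists a' b' l0 r0, [/\ nbox a' b', box a' b' `<=` box a b &
    forall x, box a' b' x -> [/\ l x < l0, l0 < t x, t x < r0 & r0 < r x]].
Proof.
move=> Ck a b l t r ab dl dt dr ltr.
have [a1 [b1 [ab1 sub1 cl]]] := Ck a b l ab dl.
have [a2 [b2 [ab2 sub2 ct]]] := Ck _ _ t ab1 dt.
have [a3 [b3 [ab3 sub3 cr]]] := Ck _ _ r ab2 dr.
have [x x3] := box_mid ab3.
have x2 := sub3 _ x3; have x1 := sub2 _ x2.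
have [lt tr] := ltr x (sub1 _ x1).
have [l0 ll0 l0t] := dense lt; have [r0 tr0 r0r] := dense tr.
have [z zl] := lt_ex hS (l x); have [w rw] := gt_ex hS (r x).
have Hl := contVP (cl x x1) zl ll0.
have Ht := contVP (ct x x2) l0t tr0.
have Hr := contVP (cr x x3) r0r rw.
have [a' [b' [xab H]]] := nearV_and (nearV_and Hl Ht) (nearV_and Hr (nearV_box x3)).
exists a', b', l0, r0; split; first exact: box_nbox xab.
  by move=> y /H [_ [_ /sub3 /sub2 /sub1]].
by move=> y /H [[[_ ?] [? ?]] [[? _] _]].
Qed.

(** Definable families of intervals contain a fixed interval over a smaller box,
    by [squeeze_of] applied to the endpoints and a point in between. *)
Lemma fiber_itv_of k : generic_continuity k ->
  forall (a b : 'rV[M]_k) (Q : 'rV[M]_k -> M -> M -> Prop), nbox a b ->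
  dfp (fun y => Q y.1.1 y.1.2 y.2) ->
  (forall x l r l' r', l <= l' -> l' < r' -> r' <= r -> Q x l r -> Q x l' r') ->
  (forall x, box a b x -> exists l r, l < r /\ Q x l r) ->
  exists a' b' l0 r0, [/\ nbox a' b', box a' b' `<=` box a b, l0 < r0 &
    forall x, box a' b' x -> Q x l0 r0].
Proof.
move=> Ck a b Q ab dQ mQ exQ.
pose R x (y : M * M * M) := box a b x -> [/\ y.1.1 < y.1.2, y.1.2 < y.2 &
  Q x y.1.1 y.2].
have dR : dfp (fun y => R y.1 y.2) by rewrite /R; dfn.
have [x|f df Rf] := @skolem _ _ _ S m0 hSk _ _ _ _ R dR.
  case: (pselect (box a b x)) => [/exQ [l [r [lr Qx]]]|nx].
    by have [t lt tr] := dense lr; exists (l, t, r).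
  by exists (m0, m0, m0).
have dl : dmap (fun x => (f x).1.1) by dfn.
have dt : dmap (fun x => (f x).1.2) by dfn.
have dr : dmap (fun x => (f x).2) by dfn.
have [x xab|a' [b' [l0 [r0 [ab' sub H]]]]] := squeeze_of Ck ab dl dt dr.
  by have [] := Rf x xab.
exists a', b', l0, r0; split=> //.
  by have [x /H [_ h h' _]] := box_mid ab'; apply: lt_trans h h'.
move=> x xab; have [_ _ Qx] := Rf x (sub x xab).
have [h1 h2 h3 h4] := H x xab.
by apply: mQ Qx; [exact: ltW|exact: lt_trans h3|exact: ltW].
Qed.

(** In each vertical line, [P] or its complement contains an interval. One of the
    two cases holds over a whole box of the base, and the interval can be taken
    constant over a smaller box. *)
Lemma sub_dichotomyS k :
  sub_dichotomy k -> generic_continuity k -> sub_dichotomy k.+1.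
Proof.
move=> Fk Ck a b P /nbox_cons [ab0 ab] dP.
set a0 := a ord0 ord0 in ab0 *; set b0 := b ord0 ord0 in ab0 *.
have main (Q : 'rV[M]_k.+1 -> Prop) a' b' : dfp Q -> nbox a' b' ->
    box a' b' `<=` box (tailV a) (tailV b) ->
    (forall x, box a' b' x -> exists l r, [/\ a0 <= l, l < r, r <= b0 &
      forall t, l < t < r -> Q (consV t x)]) ->
    exists a'' b'', [/\ nbox a'' b'', box a'' b'' `<=` box a b &
      forall x, box a'' b'' x -> Q x].
  move=> dQ ab' sub HQ.
  pose R x l r := [/\ a0 <= l, r <= b0 & forall t, l < t < r -> Q (consV t x)].
  have dR : dfp (fun y => R y.1.1 y.1.2 y.2) by rewrite /R; dfn.
  have [||a1 [b1 [l [r [ab1 sub1 lr HR]]]]] := fiber_itv_of Ck ab' dR.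
  - move=> x l r l' r' ll lr rr [al rb H]; split=> [||t].
    + exact: le_trans ll.
    + exact: le_trans rr rb.
    + by move=> /(sub_itv ll rr); apply: H.
  - by move=> x /HQ [l [r [? ? ? ?]]]; exists l, r; split.
  exists (consV l a1), (consV r b1); split; first exact/nbox_consV.
    move=> x; rewrite -(consV_tail x) => /box_consV [h /[dup] xb /sub1 /sub xab].
    apply/box_cons; rewrite consV0 consVK; split=> //.
    by have [al rb _] := HR _ xb; apply: sub_itv al rb h.
  move=> x; rewrite -(consV_tail x) => /box_consV [h xb].
  by have [_ _ H] := HR _ xb; apply: H.
pose A x := exists l r, [/\ a0 <= l, l < r, r <= b0 &
  forall t, l < t < r -> P (consV t x)].
have dA : dfp A by rewrite /A; dfn.
have [a' [b' [ab' sub [HA|HA]]]] := Fk _ _ _ ab dA.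
  have [a1 [b1 [? ? ?]]] := main P a' b' dP ab' sub HA.
  by exists a1, b1; split=> //; left.
have dnP : dfp (fun x => ~ P x) by dfn.
have [x xab|a1 [b1 [? ? ?]]] := main _ a' b' dnP ab' sub; last first.
  by exists a1, b1; split=> //; right.
have dPx : dfp (fun t => P (consV t x)) by dfn.
have [l [r [al lr rb [H|H]]]] := om_itv hS ab0 dPx; last by exists l, r.
by case: (HA x xab); exists l, r.
Qed.

Definition wmono u (l r : M) (f : M -> M) : Prop :=
  forall t1 t2, l < t1 < r -> l < t2 < r -> t1 < t2 -> ~ lts u (f t2) (f t1).

(** On a smaller box [f] is monotone and continuous in the first variable, always
    in the same direction, and also continuous in the other variables taken
    together. This implies continuity: the values at [(s, w)], for [s] between
    [t1] and [t2], lie between those at [(t1, w)] and at [(t2, w)], which are near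
    the values at [(t1, x)] and [(t2, x)] by continuity in [w]. *)
Lemma generic_continuityS k :
  sub_dichotomy k -> generic_continuity k -> generic_continuity k.+1.
Proof.
move=> Fk Ck a b f /nbox_cons [ab0 ab] df.
set a0 := a ord0 ord0 in ab0 *; set b0 := b ord0 ord0 in ab0 *.
pose Q u x l r := [/\ a0 <= l, r <= b0, wmono u l r (fun t => f (consV t x)) &
  forall t, l < t < r -> contM (fun t => f (consV t x)) t].
have dQ u : dfp (fun y => Q u y.1.1 y.1.2 y.2).
  by rewrite /Q /wmono /contM; dfn.
have mQ u x l r l' r' : l <= l' -> l' < r' -> r' <= r -> Q u x l r -> Q u x l' r'.
  move=> ll lr rr [al rb H H']; split.
  - exact: le_trans ll.
  - exact: le_trans rr rb.
  - by move=> t1 t2 /(sub_itv ll rr) h /(sub_itv ll rr) h'; apply: H.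
  - by move=> t /(sub_itv ll rr); apply: H'.
have exQ x : exists u l r, l < r /\ Q u x l r.
  have dfx : dmap (fun t => f (consV t x)) by dfn.
  have [l [r [al lr rb [H|[u H H']]]]] := monotonicity hS dfx ab0.
    exists true, l, r; split=> //; split=> //.
      by move=> t1 t2 h h' _; rewrite (H _ _ h h') lts_irr.
    by move=> t h; apply: const_cont h H.
  exists u, l, r; split=> //; split=> //.
    by move=> t1 t2 h h' /(H _ _ h h') h1 /(lts_asym h1).
  by move=> t h; apply: (smono_cont hS h H H').
have [u [a1 [b1 [ab1 sub1 exu]]]] : exists u a1 b1, [/\ nbox a1 b1,
    box a1 b1 `<=` box (tailV a) (tailV b) &
    forall x, box a1 b1 x -> exists l r, l < r /\ Q u x l r].
  pose A x := exists l r, l < r /\ Q true x l r.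
  have dA : dfp A by have dQ' := dQ true; rewrite /A; dfn.
  have [a1 [b1 [ab1 sub1 [HA|HA]]]] := Fk _ _ _ ab dA.
    by exists true, a1, b1.
  exists false, a1, b1; split=> // x /HA nA.
  by have [[] [l [r H]]] := exQ x; [case: nA|]; exists l, r.
have [//|a2 [b2 [l [r [ab2 sub2 lr HQ]]]]] := fiber_itv_of Ck ab1 (dQ u) (mQ u).
pose P (y : 'rV[M]_k.+1) := contV (fun x => f (consV (y ord0 ord0) x)) (tailV y).
have dP : dfp P.
  rewrite /P /contV.
  by rewrite /nearV; dfn.
have ab2' : nbox (consV l a2) (consV r b2) by apply/nbox_consV.
have [a3 [b3 [/nbox_cons [ab30 ab3] sub3 H3]]] :=
  sub_dichotomyS Fk Ck ab2' dP.
have {}H3 : forall y, box a3 b3 y -> P y.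
  case: H3 => // H3; have [t at' tb] := dense ab30.
  have dft : dmap (fun x => f (consV t x)) by dfn.
  have [a4 [b4 [ab4 sub4 H4]]] := Ck _ _ _ ab3 dft.
  have [x xab] := box_mid ab4.
  case: (H3 (consV t x)); last by rewrite /P consV0 consVK; apply: H4.
  by apply/box_cons; rewrite consV0 consVK at' tb; split=> //; apply: sub4.
exists a3, b3; split; first exact/nbox_cons.
  move=> y /sub3; rewrite -(consV_tail y) => /box_consV [h xb].
  have [al rb _ _] := HQ _ xb.
  apply/box_cons; rewrite consV0 consVK; split; last by apply/sub1/sub2.
  exact: sub_itv al rb h.
move=> y yab c e; rewrite -{1 2}(consV_tail y).
set t := y ord0 ord0; set x := tailV y => cf fe.
have /box_consV [tlr xab2] : box (consV l a2) (consV r b2) (consV t x).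
  by rewrite consV_tail; apply: sub3.
have /box_cons [tab3 xab3] := yab.
have [_ _ _ cQ] := HQ _ xab2.
have [p [q [pt tq Hpq]]] := cQ t tlr c e cf fe.
have [t1 [pt1 at1 t1t]] : exists t1, [/\ p < t1, a3 ord0 ord0 < t1 & t1 < t].
  have /dense [t1] : Order.max p (a3 ord0 ord0) < t.
    by rewrite gt_max pt; case/andP: tab3.
  by rewrite gt_max => /andP [? ?] ?; exists t1.
have [t2 [t2q t2b tt2]] : exists t2, [/\ t2 < q, t2 < b3 ord0 ord0 & t < t2].
  have /dense [t2] : t < Order.min q (b3 ord0 ord0).
    by rewrite lt_min tq; case/andP: tab3.
  by move=> ?; rewrite lt_min => /andP [? ?]; exists t2.
have near s : p < s < q -> a3 ord0 ord0 < s < b3 ord0 ord0 ->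
    nearV x (fun x' => c < f (consV s x') < e).
  move=> spq sab; have Ps : P (consV s x).
    by apply: H3; apply/box_cons; rewrite consV0 consVK.
  by move: Ps; rewrite /P consV0 consVK; apply; case/andP: (Hpq s spq).
have H1 : nearV x (fun x' => c < f (consV t1 x') < e).
  apply: near; first by rewrite pt1 (lt_trans t1t).
  by rewrite at1 (lt_trans t1t) // (lt_trans tt2).
have H2 : nearV x (fun x' => c < f (consV t2 x') < e).
  apply: near; first by rewrite t2q (lt_trans pt) // (lt_trans tt2).
  by rewrite t2b andbT (lt_trans at1) // (lt_trans t1t).
have [a4 [b4 [xab4 H4]]] := nearV_and (nearV_and H1 H2) (nearV_box xab3).
exists (consV t1 a4), (consV t2 b4); split.
  by rewrite -(consV_tail y); apply/box_consV; rewrite t1t tt2.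
move=> z; rewrite -(consV_tail z) => /box_consV [/andP [t1s st2] /H4].
move: (z ord0 ord0) (tailV z) t1s st2 => s w t1s st2 [[h1 h2] wab].
have in3 s' : t1 <= s' -> s' <= t2 -> box a3 b3 (consV s' w).
  move=> le1 le2; apply/box_cons; rewrite consV0 consVK; split=> //.
  by rewrite (lt_le_trans at1 le1) (le_lt_trans le2).
have t1t2 : t1 < t2 by apply: lt_trans t1s st2.
have /sub3/box_consV [t1lr wab2] := in3 t1 (lexx _) (ltW t1t2).
have /sub3/box_consV [slr _] := in3 s (ltW t1s) (ltW st2).
have /sub3/box_consV [t2lr _] := in3 t2 (ltW t1t2) (lexx _).
have [_ _ m _] := HQ _ wab2.
have := m _ _ slr t2lr st2; have := m _ _ t1lr slr t1s.
case/andP: h1 => c1 e1; case/andP: h2 => c2 e2.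
case: (u) => /= /negP; rewrite -leNgt => m1 /negP; rewrite -leNgt => m2.
  by rewrite (lt_le_trans c1 m1) (le_lt_trans m2 e2).
by rewrite (lt_le_trans c2 m2) (le_lt_trans m1 e1).
Qed.

Lemma generic k : sub_dichotomy k /\ generic_continuity k.
Proof.
elim: k => [|k [Fk Ck]]; last first.
  by split; [apply: sub_dichotomyS|apply: generic_continuityS].
have all0 (x y : 'rV[M]_0) : x = y by apply/rowP => -[].
split=> [a b P ab _|a b f ab _]; exists a, b; split=> //.
  case: (pselect (P a)) => Pa; [left|right] => x _; by rewrite (all0 x a).
by move=> x _ c e cx xe; exists a, b; split=> [[]//|y _]; rewrite (all0 y x) cx.
Qed.

Lemma generic_dichotomy k : sub_dichotomy k. Proof. by case: (generic k). Qed.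
Lemma generic_cont k : generic_continuity k. Proof. by case: (generic k). Qed.
Definition squeeze k := squeeze_of (@generic_cont k).
Definition fiber_itv k := fiber_itv_of (@generic_cont k).

Lemma generic_cover k (a b : 'rV[M]_k) (I : finType) (A : I -> 'rV[M]_k -> Prop) :
  nbox a b -> (forall i, dfp (A i)) -> (forall x, box a b x -> exists i, A i x) ->
  exists i a' b', [/\ nbox a' b', box a' b' `<=` box a b &
    forall x, box a' b' x -> A i x].
Proof.
move=> ab dA cov; apply: contrapT => no.
suff [a' [b' [ab' sub H]]] : exists a' b', [/\ nbox a' b',
    box a' b' `<=` box a b & forall i, i \in enum I -> forall x, box a' b' x -> ~ A i x].
  have [x xab] := box_mid ab'; have [i Ai] := cov x (sub x xab).
  by apply: (H i _ x xab Ai); rewrite mem_enum.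
elim: (enum I) => [|i l [a1 [b1 [ab1 sub1 H1]]]].
  by exists a, b; split=> // i; rewrite in_nil.
have [a2 [b2 [ab2 sub2 [H2|H2]]]] := generic_dichotomy ab1 (dA i).
  by case: no; exists i, a2, b2; split=> // x /sub2 /sub1.
exists a2, b2; split=> // [x /sub2 /sub1 //|j].
by rewrite inE => /predU1P [->//|jl] x /sub2; apply: H1.
Qed.

(** One coordinate of the target after the other, on smaller and smaller boxes. *)
Lemma squeezeV k n (a b : 'rV[M]_k) (l t r : 'rV[M]_k -> 'rV[M]_n) : nbox a b ->
  dmap l -> dmap t -> dmap r -> (forall x, box a b x -> box (l x) (r x) (t x)) ->
  exists a' b' (l0 r0 : 'rV[M]_n), [/\ nbox a' b', box a' b' `<=` box a b &
    forall x : 'rV[M]_k, box a' b' x -> forall i, [/\ l x ord0 i < l0 ord0 i,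
      l0 ord0 i < t x ord0 i, t x ord0 i < r0 ord0 i & r0 ord0 i < r x ord0 i]].
Proof.
move=> ab dl dt dr ltr.
suff [a' [b' [l0 [r0 [ab' sub H]]]]] : exists a' b' (l0 r0 : 'I_n -> M),
    [/\ nbox a' b', box a' b' `<=` box a b &
    forall x, box a' b' x -> forall i : 'I_n, i \in enum 'I_n -> [/\ l x ord0 i < l0 i,
      l0 i < t x ord0 i, t x ord0 i < r0 i & r0 i < r x ord0 i]].
  exists a', b', (\row_i l0 i)%R, (\row_i r0 i)%R; split=> // x xab i.
  by rewrite !mxE; apply: H; rewrite ?mem_enum.
elim: (enum 'I_n) => [|j s [a1 [b1 [l0 [r0 [ab1 sub1 H1]]]]]].
  by exists a, b, (fun=> m0), (fun=> m0); split=> // x _ i; rewrite in_nil.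
have dlj : dmap (fun x => l x ord0 j) by dfn.
have dtj : dmap (fun x => t x ord0 j) by dfn.
have drj : dmap (fun x => r x ord0 j) by dfn.
have [x /sub1 /ltr /(_ j) /andP //|a2 [b2 [p [q [ab2 sub2 H2]]]]] :=
  squeeze ab1 dlj dtj drj.
exists a2, b2, (fun i => if i == j then p else l0 i),
  (fun i => if i == j then q else r0 i); split=> // [x /sub2 /sub1 //|x xab i].
rewrite inE; case: (eqVneq i j) => [-> _|_ /= is_]; first exact: H2.
exact: H1 (sub2 _ xab) _ is_.
Qed.

(** By induction on [k], looking first at the dependence on the first variable.
    Where [t] is strictly monotone in it, the intermediate value property solves
    [t = c] for the first variable over a box of the others; where [t] does not
    depend on it, the induction hypothesis applies to the other variables. *)
Lemma const_or_slice k (t : 'rV[M]_k -> M) (a b : 'rV[M]_k) :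
  dmap t -> nbox a b ->
  (exists a' b' c, [/\ nbox a' b', box a' b' `<=` box a b &
     forall x, box a' b' x -> t x = c]) \/
  (exists k' (J : 'I_k' -> 'I_k) c a1 b1, [/\ k = k'.+1, nbox a1 b1 &
     forall x', box a1 b1 x' -> exists x, [/\ box a b x, sel J x = x' & t x = c]]).
Proof.
elim: k t a b => [|k IH] t a b dt.
  have all0 (x y : 'rV[M]_0) : x = y by apply/rowP => -[].
  by move=> ab; left; exists a, b, (t a); split=> // x _; rewrite (all0 x a).
move=> /nbox_cons [ab0 ab].
set a0 := a ord0 ord0 in ab0 *; set b0 := b ord0 ord0 in ab0 *.
pose Q (i : option bool) x l r := [/\ a0 <= l, r <= b0 &
  if i is Some u then smono u l r (fun t' => t (consV t' x)) /\
    ivp l r (fun t' => t (consV t' x)) else const_on l r (fun t' => t (consV t' x))].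
have dQ i : dfp (fun y => Q i y.1.1 y.1.2 y.2).
  rewrite /Q; case: i => [u|]; rewrite /smono /ivp /const_on; last by dfn.
  apply: dfp_and3; [by dfn|by dfn|]; apply: dfp_and; first by dfn.
  (* The side in [ivp] ranges over the booleans, here replaced by ['I_2]. *)
  apply: (dfp_ext (P := fun y => forall (w : 'I_2) x y' v, y.1.2 < x < y.2 ->
    y.1.2 < y' < y.2 -> x < y' -> lts (w == ord0) (t (consV x y.1.1)) v ->
    lts (w == ord0) v (t (consV y' y.1.1)) ->
    exists2 z, x < z < y' & t (consV z y.1.1) = v)); last by dfn.
  move=> y; split=> H w; last exact: H.
  by case: w; [apply: (H ord0)|apply: (H ord_max)].
have mQ i x l r l' r' : l <= l' -> l' < r' -> r' <= r -> Q i x l r -> Q i x l' r'.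
  move=> ll lr rr [al rb H]; split; [exact: le_trans ll|exact: le_trans rr rb|].
  case: i H => [u [H H']|H]; [split|].
  - by move=> t1 t2 /(sub_itv ll rr) h /(sub_itv ll rr) h'; apply: H.
  - by move=> w t1 t2 v /(sub_itv ll rr) h /(sub_itv ll rr) h'; apply: H'.
  - by move=> t1 t2 /(sub_itv ll rr) h /(sub_itv ll rr) h'; apply: H.
have [||i [a1 [b1 [ab1 sub1 H1]]]] :=
    @generic_cover k _ _ _ (fun i x => exists l r, l < r /\ Q i x l r) ab.
- by move=> i; have := dQ i; move: (Q i) => R dR; dfn.
- move=> x xab; have dtx : dmap (fun s => t (consV s x)) by dfn.
  have [l [r [al lr rb [H|[u H H']]]]] := monotonicity hS dtx ab0.
    by exists None, l, r; split.
  by exists (Some u), l, r; split.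
have [//|a2 [b2 [l [r [ab2 sub2 lr HQ]]]]] := fiber_itv ab1 (dQ i) (mQ i).
have inab s x : l < s < r -> box a2 b2 x -> box a b (consV s x).
  move=> slr xab; apply/box_cons; rewrite consV0 consVK.
  have [al rb _] := HQ x xab; split; last by apply/sub1/sub2.
  exact: sub_itv al rb slr.
case: i {H1 mQ dQ} HQ => [u|] HQ.
  right; have [s1 ls1 s1r] := dense lr; have [s2 s12 s2r] := dense s1r.
  have s1lr : l < s1 < r by rewrite ls1.
  have s2lr : l < s2 < r by rewrite s2r (lt_trans ls1).
  pose R x p q := forall v, p < v < q ->
    lts u (t (consV s1 x)) v /\ lts u v (t (consV s2 x)).
  have dR : dfp (fun y => R y.1.1 y.1.2 y.2) by rewrite /R; dfn.
  have [||a3 [b3 [p [q [ab3 sub3 pq HR]]]]] := fiber_itv ab2 dR.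
  - by move=> x p q p' q' pp pq qq H v /(sub_itv pp qq); apply: H.
  - move=> x /HQ [_ _ [m _]]; have := m _ _ s1lr s2lr s12; rewrite /R.
    case: (u) => /= h.
      by exists (t (consV s1 x)), (t (consV s2 x)); split=> // v /andP [].
    by exists (t (consV s2 x)), (t (consV s1 x)); split=> // v /andP [].
  have [c pc cq] := dense pq.
  exists k, (lift ord0), c, a3, b3; split=> // x xab.
  have xab2 := sub3 _ xab.
  have [_ _ [_ v]] := HQ x xab2.
  have [h1 h2] : lts u (t (consV s1 x)) c /\ lts u c (t (consV s2 x)).
    by apply: HR => //; rewrite pc.
  have [s /andP [s1s ss2] ts] := v u _ _ c s1lr s2lr s12 h1 h2.
  exists (consV s x); split=> //; last first.
    by apply/rowP => j; rewrite mxE consVS.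
  by apply: inab => //; rewrite (lt_trans ls1) // (lt_trans ss2).
have [s ls sr] := dense lr.
have slr : l < s < r by rewrite ls.
have dts : dmap (fun x => t (consV s x)) by dfn.
have tE w x : l < w < r -> box a2 b2 x -> t (consV w x) = t (consV s x).
  by move=> wlr xab; have [_ _ H] := HQ x xab; apply: H.
have [[a3 [b3 [c [ab3 sub3 H3]]]]|] := IH _ _ _ dts ab2.
  left; exists (consV l a3), (consV r b3), c; split; first exact/nbox_consV.
    move=> y; rewrite -(consV_tail y) => /box_consV [h /sub3 h'].
    exact: inab.
  move=> y; rewrite -(consV_tail y) => /box_consV [h h'].
  by rewrite tE //; [apply: H3|apply: sub3].
move=> [k' [J [c [a3 [b3 [Ek ab3 H3]]]]]]; right.
exists k'.+1, (fun i => if unlift ord0 i is Some j then lift ord0 (J j) else ord0).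
exists c, (consV l a3), (consV r b3); split; [by rewrite Ek|exact/nbox_consV|].
move=> y; rewrite -(consV_tail y) => /box_consV [h /H3 [x [xab xJ tx]]].
exists (consV (y ord0 ord0) x); split; [exact: inab| |by rewrite tE].
apply/rowP => i; rewrite mxE [RHS]mxE; case: unliftP => [j|] _.
  by rewrite consVS -xJ mxE.
by rewrite consV0.
Qed.

End Boxes.

(** * Cells and the dimension of frontiers *)

Section Topology.
Context {d : Order.disp_t} {M : orderTopologicalType d} {L : language}.
Context {S : structure L M} {m0 : has_point M}.
Hypothesis hS : o_minimal S.

Lemma nbhsM (x : M) (U : set M) : nbhs x U <->
  exists p q, [/\ p < x, x < q & forall y, p < y < q -> U y].
Proof.
have [p0 p0x] := lt_ex hS x; have [q0 xq0] := gt_ex hS x.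
split=> [|[p [q [px xq H]]]]; last first.
  have : nbhs x `]p, q[%classic.
    apply: open_nbhs_nbhs; split; first exact: itv_open.
    by rewrite /= in_itv /= px.
  by apply: filterS => y /=; rewrite in_itv /=; apply: H.
rewrite itv_nbhsE => -[[i j] [+ +] H].
have {}H y : y \in Interval i j -> U y by move=> yij; apply: (H y).
case: i H => [[] l|[]]; case: j => [[] r|[]] //= H _.
- by rewrite in_itv /= => /andP [lx xr]; exists l, r.
- rewrite in_itv /= andbT => lx; exists l, q0; split=> // y /andP [ly _].
  by apply: H; rewrite in_itv /= ly.
- rewrite in_itv /= => xr; exists p0, r; split=> // y /andP [_ yr].
  by apply: H; rewrite in_itv.
- by move=> _; exists p0, q0; split=> // y _; apply: H; rewrite in_itv.
Qed.

Lemma nearV_all k n (x : 'rV[M]_k) (P : 'I_n -> 'rV[M]_k -> Prop) :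
  (forall i, nearV x (P i)) -> nearV x (fun y => forall i, P i y).
Proof.
move=> H; suff H' : nearV x (fun y => forall i, i \in enum 'I_n -> P i y).
  by apply: nearV_mono H' => y Hy i; apply: Hy; rewrite mem_enum.
elim: (enum 'I_n) => [|i s IH].
  have H1 j : exists p, p < x ord0 j by apply: (lt_ex hS).
  have H2 j : exists p, x ord0 j < p by apply: (gt_ex hS).
  have [p Hp] := choice H1; have [q Hq] := choice H2.
  exists (\row_i p i)%R, (\row_i q i)%R; split=> // j.
  by rewrite !mxE Hp Hq.
apply: nearV_mono (nearV_and (H i) IH) => y [Hi Hs] j.
by rewrite inE => /predU1P [->|/Hs].
Qed.

Lemma nearV_coord k (x : 'rV[M]_k) j p q : p < x ord0 j < q ->
  nearV x (fun y => p < y ord0 j < q).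
Proof.
move=> xj; have H1 i : exists p, p < x ord0 i by apply: (lt_ex hS).
have H2 i : exists p, x ord0 i < p by apply: (gt_ex hS).
have [u Hu] := choice H1; have [v Hv] := choice H2.
exists (\row_i if i == j then p else u i)%R.
exists (\row_i if i == j then q else v i)%R; split=> [i|y /(_ j)].
  by rewrite !mxE; case: eqVneq => [->|_] //; rewrite Hu Hv.
by rewrite !mxE eqxx.
Qed.

Lemma nearV_sel k k' (J : 'I_k' -> 'I_k) (x : 'rV[M]_k) a b :
  box a b (sel J x) -> nearV x (fun y => box a b (sel J y)).
Proof.
move=> H; apply: nearV_all => i.
have /nearV_coord : a ord0 i < x ord0 (J i) < b ord0 i.
  by have := H i; rewrite mxE.
by apply: nearV_mono => y; rewrite mxE.
Qed.

Lemma nbhsV k (x : 'rV[M]_k) (U : set 'rV[M]_k) : nbhs x U <-> nearV x U.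
Proof.
split=> [[P HP sub]|[a [b [xab H]]]].
  have : nearV x (fun y => forall j, P ord0 j (y ord0 j)).
    apply: nearV_all => j; have /nbhsM [p [q [px xq H]]] := HP ord0 j.
    have : p < x ord0 j < q by rewrite px.
    by move=> /nearV_coord; apply: nearV_mono => y; apply: H.
  by apply: nearV_mono => y Hy; apply: sub => i j; rewrite (ord1 i).
exists (fun _ j => [set t | a ord0 j < t < b ord0 j]) => [i j|y Hy].
  rewrite (ord1 i); apply/nbhsM; exists (a ord0 j), (b ord0 j).
  by have /andP [] := xab j.
by apply: H => i; apply: Hy.
Qed.

Lemma continuous_within_contV k (D : set 'rV[M]_k) (f : 'rV[M]_k -> M) :
  (forall x c e, D x -> c < f x -> f x < e ->
     nearV x (fun y => D y -> c < f y < e)) -> {within D, continuous f}.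
Proof.
move=> H; apply/subspace_continuousP => x Dx U /nbhsM [c [e [cx xe Hce]]].
apply/nbhsV; apply: nearV_mono (H x c e Dx cx xe) => y Hy Dy.
by apply: Hce; apply: Hy.
Qed.

End Topology.

Section Cells.
Context {d : Order.disp_t} {M : orderTopologicalType d} {L : language}.
Context {S : structure L M} {m0 : has_point M}.
Hypothesis hS : o_minimal S.
Hypothesis hSk : definable_skolem_functions S.
Local Notation dfp := (defpred (S := S)).
Local Notation dmap := (defmap (S := S)).
Local Notation dense := (dense hS).

Definition snocV n (y : 'rV[M]_n) (t : M) : 'rV[M]_(n + 1) :=
  row_mx y (const_mx t).

Lemma lsub_snocV n (y : 'rV[M]_n) t : lsubmx (snocV y t) = y.
Proof. exact: row_mxKl. Qed.

Lemma rsub_snocV n (y : 'rV[M]_n) t : rsubmx (snocV y t) ord0 ord0 = t.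
Proof. by rewrite row_mxKr mxE. Qed.

Lemma snocVK n (x : 'rV[M]_(n + 1)) :
  snocV (lsubmx x) (rsubmx x ord0 ord0) = x.
Proof.
rewrite /snocV -[RHS]hsubmxK; congr row_mx.
by apply/matrixP => i j; rewrite !ord1 mxE.
Qed.

(** The extension by a constant turns the partial functions that bound cells
    into total ones. *)
Lemma dmap_extend n (C : set 'rV[M]_n) (f : 'rV[M]_n -> M) : dfp C ->
  definable_map S C (fun x => const_mx (f x) : 'rV[M]_1) ->
  dmap (fun y => ifp (C y) (f y) m0).
Proof.
move=> dC /definable_dfp dG.
have dG' : dfp (fun z : 'rV[M]_n * M =>
    [set row_mx x (const_mx (f x) : 'rV[M]_1) | x in C] (row_mx z.1 (const_mx z.2))).
  by apply: (dfp_comp dG); dfn.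
apply: (dfp_ext (P := fun z : 'rV[M]_n * M =>
  (C z.1 -> [set row_mx x (const_mx (f x) : 'rV[M]_1) | x in C]
      (row_mx z.1 (const_mx z.2))) /\ (~ C z.1 -> z.2 = m0))); last first.
  by apply: dfp_and; [apply: dfp_imp => //; dfn|dfn].
move=> [y t] /=; case: (pselect (C y)) => Cy; [rewrite ifpT|rewrite ifpF] => //.
  split=> [[/(_ Cy) [x _ /eq_row_mx [<- /matrixP E]] _]|<-].
    by have := E ord0 ord0; rewrite !mxE.
  by split=> // _; exists y.
by split=> [[_ ->]|<-].
Qed.

Lemma definable_cont_dmap n (C : set 'rV[M]_n) (f g : 'rV[M]_n -> M) :
  dfp C -> dmap g -> (forall x, C x -> f x = g x) ->
  definable_map S C (fun x => const_mx (f x) : 'rV[M]_1).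
Proof.
move=> dC dg E; have dg' : dmap (fun x => const_mx (g x) : 'rV[M]_1) by dfn.
have := definable_map_dmap dC dg'; rewrite /definable_map.
suff -> : [set row_mx x (const_mx (f x) : 'rV[M]_1) | x in C] =
  [set row_mx x (const_mx (g x)) | x in C] by [].
by apply/eq_imagel => x Cx; rewrite E.
Qed.

Lemma definable_cont_sub n (C C' : set 'rV[M]_n) (f : 'rV[M]_n -> M) :
  dfp C -> dfp C' -> C' `<=` C -> definable_cont S C f -> definable_cont S C' f.
Proof.
move=> dC dC' sub [df cf]; split; last exact: continuous_subspaceW cf.
apply: (definable_cont_dmap dC' (dmap_extend dC df)) => x Cx.
by rewrite ifpT //; apply: sub.
Qed.

Lemma definable_cont_const n (C : set 'rV[M]_n) (t : M) :
  dfp C -> definable_cont S C (fun=> t).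
Proof.
move=> dC; split; first by apply: (definable_cont_dmap dC (dmap_const t)).
by apply: continuous_subspaceT => x; apply: cst_continuous.
Qed.

Definition bnd n (f : option ('rV[M]_n -> M)) (x : 'rV[M]_n) : option M :=
  omap (fun h => h x) f.

Lemma dfp_oo_itv G (c : ctx S G) n (f g : option ('rV[M]_n -> M)) (y : G -> 'rV[M]_n)
    (t : G -> M) :
  (if f is Some f' then dmap f' else True) ->
  (if g is Some g' then dmap g' else True) -> dmap y -> dmap t ->
  dfp (fun x => oo_itv (bnd f (y x)) (bnd g (y x)) (t x)).
Proof.
move=> df dg dy dt; rewrite /oo_itv /bnd.
by case: f df => [f|] df; case: g dg => [g|] dg /=; dfn.
Qed.

Lemma cell_dfp n r (D : set 'rV[M]_n) : cell S r D -> dfp D.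
Proof.
move=> cD; elim: n r D / cD => [|n r C f _ dC [df _]|n r C f g _ dC df dg _].
- exact: dfp_True.
- have dF := dmap_extend dC df.
  apply: (dfp_ext (P := fun x : 'rV[M]_(n + 1) => C (lsubmx x) /\
    rsubmx x ord0 ord0 = ifp (C (lsubmx x)) (f (lsubmx x)) m0)).
    by move=> x /=; split=> -[Cx E]; split=> //; move: E; rewrite ifpT.
  apply: dfp_and; first by dfn.
  apply: dfp_eq; first by dfn.
  by apply: (dmap_comp dF); dfn.
pose ext (h : option ('rV[M]_n -> M)) : option ('rV[M]_n -> M) :=
  omap (fun h y => ifp (C y) (h y) m0) h.
have dext h : (if h is Some h' then definable_cont S C h' else True) ->
    if ext h is Some h' then dmap h' else True.
  by case: h => // h' [dh _]; apply: dmap_extend.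
apply: (dfp_ext (P := fun x : 'rV[M]_(n + 1) => C (lsubmx x) /\
  oo_itv (bnd (ext f) (lsubmx x)) (bnd (ext g) (lsubmx x)) (rsubmx x ord0 ord0))).
  move=> x /=.
  have E h : C (lsubmx x) -> bnd (ext h) (lsubmx x) = omap (fun h => h (lsubmx x)) h.
    by case: h => //= h Cx; rewrite ifpT.
  by split=> -[Cx H]; split=> //; move: H; rewrite !E.
apply: dfp_and; first by dfn.
by apply: dfp_oo_itv; [exact: dext|exact: dext|dfn|dfn].
Qed.

Lemma cell_le n r (D : set 'rV[M]_n) : cell S r D -> (r <= n)%N.
Proof.
move=> cD; elim: n r D / cD => [//|n r C f _ rn _|n r C f g _ rn _ _ _].
  by rewrite (leq_trans rn) // leq_addr.
by rewrite addn1 ltnS.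
Qed.

Definition projects n r (J : 'I_r -> 'I_n) (D : set 'rV[M]_n) (a b : 'rV[M]_r) :=
  forall u, box a b u -> exists2 x, D x & sel J x = u.

Lemma oo_lt_itv (a b : option M) : oo_lt a b ->
  exists l r, l < r /\ forall t, l < t < r -> oo_itv a b t.
Proof.
case: a b => [a|] [b|] /= ab.
- by exists a, b; split=> // t /andP [].
- by have [c ac] := gt_ex hS a; exists a, c; split=> // t /andP [].
- by have [c ac] := lt_ex hS b; exists c, b; split=> // t /andP [].
- by have [c ac] := gt_ex hS m0; exists m0, c.
Qed.

(** The coordinates [J] are those in which the cell was built as a band. Over any
    box inside its projection the cell is again a cell, as the bands over such a
    box can be cut by constants. *)
Lemma cell_projection n r (D : set 'rV[M]_n) : cell S r D ->
  exists J : 'I_r -> 'I_n, [/\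
    forall x y, D x -> D y -> sel J x = sel J y -> x = y,
    exists a b, nbox a b /\ projects J D a b &
    forall a b, nbox a b -> projects J D a b ->
      cell S r (D `&` [set x | box a b (sel J x)])].
Proof.
move=> cD; elim: n r D / cD => [|n r C f cC [J [Ji [a [b [ab Jab]]] Jc]] cf|
    n r C f g cC [J [Ji [a [b [ab Jab]]] Jc]] cf cg fg].
- have all0 (x y : 'rV[M]_0) : x = y by apply/rowP => -[].
  exists id; split=> [x y _ _ _|| a b _ _]; first exact: all0.
    pose z : 'rV[M]_0 := const_mx m0.
    by exists z, z; split=> [[]|u _] //; exists z.
  set B := _ `&` _; suff -> : B = setT by exact: cell_point.
  by apply/seteqP; split=> // x _; split=> // -[].
- have dC := cell_dfp cC.
  have E x : sel (fun i => lshift 1 (J i)) x = sel J (lsubmx x).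
    by apply/rowP => i; rewrite !mxE.
  exists (fun i => lshift 1 (J i)); split=> [x y [Cx fx] [Cy fy]||a' b' ab' Jab'].
  + rewrite !E => /(Ji _ _ Cx Cy) xy.
    by rewrite -(snocVK x) -(snocVK y) fx fy xy.
  + exists a, b; split=> // u /Jab [y Cy <-]; exists (snocV y (f y)).
      by split; rewrite /= ?lsub_snocV ?rsub_snocV.
    by rewrite E lsub_snocV.
  have Jab2 : projects J C a' b'.
    by move=> u /Jab' [x [Cx _] <-]; exists (lsubmx x); rewrite ?E.
  have cC' := Jc _ _ ab' Jab2.
  have cf' : definable_cont S (C `&` [set x | box a' b' (sel J x)]) f.
    by apply: definable_cont_sub cf => //; apply: cell_dfp cC'.
  have := cell_graph cC' cf'; set A := [set x | _]; set B := _ `&` _.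
  suff -> : A = B by [].
  by apply/seteqP; split=> x; rewrite /A /B /= E; move=> [[? ?] ?].
have dC := cell_dfp cC.
pose J' (i : 'I_r.+1) := if unlift ord0 i is Some j then lshift 1 (J j) else rshift n ord0.
have E x : sel J' x = consV (rsubmx x ord0 ord0) (sel J (lsubmx x)).
  by apply/rowP => i; rewrite !mxE /J'; case: unliftP => [j|] _; rewrite ?mxE.
exists J'; split=> [x y [Cx fx] [Cy fy]||a' b' ab' Jab'].
- rewrite !E => xy; have /(Ji _ _ Cx Cy) E1 : sel J (lsubmx x) = sel J (lsubmx y).
    by rewrite -(consVK (rsubmx x ord0 ord0) (sel J _)) xy consVK.
  have E2 : rsubmx x ord0 ord0 = rsubmx y ord0 ord0.
    by rewrite -(consV0 (rsubmx x ord0 ord0) (sel J (lsubmx x))) xy consV0.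
  by rewrite -(snocVK x) -(snocVK y) E1 E2.
- pose ext (h : option ('rV[M]_n -> M)) : option ('rV[M]_n -> M) :=
    omap (fun h y => ifp (C y) (h y) m0) h.
  have dext h : (if h is Some h' then definable_cont S C h' else True) ->
      if ext h is Some h' then dmap h' else True.
    by case: h => // h' [dh _]; apply: dmap_extend.
  have extE h y : C y -> bnd (ext h) y = omap (fun h => h y) h.
    by case: h => //= h Cy; rewrite ifpT.
  have dR : dfp (fun z => box a b z.1 -> C z.2 /\ sel J z.2 = z.1) by dfn.
  have [u|s ds Hs] := @skolem _ _ _ S m0 hSk _ _ _ _
      (fun u y => box a b u -> C y /\ sel J y = u) dR.
    case: (pselect (box a b u)) => [/Jab [y Cy yu]|nu]; first by exists y.
    by exists (const_mx m0).
  pose Q u l r := forall t, l < t < r ->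
    oo_itv (bnd (ext f) (s u)) (bnd (ext g) (s u)) t.
  have dQ : dfp (fun y => Q y.1.1 y.1.2 y.2).
    rewrite /Q; apply: (@dfp_all _ _ _ _ _ _ _ _ _ (fun y t => y.1.2 < t < y.2 ->
      oo_itv (bnd (ext f) (s y.1.1)) (bnd (ext g) (s y.1.1)) t)).
    apply: dfp_imp; first by dfn.
    by apply: dfp_oo_itv; [exact: dext|exact: dext|dfn|dfn].
  have [||a1 [b1 [l [r' [ab1 sub1 lr HQ]]]]] := fiber_itv hS hSk ab dQ.
  + move=> u l r1 l' r' ll lr rr H t /(sub_itv ll rr); apply: H.
  + move=> u /Hs [Cs _]; rewrite /Q !extE //.
    exact/oo_lt_itv/fg.
  exists (consV l a1), (consV r' b1); split; first exact/nbox_consV.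
  move=> u; rewrite -(consV_tail u) => /box_consV [lt ut].
  have [Cs su] := Hs _ (sub1 _ ut).
  exists (snocV (s (tailV u)) (u ord0 ord0)); last first.
    by rewrite E lsub_snocV rsub_snocV su.
  split; rewrite /= ?lsub_snocV ?rsub_snocV //.
  by rewrite -!extE //; apply: HQ.
have /nbox_cons [ab0' abt] := ab'.
have Jab2 : projects J C (tailV a') (tailV b').
  move=> u uab; have [t at' tb] := dense ab0'.
  have [|x [Cx _]] := Jab' (consV t u).
    by apply/box_cons; rewrite consV0 consVK at' tb.
  by rewrite E => xu; exists (lsubmx x) => //; rewrite -(consVK t u) -xu consVK.
have cC' := Jc _ _ abt Jab2; have dC' := cell_dfp cC'.
have := @cell_band _ _ _ S n r _ (Some (fun=> a' ord0 ord0)) (Some (fun=> b' ord0 ord0))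
  cC' (definable_cont_const _ dC') (definable_cont_const _ dC') (fun _ _ => ab0').
set A := [set x | _]; set B := _ `&` _.
suff -> : A = B by [].
apply/seteqP; split=> x.
  move=> [/= [Cx xab] [h h']].
  have xab' : box a' b' (sel J' x).
    by apply/box_cons; rewrite E consV0 consVK h h'.
  have [y Dy yx] := Jab' _ xab'.
  suff <- : y = x by split=> //=; rewrite yx.
  have [Cy fy] := Dy; move: yx; rewrite !E => yx.
  have /(Ji _ _ Cy Cx) E1 : sel J (lsubmx y) = sel J (lsubmx x).
    by rewrite -(consVK (rsubmx y ord0 ord0) (sel J _)) yx consVK.
  have E2 : rsubmx y ord0 ord0 = rsubmx x ord0 ord0.
    by rewrite -(consV0 (rsubmx y ord0 ord0) (sel J (lsubmx y))) yx consV0.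
  by rewrite -(snocVK x) -(snocVK y) E1 E2.
move=> [[Cx fx]] /= /box_cons; rewrite E consV0 consVK => -[/andP [h h'] xab].
by split.
Qed.

(** A cell is a homeomorphic copy, under a coordinate projection, of a set that
    contains a box, so generic continuity passes to functions on cells. *)
Lemma cell_generic_cont n r (D : set 'rV[M]_n) (f : 'rV[M]_n -> M) :
  cell S r D -> dmap f ->
  exists D', [/\ cell S r D', D' `<=` D & definable_cont S D' f].
Proof.
move=> cD df; have dD := cell_dfp cD.
have [J [Ji [a [b [ab Jab]]] Jc]] := cell_projection cD.
have dR : dfp (fun z => box a b z.1 -> D z.2 /\ sel J z.2 = z.1) by dfn.
have [u|s ds Hs] := @skolem _ _ _ S m0 hSk _ _ _ _
    (fun u y => box a b u -> D y /\ sel J y = u) dR.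
  case: (pselect (box a b u)) => [/Jab [y Cy yu]|nu]; first by exists y.
  by exists (const_mx m0).
have dfs : dmap (fun u => f (s u)) by dfn.
have [a' [b' [ab' sub cont]]] := generic_cont hS hSk ab dfs.
have Jab' : projects J D a' b' by move=> u /sub /Jab.
have cD' := Jc a' b' ab' Jab'.
exists (D `&` [set x | box a' b' (sel J x)]); split=> //.
have sE x : D x -> box a' b' (sel J x) -> s (sel J x) = x.
  by move=> Dx /sub /Hs [Dy yx]; apply: Ji.
split; first by apply: (definable_cont_dmap (cell_dfp cD') df).
apply: (continuous_within_contV hS) => x c e [Dx xab] cx xe.
have := cont _ xab; rewrite /contV sE // => /(_ c e cx xe) [p [q [xpq H]]].
apply: nearV_mono (nearV_sel hS xpq) => y yab [Dy yab'].
by have := H _ yab; rewrite sE.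
Qed.

Lemma cell_const_graph n r (D : set 'rV[M]_n) (f : 'rV[M]_n -> M) (A : set 'rV[M]_(n + 1)) :
  cell S r D -> definable_cont S D f -> (forall y, D y -> A (snocV y (f y))) ->
  exists D', cell S r D' /\ D' `<=` A.
Proof.
move=> cD cf H; eexists; split; first exact: (cell_graph cD cf).
by move=> x [/= /H Dx E]; move: Dx; rewrite -E snocVK.
Qed.

(** By induction on the ambient dimension, using a definable section of [g] over
    the box. Either
    its last coordinate is isolated in its fibre, and on a smaller box the section
    lives on a graph over the remaining coordinates; or the fibre contains a
    fixed interval, and one loses at most one dimension in the base. *)
Lemma image_box_cell n k (A : 'rV[M]_n -> Prop) (g : 'rV[M]_n -> 'rV[M]_k)
    (a b : 'rV[M]_k) : dfp A -> dmap g -> nbox a b ->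
  (forall x, box a b x -> exists2 y, A y & g y = x) ->
  exists D, cell S k D /\ D `<=` A.
Proof.
elim: n k A g a b => [|n IH] k A g a b dA dg ab gA.
  have all0 (x y : 'rV[M]_0) : x = y by apply/rowP => -[].
  case: k g a b dg ab gA => [|k] g a b dg ab gA.
    exists setT; split; first exact: cell_point.
    have [x xab] := box_mid hS ab; have [y Ay _] := gA x xab.
    by move=> z _; rewrite (all0 z y).
  have [x xab] := box_mid hS ab; have [y _ yx] := gA x xab.
  have /box_cons [/andP [ax xb] xt] := xab.
  have [t at' tx] := dense ax.
  have [|y' _ y'x] := gA (consV t (tailV x)).
    by apply/box_cons; rewrite consV0 consVK at' (lt_trans tx).
  move: tx; rewrite -(consV0 t (tailV x)) -y'x (all0 y' y) yx.
  by rewrite ltxx.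
move: A g dA dg gA; rewrite -[n.+1]addn1 => A g dA dg gA.
have dR : dfp (fun z => box a b z.1 -> A z.2 /\ g z.2 = z.1) by dfn.
have [x|s ds Hs] := @skolem _ _ _ S m0 hSk _ _ _ _
    (fun x y => box a b x -> A y /\ g y = x) dR.
  case: (pselect (box a b x)) => [/gA [y Ay yx]|nx]; first by exists y.
  by exists (const_mx m0).
pose y x := lsubmx (s x); pose t x := rsubmx (s x) ord0 ord0.
have dy : dmap y by rewrite /y; dfn.
have dt : dmap t by rewrite /t; dfn.
have dsn G (c : ctx S G) (p : G -> 'rV[M]_n) (q : G -> M) : dmap p -> dmap q ->
    dmap (fun x => snocV (p x) (q x)) by move=> dp dq; rewrite /snocV; dfn.
have {}Hs x : box a b x -> A (snocV (y x) (t x)) /\ g (snocV (y x) (t x)) = x.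
  by rewrite snocVK; apply: Hs.
have dAs : dfp (fun z : 'rV[M]_n * M => A (snocV z.1 z.2)).
  by apply: (dfp_comp dA); apply: dsn; dfn.
have dgs t0 : dmap (fun z : 'rV[M]_n => g (snocV z t0)).
  by apply: (dmap_comp dg); apply: dsn; dfn.
pose As z w := A (snocV z w).
have dAs' : dfp (fun z => As z.1 z.2) by exact: dAs.
pose inner z v := exists l r, [/\ l < v, v < r & forall w, l < w < r -> As z w].
have dinner : dfp (fun z => inner z.1 z.2) by rewrite /inner; dfn.
have din : dfp (fun x => inner (y x) (t x)) by dfn.
have [a1 [b1 [ab1 sub1 [H1|H1]]]] := generic_dichotomy hS hSk ab din.
  have dR1 : dfp (fun z => box a1 b1 z.1 -> [/\ z.2.1 < t z.1, t z.1 < z.2.2 &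
      forall w, z.2.1 < w < z.2.2 -> As (y z.1) w]) by dfn.
  have [x|f df Hf] := @skolem _ _ _ S m0 hSk _ _ _ _
    (fun x (z : M * M) => box a1 b1 x -> [/\ z.1 < t x, t x < z.2 &
      forall w, z.1 < w < z.2 -> As (y x) w]) dR1.
    case: (pselect (box a1 b1 x)) => [/H1 [l [r ?]]|nx]; first by exists (l, r).
    by exists (m0, m0).
  have dl : dmap (fun x => (f x).1) by dfn.
  have dr : dmap (fun x => (f x).2) by dfn.
  have [x /Hf [] //|a2 [b2 [l [r [ab2 sub2 H2]]]]] := squeeze hS hSk ab1 dl dt dr.
  pose P z := forall w, l < w < r -> As z w.
  have dP : dfp P by rewrite /P; dfn.
  have yP x : box a2 b2 x -> P (y x) /\ l < t x < r.
    move=> xab; have [h1 h2 h3 h4] := H2 x xab.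
    have [_ _ H] := Hf x (sub2 x xab); split; last by rewrite h2.
    by move=> w /(sub_itv (ltW h1) (ltW h4)); apply: H.
  have lr : l < r.
    by have [x /yP [_ /andP [lt tr]]] := box_mid hS ab2; apply: lt_trans lt tr.
  have gy x : box a2 b2 x -> g (snocV (y x) (t x)) = x.
    by move=> /sub2 /sub1 /Hs [].
  (* The fibres over [P] contain the interval from [l] to [r]. Fixing the last
     coordinate of the section leaves a box of dimension [k] or [k - 1]. *)
  have [[a3 [b3 [v [ab3 sub3 tv]]]]|] := const_or_slice hS hSk dt ab2.
    have lvr : l < v < r.
      by have [x xab] := box_mid hS ab3; have [_] := yP _ (sub3 x xab); rewrite tv.
    have [|D [cD DP]] := IH k P _ _ _ dP (dgs v) ab3.
      move=> x xab; exists (y x); first by have [] := yP x (sub3 x xab).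
      by rewrite -{1}(tv x xab); apply/gy/sub3.
    apply: (cell_const_graph cD (definable_cont_const v (cell_dfp cD))) => z Dz.
    by apply: (DP z Dz).
  move=> [k' [J [v [a3 [b3 [Ek ab3 H3]]]]]].
  have dgJ : dmap (fun z => sel J (g (snocV z v))) by have := dgs v; dfn.
  have [|D [cD DP]] := IH k' P _ _ _ dP dgJ ab3.
    move=> x' /H3 [x [xab xJ tx]]; exists (y x); first by have [] := yP x xab.
    by rewrite -tx gy.
  have dD := cell_dfp cD.
  have := @cell_band _ _ _ S n k' _ (Some (fun=> l)) (Some (fun=> r)) cD
    (definable_cont_const _ dD) (definable_cont_const _ dD) (fun _ _ => lr).
  rewrite Ek => cB; eexists; split; first exact: cB.
  move=> x [/= Dx [lx xr]]; have lxr : l < rsubmx x ord0 ord0 < r by apply/andP.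
  by have := DP _ Dx _ lxr; rewrite /As snocVK.
(* The points of a fibre that are not interior to it are isolated. So over a
   smaller box the last coordinate of the section is the only such point of its
   fibre between two constants [l] and [r], and hence a function [h] of the others. *)
pose A0 z v := As z v /\ ~ inner z v.
have dA0 : dfp (fun z => A0 z.1 z.2) by rewrite /A0; dfn.
have iso z v : A0 z v -> exists l r, [/\ l < v, v < r &
    forall w, l < w < r -> A0 z w -> w = v].
  move=> A0v.
  have dA0z : dfp (fun w => A0 z w) by dfn.
  have side o : ev o v (fun w => ~ A0 z w).
    have [|//] := om_ev hS o v dA0z.
    case: o => -[p /= vp Hp]; exfalso.
      have [w vw wp] := dense vp; have [_] := Hp w vw wp; apply; exists v, p.
      by split=> // w' /andP [h h']; have [] := Hp w' h h'.
    have [w vw wp] := dense vp; have [_] := Hp w wp vw; apply; exists p, v.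
    by split=> // w' /andP [h h']; have [] := Hp w' h' h.
  have [r /= vr Hr] := side true; have [l /= lv Hl] := side false.
  exists l, r; split=> // w /andP [lw wr] Aw.
  by case: (ltgtP w v) => // h; [case: (Hl w h lw)|case: (Hr w h wr)].
have dR1 : dfp (fun z => box a1 b1 z.1 -> [/\ z.2.1 < t z.1, t z.1 < z.2.2 &
    forall w, z.2.1 < w < z.2.2 -> A0 (y z.1) w -> w = t z.1]) by dfn.
have A0y x : box a1 b1 x -> A0 (y x) (t x).
  by move=> xab; split; [have [] := Hs x (sub1 x xab)|apply: H1].
have [x|f df Hf] := @skolem _ _ _ S m0 hSk _ _ _ _
  (fun x (z : M * M) => box a1 b1 x -> [/\ z.1 < t x, t x < z.2 &
    forall w, z.1 < w < z.2 -> A0 (y x) w -> w = t x]) dR1.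
  case: (pselect (box a1 b1 x)) => [/A0y /iso [l [r ?]]|nx]; first by exists (l, r).
  by exists (m0, m0).
have dl : dmap (fun x => (f x).1) by dfn.
have dr : dmap (fun x => (f x).2) by dfn.
have [x /Hf [] //|a2 [b2 [l [r [ab2 sub2 H2]]]]] := squeeze hS hSk ab1 dl dt dr.
pose P z := exists v, [/\ l < v < r, A0 z v & forall w, l < w < r -> A0 z w -> w = v].
have dP : dfp P by rewrite /P; dfn.
have dR2 : dfp (fun z => P z.1 -> l < z.2 < r /\ A0 z.1 z.2) by dfn.
have [z|h dh Hh] := @skolem _ _ _ S m0 hSk _ _ _ _
  (fun z v => P z -> l < v < r /\ A0 z v) dR2.
  case: (pselect (P z)) => [[v []]|nP]; first by exists v.
  by exists m0.
have ltr x : box a2 b2 x -> l < t x < r.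
  by move=> /H2 [_ h1 h2 _]; rewrite h1.
have uniq x w : box a2 b2 x -> l < w < r -> A0 (y x) w -> w = t x.
  move=> xab wlr; have [h1 _ _ h4] := H2 x xab.
  have [_ _ H] := Hf x (sub2 x xab); apply: H.
  exact: (sub_itv (ltW h1) (ltW h4)).
have Py x : box a2 b2 x -> P (y x).
  move=> xab; exists (t x); split; [exact: ltr|exact/A0y/sub2|].
  by move=> w; apply: uniq.
have dgh : dmap (fun z => g (snocV z (h z))).
  by apply: (dmap_comp dg); apply: dsn; dfn.
have [|D [cD DP]] := IH k P _ _ _ dP dgh ab2.
  move=> x xab; exists (y x); first exact: Py.
  have [hl hA] := Hh _ (Py x xab).
  by rewrite (uniq x _ xab hl hA); case: (Hs x) => //; apply/sub1/sub2.
have [D' [cD' DD' ch]] := cell_generic_cont cD dh.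
apply: (cell_const_graph cD' ch) => z /DD' /DP Pz.
by have [_ []] := Hh z Pz.
Qed.

(** Let [s] be a section of the cell [D] over a box in its projection. For all [u]
    in a smaller box, the fibre of [A] over [u] accumulates at [s u], since
    otherwise a fixed box around a part of the section would separate it from [A].
    As [s u] is not in [A], one more coordinate takes infinitely many values on
    each fibre, and [A] projects onto a box of the next dimension. *)
Theorem frontier_cell n r (D A : set 'rV[M]_n) : cell S r D -> dfp A ->
  (forall x, D x -> ~ A x) ->
  (forall x P, D x -> nearV x P -> exists2 y, A y & P y) ->
  exists D', cell S r.+1 D' /\ D' `<=` A.
Proof.
move=> cD dA disj acc; have dD := cell_dfp cD.
have [J [Ji [a [b [ab Jab]]] Jc]] := cell_projection cD.
have dR : dfp (fun z => box a b z.1 -> D z.2 /\ sel J z.2 = z.1) by dfn.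
have [u|s ds Hs] := @skolem _ _ _ S m0 hSk _ _ _ _
    (fun u y => box a b u -> D y /\ sel J y = u) dR.
  case: (pselect (box a b u)) => [/Jab [y Cy yu]|nu]; first by exists y.
  by exists (const_mx m0).
pose F u y := A y /\ sel J y = u.
have dF : dfp (fun z => F z.1 z.2) by rewrite /F; dfn.
pose B u := forall p q, box p q (s u) -> exists2 y, box p q y & F u y.
have dB : dfp B by rewrite /B; dfn.
have [a1 [b1 [ab1 sub1 [H1|H1]]]] := generic_dichotomy hS hSk ab dB; last first.
  have dR1 : dfp (fun z => box a1 b1 z.1 -> box z.2.1 z.2.2 (s z.1) /\
      forall y, box z.2.1 z.2.2 y -> ~ F z.1 y) by dfn.
  have [u|f df Hf] := @skolem _ _ _ S m0 hSk _ _ _ _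
    (fun u (z : 'rV[M]_n * 'rV[M]_n) => box a1 b1 u -> box z.1 z.2 (s u) /\
      forall y, box z.1 z.2 y -> ~ F u y) dR1.
    case: (pselect (box a1 b1 u)) => [/H1|nu]; last first.
      by exists (const_mx m0, const_mx m0).
    move=> /existsNP [p /existsNP [q /not_implyP [spq nF]]].
    by exists (p, q) => _; split=> // y ypq Fy; apply: nF; exists y.
  have dl : dmap (fun u => (f u).1) by dfn.
  have dr : dmap (fun u => (f u).2) by dfn.
  have [u /Hf [] //|a2 [b2 [l [r' [ab2 sub2 H2]]]]] := squeezeV hS hSk ab1 dl ds dr.
  have [u uab] := box_mid hS ab2.
  have [Du su] := Hs u (sub1 _ (sub2 _ uab)).
  have near1 : nearV (s u) (fun y => box a2 b2 (sel J y)).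
    by apply: (nearV_sel hS); rewrite su.
  have near2 : nearV (s u) (box l r').
    by apply: nearV_box => i; have [_ h1 h2 _] := H2 u uab i; rewrite h1.
  have [y Ay [yab ylr]] := acc _ _ Du (nearV_and near1 near2).
  have [_ H] := Hf _ (sub2 _ yab); exfalso; apply: (H y) => // i.
  have [h1 _ _ h4] := H2 _ yab i; have /andP [h2 h3] := ylr i.
  by rewrite (lt_trans h1 h2) (lt_trans h3 h4).
(* If no coordinate took an interval of values on the fibre over [u], all of
   them would be isolated at [s u], and [s u] would lie in [A]. *)
pose Q i u l r' := forall t, l < t < r' -> exists2 y, F u y & y ord0 i = t.
have dQ i : dfp (fun z => Q i z.1.1 z.1.2 z.2) by rewrite /Q; dfn.
have [||i [a2 [b2 [ab2 sub2 H2]]]] :=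
    @generic_cover _ _ _ _ _ hS hSk _ _ _ _
      (fun i u => exists l r', l < r' /\ Q i u l r') ab1.
- by move=> i; have := dQ i; move: (Q i) => R dR2; dfn.
- move=> u uab; apply: contrapT => noi.
  have [Du su] := Hs u (sub1 _ uab).
  have near1 : nearV (s u) (fun y => forall i,
      (exists2 z, F u z & z ord0 i = y ord0 i) -> y ord0 i = s u ord0 i).
    apply: (nearV_all hS) => i.
    pose E t := exists2 z, F u z & z ord0 i = t.
    have dE : dfp E by rewrite /E; dfn.
    have side w : ev w (s u ord0 i) (fun t => ~ E t).
      have [|//] := om_ev hS w (s u ord0 i) dE.
      case: w => -[p /= vp Hp]; exfalso; apply: noi; exists i.
        by exists (s u ord0 i), p; split=> // t /andP [h h']; apply: Hp.
      by exists p, (s u ord0 i); split=> // t /andP [h h']; apply: Hp.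
    have [r' /= vr Hr] := side true; have [l /= lv Hl] := side false.
    have : l < s u ord0 i < r' by rewrite lv.
    move=> /(nearV_coord hS); apply: nearV_mono => y /andP [ly yr] Ey.
    by case: (ltgtP (y ord0 i) (s u ord0 i)) => // h;
      [case: (Hl _ h ly)|case: (Hr _ h yr)].
  have [p [q [spq H]]] := near1.
  have [y ypq Fy] := H1 u uab p q spq.
  have yE : y = s u by apply/rowP => i; apply: (H y ypq i); exists y.
  by case: (disj _ Du); rewrite -yE; case: Fy.
have [|//|a3 [b3 [l [r' [ab3 sub3 lr HQ]]]]] := fiber_itv hS hSk ab2 (dQ i).
  by move=> u l r1 l' r' ll lr rr H t /(sub_itv ll rr); apply: H.
have dg : dmap (fun y : 'rV[M]_n => consV (y ord0 i) (sel J y)) by dfn.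
have ab4 : nbox (consV l a3) (consV r' b3) by apply/nbox_consV.
apply: (image_box_cell dA dg ab4) => x; rewrite -(consV_tail x) => /box_consV [h xab].
by have [y [Ay yJ] yi] := HQ _ xab _ h; exists y; rewrite // yJ yi.
Qed.

End Cells.

(** * Definable spaces as types with coordinates *)

Section Space.
Context {d : Order.disp_t} {M : orderTopologicalType d} {L : language}.
Context {S : structure L M} {m0 : has_point M}.
Context {X : topologicalType}.
Variable D : definable_space S X.
Variables (m1 : M) (m01 : m1 <> m0).
Local Notation chdim := (@chdim _ _ _ _ _ D).
Implicit Types (j : 'I_(ncharts D)).

(** All the charts are used at once, so that no chart has to be chosen for a point.
    The additional coordinate of a chart tells whether the point lies in its
    domain. *)
Definition Xidx : finType := {j : 'I_(ncharts D) & (option 'I_(chdim j))}.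

Definition Xcrd (x : X) (i : Xidx) : M :=
  let: existT j o := i in
  if o is Some k then ifp (dom j x) (chart j x ord0 k) m0
  else ifp (dom j x) m1 m0.

Lemma Xcrd_dom x j : Xcrd x (existT _ j None) = m1 <-> dom j x.
Proof.
rewrite /Xcrd; case: (pselect (dom j x)) => h; [rewrite ifpT|rewrite ifpF] => //.
by split=> // E; case: m01.
Qed.

Lemma chart_inj j x y : dom j x -> dom j y -> chart j x = chart j y -> x = y.
Proof. by move=> Dx Dy; apply: (@ds_inj _ _ _ _ _ D j); rewrite inE. Qed.

Lemma ex_dom x : exists j, dom j x.
Proof.
have : [set: X] x by [].
by rewrite -(ds_cover D) => -[j _ Dx]; exists j.
Qed.

Lemma Xcrd_inj x y : Xcrd x = Xcrd y -> x = y.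
Proof.
move=> E; have [j Dx] := ex_dom x.
have Dy : dom j y by apply/Xcrd_dom; rewrite -E; apply/Xcrd_dom.
apply: (chart_inj Dx Dy); apply/rowP => k.
have := congr1 (fun f => f (existT (fun j => option 'I_(chdim j)) j (Some k))) E.
by rewrite /Xcrd !ifpT.
Qed.

Lemma defI_definable I n (A : set 'rV[M]_n) (r : 'I_n -> I) : definable S A ->
  defI S (fun v : I -> M => A (\row_i v (r i))%R).
Proof. by move=> /(definable_defI S m0) dA; apply: (defI_sub r dA). Qed.

(** The definition of a definable space makes the coordinates in one chart decide
    those in the others: whether the point is in their domains, by
    [ds_overlap_definable], and its images there, by [ds_transition_definable]. *)
Lemma Xcrd_def : defI S (fun v => exists x, Xcrd x = v).
Proof.
pose at_ j : 'I_(chdim j) -> Xidx := fun k => existT _ j (Some k).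
pose row_ j (v : Xidx -> M) : 'rV[M]_(chdim j) := (\row_k v (at_ j k))%R.
pose T j : Xidx := existT _ j None.
pose im j := chart j @` dom j.
pose ov j j' := chart j @` (dom j `&` dom j').
pose tr j j' := [set row_mx (chart j x) (chart j' x) | x in dom j `&` dom j'].
apply: (defI_ext (A := fun v => exists j, (v (T j) = m1 /\ im j (row_ j v)) /\
  forall j', (ov j j' (row_ j v) ->
      v (T j') = m1 /\ tr j j' (row_mx (row_ j v) (row_ j' v))) /\
    (~ ov j j' (row_ j v) ->
      v (T j') = m0 /\ forall k, v (at_ j' k) = m0))); last first.
  apply: (defI_exfin m0) => j.
  have dov j' : defI S (fun v => ov j j' (row_ j v)).
    exact: (defI_definable (at_ j) (ds_overlap_definable j j')).
  apply: (defI_and m0).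
    apply: (defI_and m0); first exact: defI_eqc.
    exact: (defI_definable (at_ j) (ds_image_definable j)).
  apply: (defI_allfin m0) => j'; apply: (defI_and m0).
    apply: (defI_imp (dov j')); apply: (defI_and m0); first exact: defI_eqc.
    have := defI_definable (fun i => match fintype.split i with
      inl k => at_ j k | inr k => at_ j' k end) (ds_transition_definable j j').
    apply: defI_ext => v.
    suff -> : (\row_i v (match fintype.split i with
      inl k => at_ j k | inr k => at_ j' k end))%R = row_mx (row_ j v) (row_ j' v).
      by [].
    by apply/rowP => i; rewrite !mxE; case: fintype.split => k; rewrite mxE.
  apply: (defI_imp (defI_not m0 (dov j'))); apply: (defI_and m0).
    exact: defI_eqc.
  by apply: (defI_allfin m0) => k; apply: defI_eqc.
have rowE x j : dom j x -> row_ j (Xcrd x) = chart j x.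
  by move=> Dx; apply/rowP => k; rewrite mxE /Xcrd /= ifpT.
have ovE x j j' : dom j x -> ov j j' (chart j x) -> dom j' x.
  by move=> Dx [y [Dy Dy'] /(chart_inj Dy Dx) <-].
move=> v; split=> [[j [[vj [x Dx xv]] H]]|[x <-]].
  exists x; apply/funext => -[j' o]; have [H1 H2] := H j'.
  rewrite -xv in H1 H2.
  case: (pselect (dom j' x)) => Dx'.
    have [E [y [Dy _] /eq_row_mx [/(chart_inj Dy Dx) -> E']]] :=
      H1 (ex_intro2 _ _ x (conj Dx Dx') erefl).
    rewrite /Xcrd; case: o => [k|]; rewrite ifpT //.
    by rewrite E' mxE.
  have [E E'] := H2 (fun h => Dx' (ovE x j j' Dx h)).
  by rewrite /Xcrd; case: o => [k|]; rewrite ifpF // E'.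
have [j Dx] := ex_dom x; exists j; rewrite rowE //; split.
  by split; [apply/Xcrd_dom|exists x].
move=> j'; split=> [/(ovE _ _ _ Dx) Dx'|nov].
  by split; [apply/Xcrd_dom|exists x => //; rewrite rowE].
have Dx' : ~ dom j' x by move=> Dx'; apply: nov; exists x.
by split=> [|k]; rewrite /Xcrd /= ifpF.
Qed.

#[local] Instance ctxS : ctx S X :=
  {| cidx := Xidx; crd := Xcrd; crd_inj := Xcrd_inj; crd_def := Xcrd_def |}.

Local Notation dfp := (defpred (S := S)).
Local Notation dmap := (defmap (S := S)).

Lemma dfp_dom j : dfp (dom j).
Proof.
apply: (dfp_ext (P := fun x => crd x (existT _ j None : Xidx) = m1)).
  by move=> x; apply: Xcrd_dom.
exact: (dfp_crd_eqc (c := ctxS)).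
Qed.

(** Outside its domain the values of a chart are arbitrary, so they need not be
    definable. *)
Definition tchart j (x : X) : 'rV[M]_(chdim j) :=
  (\row_k Xcrd x (existT _ j (Some k)))%R.

Lemma tchartE j x : dom j x -> tchart j x = chart j x.
Proof. by move=> Dx; apply/rowP => k; rewrite mxE /Xcrd ifpT. Qed.

Lemma dmap_tchart j : dmap (tchart j).
Proof.
rewrite /tchart; apply: dmap_mx => k.
exact: (dmap_crd_at (c := ctxS) (existT _ j (Some k) : Xidx)).
Qed.

Lemma definable_sub_dfp (A : set X) : definable_sub D A <-> dfp A.
Proof.
have dt := dmap_tchart; have dd := dfp_dom.
split=> [dA|dA j].
  have {}dA j : dfp (chart j @` (A `&` dom j)) by apply/definable_dfp/dA.
  apply: (dfp_ext (P := fun x => exists j, dom j x /\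
    (chart j @` (A `&` dom j)) (tchart j x))); last first.
    apply: dfp_exfin => j; apply: dfp_and; first exact: dfp_dom.
    exact: (dfp_comp (dA j) (dt j)).
  move=> x; split=> [[j [Dx [y [Ay Dy]]]]|Ax].
    by rewrite tchartE // => /(chart_inj Dy Dx) <-.
  by have [j Dx] := ex_dom x; exists j; split=> //; exists x; rewrite ?tchartE.
apply/definable_dfp; apply: (dfp_ext (P := fun y : 'rV[M]_(chdim j) => exists x : X,
  (A x /\ dom j x) /\ tchart j x = y)).
  move=> y; split=> [[x [[Ax Dx] <-]]|[x [Ax Dx] <-]].
    by exists x; rewrite ?tchartE.
  by exists x; rewrite tchartE.
have dj := dd j; have tj := dt j.
by dfn.
Qed.

(** The boxes of the charts, a definable basis of the topology. *)
Definition bx j a b : set X := fun x => dom j x /\ box a b (tchart j x).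

Lemma dfp_bx G (c : ctx S G) j (a b : G -> 'rV[M]_(chdim j)) (x : G -> X) :
  dmap a -> dmap b -> dmap x -> dfp (fun y => bx (j := j) (a y) (b y) (x y)).
Proof.
move=> da db dx; rewrite /bx.
by have dj := dfp_dom j; have tj := dmap_tchart j; dfn.
Qed.

Ltac dfn_hook ::= lazymatch goal with
  | |- defpred (fun x => is_true (lts _ _ _)) => apply: dfp_lts
  | |- defpred (fun x => ev _ (@?f x) (@?P x)) =>
      apply: (@dfp_ev _ _ _ _ _ _ _ _ f P)
  | |- defpred (fun x => box _ _ _) => apply: dfp_box
  | |- defpred (fun x => bx _ _ _) => apply: dfp_bx
  | |- defpred (fun x => dom _ _) => apply: (dfp_comp (dfp_dom _))
  | |- defmap (fun x => tchart _ _) => apply: (dmap_comp (dmap_tchart _))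
  | |- defmap (fun x => consV _ _) => apply: dmap_consV
  | |- defmap (fun x => tailV _) => apply: dmap_tailV
  | |- defmap (fun x => sel _ _) => apply: dmap_sel
  | |- defmap (fun x => setc _ _ _) => apply: dmap_setc
  end.

Hypothesis hS : o_minimal S.
Hypothesis hSk : definable_skolem_functions S.
Hypothesis hX : hausdorff_space X.

Lemma open_box k (a b : 'rV[M]_k) : open (box a b).
Proof.
rewrite openE => x xab; apply/(nbhsV hS).
exact: nearV_box.
Qed.

Lemma open_bx j a b : open (bx (j := j) a b).
Proof.
have sub : bx a b `<=` dom j by move=> x [].
apply/(ds_chart_homeo sub); exists (box a b); first exact: open_box.
apply/seteqP; split=> [_ [x [Dx xab] <-]|_ [[x Dx <-] xab]].
  by split; [exists x|rewrite -tchartE].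
by exists x => //; split=> //; rewrite tchartE.
Qed.

Lemma nbhs_bx j a b x : bx (j := j) a b x -> nbhs x (bx a b).
Proof. by move=> xab; apply: open_nbhs_nbhs; split=> //; apply: open_bx. Qed.

Lemma bx_basis j x U : dom j x -> nbhs x U ->
  exists a b, bx (j := j) a b x /\ bx a b `<=` U.
Proof.
move=> Dx; rewrite nbhsE => -[V [oV Vx] VU].
have sub : V `&` dom j `<=` dom j by move=> ? [].
have oVD : open (V `&` dom j) by apply: openI => //; apply: ds_dom_open.
have [O oO EO'] := (ds_chart_homeo sub).1 oVD.
have EO : chart j @` (V `&` dom j) = chart j @` dom j `&` O := EO'.
have Ox : O (chart j x).
  suff : (chart j @` dom j `&` O) (chart j x) by case.
  by rewrite -EO; exists x.
have /(nbhsV hS) [a [b [xab H]]] : nbhs (chart j x) O.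
  by apply: open_nbhs_nbhs.
exists a, b; split; first by split=> //; rewrite tchartE.
move=> y [Dy]; rewrite tchartE // => /H Oy.
have : (chart j @` dom j `&` O) (chart j y) by split=> //; exists y.
by rewrite -EO => -[z [Vz Dz] /(chart_inj Dz Dy) <-]; apply: VU.
Qed.

Lemma dfp_closure (A : set X) : dfp A -> dfp (closure A).
Proof.
move=> dA; apply: (dfp_ext (P := fun x => forall (j : 'I_(ncharts D)),
  forall a b : 'rV[M]_(chdim j), bx a b x -> exists y, A y /\ bx a b y)).
  move=> x; split=> [H U Ux|clA j a b xab].
    have [j Dx] := ex_dom x; have [a [b [xab sub]]] := bx_basis Dx Ux.
    by have [y [Ay /sub Uy]] := H j a b xab; exists y.
  by have [y [Ay yab]] := clA _ (nbhs_bx xab); exists y.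
by dfn.
Qed.

(** * Definable compactness and iterated limits *)

(** Stated with the boxes of the charts, this is definable in [t] and [x]. *)
Definition limX s (p : M -> X) (t : M) (x : X) : Prop := forall j,
  forall a b : 'rV[M]_(chdim j), bx a b x -> ev s t (fun t' => bx a b (p t')).

Lemma limXP s p t x : limX s p t x <-> forall U, nbhs x U -> ev s t (fun t' => U (p t')).
Proof.
split=> H; last by move=> j a b xab; apply: H; apply: nbhs_bx.
move=> U Ux; have [j Dx] := ex_dom x.
have [a [b [xab sub]]] := bx_basis Dx Ux.
by apply: ev_mono (H j a b xab) => t' _ /sub.
Qed.

Lemma nbhs_lts s (t a t' : M) : lts s t t' -> lts s t' a ->
  nbhs t' (fun y => lts s t y /\ lts s y a).
Proof.
case: s => /= h h'; apply/(nbhsM hS).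
  by exists t, a; split=> // y /andP [].
by exists a, t; split=> // y /andP [].
Qed.

(** Eventually the curve stays in the domain of one chart, where the monotonicity
    theorem applies to each of its coordinates. *)
Lemma ev_continuous s (p : M -> X) t : dmap p ->
  ev s t (fun t' => forall U, nbhs (p t') U -> nbhs t' (fun y => U (p y))).
Proof.
move=> dp.
have cov : ev s t (fun t' => exists j, dom j (p t')).
  by have [a ta] := lts_ex hS s t; exists a => // t' _ _; exact: (ex_dom).
have dd j : dfp (fun t' => dom j (p t')) by dfn.
have [j [a ta Ha]] := ev_cover hS dd cov.
have Hc : ev s t (fun t' => forall k : 'I_(chdim j), k \in enum 'I_(chdim j) ->
    contM (fun y => tchart j (p y) ord0 k) t').
  elim: (enum _) => [|k l IH].
    by exists a => // t' _ _ k; rewrite in_nil.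
  have dk : dmap (fun y => tchart j (p y) ord0 k) by dfn.
  apply: ev_mono (ev_and (ev_contM hS s t dk) IH) => t' _ [H1 H2] k'.
  by rewrite inE => /predU1P [->|/H2].
have nb : ev s t (fun t' => nbhs t' (fun y => dom j (p y))).
  exists a => // t' h h'; apply: filterS (nbhs_lts h h') => y [h1 h2].
  exact: Ha.
have dj : ev s t (fun t' => dom j (p t')) by exists a.
apply: ev_mono (ev_and (ev_and Hc nb) dj) => t' _ [[Hk Hd] Dj] U pU.
have [a' [b' [[_ xab] sub]]] := bx_basis Dj pU.
have : nbhs t' (fun y => forall k, k \in enum 'I_(chdim j) ->
    a' ord0 k < tchart j (p y) ord0 k < b' ord0 k).
  have : forall k, k \in enum 'I_(chdim j) -> k \in enum 'I_(chdim j) by [].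
  elim: {1 3}(enum _) => [|k l IH] kl.
    by apply: filterE => y k; rewrite in_nil.
  have /IH {}IH : forall k', k' \in l -> k' \in enum 'I_(chdim j).
    by move=> k' k'l; apply: kl; rewrite inE k'l orbT.
  have ck := Hk k (kl k (mem_head _ _)).
  have /andP [h1 h2] := xab k.
  have [u [v [ut tv H]]] := ck _ _ h1 h2.
  have near1 : nbhs t' (fun y => a' ord0 k < tchart j (p y) ord0 k < b' ord0 k).
    by apply/(nbhsM hS); exists u, v.
  apply: filterS (filterI near1 IH) => y [H1 H2] k'.
  by rewrite inE => /predU1P [->|/H2].
move=> near2; apply: filterS (filterI near2 Hd) => y [H1 H2].
by apply: sub; split=> // k; apply: H1; rewrite mem_enum.
Qed.

(** With [a] on side [s] of [t], which of the two is the left endpoint depends on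
    the side. *)
Definition lend (s : bool) (t a : M) : option M := Some (if s then t else a).
Definition rend (s : bool) (t a : M) : option M := Some (if s then a else t).

Lemma oo_itv_ends s t a t' : oo_itv (lend s t a) (rend s t a) t' <->
  lts s t t' /\ lts s t' a.
Proof. by case: s; split=> -[]. Qed.

Definition end_filter s t a : set_system M := if s
  then at_left_end (lend s t a) (rend s t a)
  else at_right_end (lend s t a) (rend s t a).

Lemma end_filterP s t a (P : set M) : lts s t a -> end_filter s t a P <-> ev s t P.
Proof.
move=> ta; split.
  case: s ta => /= ta [s' [h h'] sub].
    by exists s' => //= t' tt' t's; apply: sub.
  by exists s' => //= t' tt' t's; apply: sub.
move=> /ev_and /(_ (ev_near ta)) [e te He].
have [s' ts se] := ltsW hS te.
have [_ sa] := He s' ts se.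
case: s ta te He ts se sa => /= ta te He ts se sa; exists s' => //.
  by move=> t' [/= h h']; apply: (He t' h (lt_trans h' se)).1.
by move=> t' [/= h h']; apply: (He t' h' (lt_trans se h)).1.
Qed.

Lemma end_limX s t a (p : M -> X) x : lts s t a ->
  p @ end_filter s t a --> x <-> limX s p t x.
Proof.
move=> ta; rewrite limXP; split=> H U /H; first by move=> /(end_filterP _ ta).
by move=> /(end_filterP _ ta).
Qed.

Lemma ev_curve s t (p : M -> X) (C : set X) : dmap p -> ev s t (fun t' => C (p t')) ->
  exists2 a, lts s t a & definable_curve D C (lend s t a) (rend s t a) p.
Proof.
move=> dp evC.
have [a ta Ha] := ev_and evC (ev_continuous s t dp).
exists a => //; split.
- by case: (s) ta.
- by move=> t' /oo_itv_ends [h h']; apply: (Ha t' h h').1.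
- apply/subspace_continuousP => t' /oo_itv_ends [h h'] U /(Ha t' h h').2.
  by apply: filterS => y Uy _.
- move=> j; apply/definable_dfp.
  apply: (dfp_ext (P := fun w : 'rV[M]_(1 + chdim j) => exists t' : M,
    ((lts s t t' /\ lts s t' a) /\ dom j (p t')) /\
    row_mx (const_mx t' : 'rV[M]_1) (tchart j (p t')) = w)); last by dfn.
  move=> w; split=> [[t' [[h Dt] <-]]|[t' [h Dt] <-]].
    by exists t'; [split=> //; apply/oo_itv_ends|rewrite tchartE].
  by exists t'; rewrite tchartE //; split=> //; split=> //; apply/oo_itv_ends.
Qed.

Lemma compact_limX K s t (p : M -> X) : definably_compact D K -> dmap p ->
  (forall t', K (p t')) -> exists2 x, K x & limX s p t x.
Proof.
move=> [_ cK] dp pK.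
have evK : ev s t (fun t' => K (p t')) by have [a ta] := lts_ex hS s t; exists a.
have [a ta cur] := ev_curve dp evK.
have [[x Kx xl] [y Ky yl]] := cK _ _ _ cur.
case: s {evK} ta cur xl yl => ta cur xl yl.
  by exists x => //; apply/(end_limX p x ta).
by exists y => //; apply/(end_limX p y ta).
Qed.

Definition lim_step m s (k : 'I_m) (p q : 'rV[M]_m -> X) : Prop :=
  forall u, limX s (fun t => p (setc u k t)) (u ord0 k) (q u).

Lemma lim_step_ex K m s (k : 'I_m) (p : 'rV[M]_m -> X) :
  definably_compact D K -> dmap p -> (forall u, K (p u)) ->
  exists q, [/\ dmap q, forall u, K (q u) & lim_step s k p q].
Proof.
move=> cK dp pK; have [/(definable_sub_dfp) dK _] := cK.
pose R u x := K x /\ limX s (fun t => p (setc u k t)) (u ord0 k) x.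
have dR : dfp (fun z => R z.1 z.2).
  by rewrite /R /limX; dfn.
have [u|q dq Hq] := @skolem _ _ _ S m0 hSk _ _ _ _ R dR.
  have dpu : dmap (fun t => p (setc u k t)) by dfn.
  have [x Kx xl] := compact_limX s (u ord0 k) cK dpu (fun t => pK _).
  by exists x.
by exists q; split=> // u; have [] := Hq u.
Qed.

(** Limits taken in one coordinate after the other: [q k] is obtained from [p] by
    letting the first [k] coordinates tend to their values from their sides. *)
Definition iterated m (side : 'I_m -> bool) (q : nat -> 'rV[M]_m -> X) : Prop :=
  forall k : 'I_m, lim_step (side k) k (q k) (q k.+1).

Lemma iterated_ex K m (side : 'I_m -> bool) (p : 'rV[M]_m -> X) :
  definably_compact D K -> dmap p -> (forall u, K (p u)) ->
  exists q, [/\ q 0%N = p, forall k, dmap (q k), forall k u, K (q k u) &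
    iterated side q].
Proof.
move=> cK dp pK.
pose (good := {f : 'rV[M]_m -> X | dmap f /\ forall u, K (f u)}).
have stepex (z : 'I_m * good) : exists w : good,
    lim_step (side z.1) z.1 (sval z.2) (sval w).
  have [df fK] := svalP z.2.
  have [f' [df' fK' H]] := lim_step_ex (side z.1) z.1 cK df fK.
  by exists (exist _ f' (conj df' fK')).
have [F HF] := choice stepex.
pose q := fix q k : good := if k is k'.+1 then
  (if insub k' is Some i then F (i, q k') else q k') else exist _ p (conj dp pK).
exists (fun k => sval (q k)); split=> // [k|k|k].
- by case: (svalP (q k)).
- by case: (svalP (q k)).
have -> : q k.+1 = F (k, q k) by rewrite /= valK.
exact: (HF (k, q k)).
Qed.

(** The limits are undone one by one. A limit in [W] and outside [C] is the limit
    of a curve that is eventually in [W], and that is eventually in [C], which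
    is the first alternative, or eventually outside [C], which allows to go on
    with a point of the curve as close to its end as desired. *)
Lemma descend m (side : 'I_m -> bool) q (W C : set X) (e : 'rV[M]_m) k u :
  iterated side q -> (forall i, dmap (q i)) -> dfp C -> open W ->
  (k <= m)%N -> W (q k u) -> ~ C (q k u) ->
  (forall i : 'I_m, (i < k)%N -> lts (side i) (u ord0 i) (e ord0 i)) ->
  (exists (i : 'I_m) u1, [/\ W (q i.+1 u1), ~ C (q i.+1 u1) &
     ev (side i) (u1 ord0 i) (fun t => C (q i (setc u1 i t)))]) \/
  (exists u', [/\ W (q 0%N u'), ~ C (q 0%N u') &
     forall i : 'I_m, if (i < k)%N then
       lts (side i) (u ord0 i) (u' ord0 i) /\ lts (side i) (u' ord0 i) (e ord0 i)
     else u' ord0 i = u ord0 i]).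
Proof.
move=> it dq dC oW; elim: k u => [|k IH] u km Wu nCu ue.
  by right; exists u; split=> // i; rewrite ltn0.
pose i := Ordinal km.
have /limXP lim := it i u.
have evW : ev (side i) (u ord0 i) (fun t => W (q i (setc u i t))).
  by apply: lim; apply: open_nbhs_nbhs.
have dCi : dfp (fun t => C (q i (setc u i t))) by have dqi := dq i; dfn.
have [evC|evC] := om_ev hS (side i) (u ord0 i) dCi.
  by left; exists i, u.
have [t [ut te [Wt nCt]]] := ev_ex hS (ev_and evW evC) (ue i (ltnSn k)).
have neq (i' : 'I_m) : (i' < k)%N -> i' != i.
  by move=> h; apply/eqP => E; move: h; rewrite E ltnn.
have [i' i'k|alt|[u' [Wu' nCu' Hu']]] := IH (setc u i t) (ltnW km) Wt nCt.
- by rewrite setc_other ?neq //; apply: ue; apply: ltnW.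
- by left.
right; exists u'; split=> // i'; have := Hu' i'; rewrite ltnS [(i' <= k)%N]leq_eqVlt.
case: (ltnP i' k) => [h|h]; first by rewrite orbT setc_other ?neq.
rewrite orbF; have [E|E] := eqVneq (i' : nat) k.
  have -> : i' = i by apply: val_inj.
  by rewrite setc_same => ->.
by rewrite setc_other //; apply: contra_neq E => ->.
Qed.

Section AtPoint.
Variable j : 'I_(ncharts D).
Local Notation n := (chdim j).

(** A point of [M^(n + n)] is a pair of opposite corners of a box; the lower
    corner approaches a point from the left and the upper one from the right. *)
Definition corner_side (i : 'I_(n + n)) : bool := (n <= i)%N.

Definition corners (c : 'rV[M]_n) : 'rV[M]_(n + n) := row_mx c c.

Lemma corner_lts (a b c e : 'rV[M]_n) : box a b c <->
  forall i, lts (corner_side i) (corners c ord0 i) (row_mx a b ord0 i).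
Proof.
split=> [cab i|H i].
  rewrite /corners !mxE; case: splitP => k Ek; rewrite /corner_side Ek.
    by rewrite leqNgt ltn_ord /=; have /andP [] := cab k.
  by rewrite leq_addr /=; have /andP [] := cab k.
have := H (lshift n i); have := H (rshift n i).
rewrite /corners /corner_side !row_mxEl !row_mxEr /= leq_addr leqNgt ltn_ord /=.
by move=> -> ->.
Qed.

Lemma corner_shrink (a b c : 'rV[M]_n) (w : 'rV[M]_(n + n)) :
  (forall i, lts (corner_side i) (corners c ord0 i) (w ord0 i) /\
     lts (corner_side i) (w ord0 i) (row_mx a b ord0 i)) ->
  box (lsubmx w) (rsubmx w) c /\ box (lsubmx w) (rsubmx w) `<=` box a b.
Proof.
move=> H; split.
  by apply/(corner_lts _ _ _ c) => i; rewrite hsubmxK; case: (H i).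
move=> y yw i; have /andP [ly yr] := yw i; rewrite !mxE in ly yr.
have [_] := H (lshift n i); have [_] := H (rshift n i).
rewrite /corner_side row_mxEl row_mxEr /= leq_addr leqNgt ltn_ord /=.
by move=> h h'; rewrite (lt_trans h' ly) (lt_trans yr h).
Qed.

Lemma near_choice K A : dfp K -> dfp A -> A `<=` K -> K !=set0 ->
  exists p : 'rV[M]_(n + n) -> X, [/\ dmap p, forall w, K (p w) &
    forall w y, A y -> bx (lsubmx w) (rsubmx w) y ->
      A (p w) /\ bx (lsubmx w) (rsubmx w) (p w)].
Proof.
move=> dK dA AK [k0 Kk0].
pose (R := fun (w : 'rV[M]_(n + n)) (x : X) => K x /\
  forall y, A y -> bx (lsubmx w) (rsubmx w) y ->
  A x /\ bx (lsubmx w) (rsubmx w) x).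
have dR : dfp (fun z => R z.1 z.2) by rewrite /R; dfn.
have [w|p dp Hp] := @skolem _ _ _ S m0 hSk _ _ _ _ R dR.
  case: (pselect (exists y, A y /\ bx (lsubmx w) (rsubmx w) y)).
    by move=> [y [Ay yw]]; exists y; split=> //; apply: AK.
  by move=> no; exists k0; split=> // y Ay yw; case: no; exists y.
by exists p; split=> // w; have [] := Hp w.
Qed.

(** By [descend] with [C] empty, any open set that contains the iterated limit
    contains values of [q 0] for arbitrarily small boxes around [x], and these
    values lie in the boxes. So the iterated limit cannot be separated from [x]. *)
Lemma iterated_limit A q x : (forall i, dmap (q i)) -> iterated corner_side q ->
  (forall w y, A y -> bx (lsubmx w) (rsubmx w) y ->
     bx (lsubmx w) (rsubmx w) (q 0%N w)) ->
  closure A x -> dom j x -> q (n + n)%N (corners (tchart j x)) = x.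
Proof.
move=> dq it qA clx Dx; apply: hX => U W Uw Wx.
have [a [b [[_ xab] sub]]] := bx_basis Dx Wx.
have Uo : (U°)%classic (q (n + n)%N (corners (tchart j x))) by apply: Uw.
have dF : dfp (fun _ : X => False) by apply: dfp_False.
have ue := (corner_lts a b _ (tchart j x)).1 xab.
have [[i [u1 [_ _ /(ev_False hS) //]]]|[w [Wp _ near]]] :=
  descend it dq dF (@open_interior _ U) (leqnn _) Uo id (fun i _ => ue i).
have {}near i : lts (corner_side i) (corners (tchart j x) ord0 i) (w ord0 i) /\
    lts (corner_side i) (w ord0 i) (row_mx a b ord0 i).
  by have := near i; rewrite ltn_ord.
have [xw subw] := corner_shrink near.
have [y [Ay yw]] := clx _ (nbhs_bx (conj Dx xw : bx _ _ x)).
have [Dp pw] := qA w y Ay yw.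
exists (q 0%N w); split; first exact: interior_subset Wp.
by apply: sub; split=> //; apply: subw.
Qed.

End AtPoint.

(** The iterated limit at [z] of points of [K] stays in [K], and it is [z]. *)
Lemma compact_closed K : definably_compact D K -> closure K `<=` K.
Proof.
move=> cK z clz; have [j Dz] := ex_dom z.
have [/(definable_sub_dfp) dK _] := cK.
have [k0 [Kk0 _]] := clz _ (@filterT _ _ (nbhs_filter z)).
have [|p [dp pK pA]] := @near_choice j K K dK dK (fun _ => id); first by exists k0.
have [q [q0 dq qK it]] := iterated_ex (@corner_side j) cK dp pK.
rewrite -(iterated_limit dq it _ clz Dz) => [|w y Ky yw]; first exact: qK.
by rewrite q0; case: (pA w y Ky yw).
Qed.

Lemma closure_of_lim (V : set X) (F : set_system M) (I : set M) (c : M -> X) x :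
  (forall P, F P -> exists2 t, I t & P t) -> (forall t, I t -> closure V (c t)) ->
  c @ F --> x -> closure V x.
Proof.
move=> FI cV cx U Ux; have [t It Ut] := FI _ (cx _ (nbhs_interior Ux)).
have [y [Vy Uy]] := cV t It _ (open_nbhs_nbhs (conj (@open_interior _ U) Ut)).
by exists y; split=> //; apply: interior_subset.
Qed.

Lemma at_left_endP a b (P : set M) : at_left_end a b P ->
  exists2 t, oo_itv a b t & P t.
Proof.
move=> [s [as_ sb] sub].
have [|l [r [lr H]]] := @oo_lt_itv _ _ _ S m0 hS a (Some s); first by case: (a) as_.
have [t lt tr] := dense hS lr; have lrt : l < t < r by rewrite lt.
have [at_ ts] := H t lrt; exists t; last by apply: sub; apply: H.
by split=> //; case: (b) sb => //= b' sb'; apply: lt_trans sb'.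
Qed.

Lemma at_right_endP a b (P : set M) : at_right_end a b P ->
  exists2 t, oo_itv a b t & P t.
Proof.
move=> [s [as_ sb] sub].
have [|l [r [lr H]]] := @oo_lt_itv _ _ _ S m0 hS (Some s) b; first by case: (b) sb.
have [t lt tr] := dense hS lr; have lrt : l < t < r by rewrite lt.
have [at_ ts] := H t lrt; exists t; last by apply: sub; apply: H.
by split=> //; case: (a) as_ => //= a' as'; apply: lt_trans at_.
Qed.

Lemma compact_closure K V : definably_compact D K -> dfp V -> V `<=` K ->
  definably_compact D (closure V).
Proof.
move=> cK dV VK; have clVK : closure V `<=` K.
  by move=> x /(closure_subset VK); apply: compact_closed.
split; first by apply/(definable_sub_dfp); apply: dfp_closure.
move=> a b c [ab cV cc dc].
have [|[x _ cx] [y _ cy]] := cK.2 a b c.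
  by split=> // t /cV /clVK.
split.
  exists x => //; apply: closure_of_lim (@at_left_endP a b) cV cx.
exists y => //; apply: closure_of_lim (@at_right_endP a b) cV cy.
Qed.

(** [R] consists of the points of the frontier that occur in an iterated limit as
    the limit of a curve in [A]. It is dense because an iterated limit that starts in
    [A] and ends outside [A] leaves [A] at some stage, arbitrarily close to its
    final value. *)
Lemma reachable_dense K V A j : definably_compact D K -> dfp V -> dfp A ->
  open V -> A `<=` V -> V `<=` K -> V !=set0 -> V `<=` dom j ->
  exists R : set X, [/\ dfp R, R `<=` (closure A `\` A) `&` V,
    forall x, R x -> exists a b c,
      definable_curve D A a b c /\ curve_limit_point a b c x &
    (closure A `\` A) `&` V `<=` closure R].
Proof.
move=> cK dV dA oV AV VK V0 Vj.
have [/(definable_sub_dfp) dK _] := cK.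
have [|p [dp pK pA]] := @near_choice j K A dK dA (fun _ h => VK _ (AV _ h)).
  by have [v Vv] := V0; exists v; apply: VK.
have [q [q0 dq qK it]] := iterated_ex (@corner_side j) cK dp pK.
pose n := chdim j.
pose R x := ((closure A x /\ ~ A x) /\ V x) /\ exists (i : 'I_(n + n)) u,
  q i.+1 u = x /\ ev (corner_side i) (u ord0 i) (fun t => A (q i (setc u i t))).
have dcl : dfp (closure A) by apply: dfp_closure.
exists R; split.
- rewrite /R; apply: dfp_and; first by dfn.
  by apply: dfp_exfin => i; have dqi := dq i; have dqS := dq i.+1; dfn.
- by move=> x [].
- move=> x [_ [i [u [qx evA]]]].
  have dc : dmap (fun t => q i (setc u i t)) by have dqi := dq i; dfn.
  have [a ta cur] := ev_curve dc evA.
  exists (lend (corner_side i) (u ord0 i) a), (rend (corner_side i) (u ord0 i) a).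
  exists (fun t => q i (setc u i t)); split=> //.
  have lim := it i u; rewrite qx in lim.
  have := (@end_limX _ _ _ (fun t => q i (setc u i t)) x ta).2 lim.
  by rewrite /curve_limit_point /end_filter; case: (corner_side i); [left|right].
move=> x [[clx nAx] Vx] U Ux.
have Dx := Vj x Vx.
have E : q (n + n)%N (corners (tchart j x)) = x.
  apply: (iterated_limit dq it _ clx Dx) => w y Ay yw.
  by rewrite q0; case: (pA w y Ay yw).
have oW : open (U° `&` V) by apply: openI => //; apply: open_interior.
have Wx : (U° `&` V) (q (n + n)%N (corners (tchart j x))).
  by rewrite E; split=> //; apply: nbhs_interior.
have nA : ~ A (q (n + n)%N (corners (tchart j x))) by rewrite E.
have [e1 [e2 [[_ xe] _]]] := bx_basis Dx (@filterT _ _ (nbhs_filter x)).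
have ue := (corner_lts e1 e2 _ (tchart j x)).1 xe.
have [[i [u1 [[Uq Vq] nq evA]]]|[w [_ nq near]]] :=
  descend it dq dA oW (leqnn _) Wx nA (fun i _ => ue i).
  exists (q i.+1 u1); split; last exact: interior_subset Uq.
  split; last by exists i, u1.
  split=> //; split=> // O Oq.
  have evO := (limXP _ _ _ _).1 (it i u1) O Oq.
  by have [t _ [Ot At]] := ev_exP hS (ev_and evO evA); exists (q i (setc u1 i t)).
exfalso; have {}near i : lts (corner_side i) (corners (tchart j x) ord0 i) (w ord0 i) /\
    lts (corner_side i) (w ord0 i) (row_mx e1 e2 ord0 i).
  by have := near i; rewrite ltn_ord.
have [xw _] := corner_shrink near.
have [y [Ay yw]] := clx _ (nbhs_bx (conj Dx xw : bx _ _ x)).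
by apply: nq; rewrite q0; case: (pA w y Ay yw).
Qed.

(** In each chart, a cell of the image of [F] minus [R] is in the frontier of the
    image of [R], as [R] is dense in [F], so the image of [F] contains a cell of
    the next dimension. *)
Lemma dense_dim (R F : set X) : dfp R -> dfp F -> R `<=` F -> F `<=` closure R ->
  F !=set0 -> (dimX D (F `\` R) < dimX D F)%E.
Proof.
move=> dR dF RF FR [x0 Fx0].
have dRj j : dfp (chart j @` (R `&` dom j)).
  by apply/definable_dfp; apply: (definable_sub_dfp R).2.
have dFj j : dfp (chart j @` (F `&` dom j)).
  by apply/definable_dfp; apply: (definable_sub_dfp F).2.
have dim_ge j r (C : set 'rV[M]_(chdim j)) : cell S r C ->
    C `<=` chart j @` (F `&` dom j) -> ((Posz r)%:E <= dimX D F)%E.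
  move=> cC sub; apply: le_trans (le_bigmax_cond _ _ (isT : xpredT j)).
  have rn : (r < (chdim j).+1)%N by rewrite ltnS; apply: cell_le cC.
  apply: (le_bigmax_cond _ (fun r : 'I_(chdim j).+1 => (Posz r)%:E) (j := Ordinal rn)).
  by apply/asboolP; exists C.
have Finf : (-oo < dimX D F)%E.
  have [j Dx0] := ex_dom x0.
  have dcst : dmap (fun _ : 'rV[M]_(chdim j) => const_mx m0 : 'rV[M]_0) by dfn.
  have nb0 : nbox (const_mx m0 : 'rV[M]_0) (const_mx m0) by case.
  have [|C [cC sub]] := image_box_cell hS hSk (dFj j) dcst nb0.
    move=> y _; exists (chart j x0); first by exists x0.
    by apply/rowP => -[].
  exact: lt_le_trans (ltNyr _) (dim_ge j 0%N C cC sub).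
apply: bigmax_lt => // j _; apply: bigmax_lt => // r /asboolP [C cC sub].
have [|y P /sub [z [[Fz _] Dz] <-] nP|C' [cC' sub']] := frontier_cell hS hSk cC (dRj j).
- move=> y /sub [z [[_ nRz] Dz] <-] [z' [Rz' Dz'] /(chart_inj Dz' Dz) E].
  by apply: nRz; rewrite -E.
- have [a [b [zab Hab]]] := nP; rewrite -(tchartE Dz) in zab.
  have [z' [Rz' [Dz' zab']]] := FR z Fz _ (nbhs_bx (conj Dz zab : bx _ _ z)).
  exists (chart j z'); first by exists z'.
  by apply: Hab; rewrite -(tchartE Dz').
apply: lt_le_trans (dim_ge j r.+1 C' cC' _); first by rewrite lte_fin ltz_nat.
by move=> y /sub' [z [Rz Dz] <-]; exists z => //; split=> //; apply: RF.
Qed.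

(** * Almost everywhere curve selection *)

(** [V] is a box of a chart inside a definably compact neighbourhood of [z]. As [V]
    is open, the frontier of [C] in [V] is that of the intersection of [C] with [V]. *)
Lemma almost_everywhere_curve_selection (C : set X) z :
  locally_definably_compact D -> dfp C -> (closure C `\` C) z ->
  exists V : set X,
    [/\ open V, dfp V, V z, definably_compact D (closure V) &
      exists E : set X,
        [/\ dfp E, E `<=` (closure C `\` C) `&` V,
            (dimX D E < dimX D ((closure C `&` V) `\` (C `&` V)))%E &
            forall x : X,
              ((closure C `&` V) `\` ((C `&` V) `|` E)) x ->
              exists (a b : option M) (c : M -> X),
                definable_curve D (C `&` V) a b c /\
                curve_limit_point a b c x]].
Proof.
move=> hlc dC [clz nCz].
have [K Kz cK] := hlc z; have [j Dz] := ex_dom z.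
have [a [b [zab sub]]] := bx_basis Dz Kz.
pose (V := bx a b : set X).
have oV : open V by apply: open_bx.
have dV : dfp V by have h : dfp (fun x => bx a b x) by dfn.
have dA : dfp (C `&` V) by apply: dfp_and.
have Vz : V z := zab.
have AV : C `&` V `<=` V by move=> ? [].
have V0 : V !=set0 by exists z.
have Vj : V `<=` dom j by move=> ? [].
have cV := compact_closure cK dV sub.
have VclV : V `<=` closure V by apply: subset_closure.
have [R [dR RF Rcurve FR]] := reachable_dense cV dV dA oV AV VclV V0 Vj.
have FE : (closure C `&` V) `\` (C `&` V) = (closure (C `&` V) `\` (C `&` V)) `&` V.
  apply/seteqP; split=> x [[h1 h2] h3].
    split=> //; split=> // U Ux.
    have [y [Cy [Uy Vy]]] := h1 _ (filterI Ux (open_nbhs_nbhs (conj oV h2))).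
    by exists y.
  by split=> //; split=> // U /h1 [y [[Cy _] Uy]]; exists y.
pose F := (closure C `&` V) `\` (C `&` V).
have dcl := dfp_closure dC.
have dF : dfp F.
  by apply: dfp_and; [apply: dfp_and|apply: dfp_not].
exists V; split=> //; exists (F `\` R); split.
- by apply: dfp_and => //; apply: dfp_not.
- by move=> x [[[h1 h2] h3] _]; split=> //; split=> // Cx; apply: h3.
- by apply: dense_dim => //; [rewrite /F FE|rewrite /F FE|exists z; split=> // -[]].
move=> x [[h1 h2] h3]; apply: Rcurve; apply: contrapT => nR; apply: (h3); right.
by split=> //; split=> // CVx; apply: h3; left.
Qed.

End Space.

Unset Implicit Arguments.
Local Close Scope order_scope.

Theorem theorem2p18 (d : Order.disp_t) (M : orderTopologicalType d)
    (L : language) (S : structure L M)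
    (hS : o_minimal S) (hSk : definable_skolem_functions S)
    (X : topologicalType) (D : definable_space S X)
    (hX : hausdorff_space X) (hlc : locally_definably_compact D)
    (C : set X) (hC : definable_sub D C) (hnC : ~ closed C) :
  forall z : X, (closure C `\` C) z ->
  exists V : set X,
    [/\ open V, definable_sub D V, V z, definably_compact D (closure V) &
      exists E : set X,
        [/\ definable_sub D E,
            E `<=` (closure C `\` C) `&` V,
            (dimX D E < dimX D ((closure C `&` V) `\` (C `&` V)))%E &
            forall x : X,
              ((closure C `&` V) `\` ((C `&` V) `|` E)) x ->
              exists (a b : option M) (c : M -> X),
                definable_curve D (C `&` V) a b c /\
                curve_limit_point a b c x]].
Proof.
have [[m0] _ _ _] := hS => z.
pose i0 : has_point M := m0.
have [m1 m01] := gt_ex hS m0.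
have m10 : m1 <> i0 by apply/eqP; rewrite gt_eqF.
have sub_dfp A := definable_sub_dfp D m10 A.
move=> /(almost_everywhere_curve_selection (m01 := m10) hS hSk hX hlc
  ((sub_dfp C).1 hC)) [V [oV dV Vz cV [E [dE EF dimE cE]]]].
exists V; split=> //; first exact/sub_dfp.
by exists E; split=> //; apply/sub_dfp.
Qed.
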